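(* Let $\alpha=\alpha_{-5}\approx 4.0796$ be the real root of $t^3-5t^2+4t-1$ and let $\beta=\alpha/(\alpha-1)$. Then $$\dim_H(\partial\mathcal{F}_\alpha)=\frac{2\log(\mu)}{\log(\beta)}\approx 1.92089,$$ where $\mu\approx 1.31007$ is the dominant root of $$t^{21}-t^{20}+t^{19}-t^{18}+t^{17}-2t^{16}+t^{15}-2t^{14}+2t^{13}-3t^{12}+t^{11}+t^9-2t^8-3t^6-2t^5-2t^4-t^3-t^2+t+1.$$
   Context: Fix a non-real Galois conjugate $\alpha'$ of $\alpha$ and let $\psi:\mathbb{Q}(\alpha)\to\mathbb{C}$ be the field embedding with $\psi(\alpha)=\alpha'$. Both $\alpha$ and $\beta$ are Pisot units, so $f_L(x)=\psi(\alpha)x$ and $f_R(x)=\psi(\beta)(\psi(1)-x)$ are contractions of $\mathbb{C}$. The tent-tile $\mathcal{F}_\alpha$ is the unique non-empty compact set $\mathcal{F}_\alpha\subset\mathbb{C}$ with $\mathcal{F}_\alpha=f_L(\mathcal{F}_\alpha)\cup f_R(\mathcal{F}_\alpha)$. $\dim_H$ denotes Hausdorff dimension and $\partial$ the topological boundary. The dominant root of a polynomial is its root of largest modulus. *)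

(* Defs.v *)
From HB Require Import structures.
From mathcomp Require Import all_boot all_order all_algebra.
From mathcomp Require Import complex.
From mathcomp Require Import all_classical all_reals all_analysis.

Set Implicit Arguments.
Unset Strict Implicit.
Unset Printing Implicit Defensive.

Import Order.TTheory GRing.Theory Num.Theory.
Import numFieldNormedType.Exports.
Import ComplexField.Normc.

Local Open Scope classical_set_scope.
Local Open Scope ring_scope.
Local Open Scope complex_scope.

Definition alpha_poly (K : nzRingType) : {poly K} :=
  'X^3 - 5 *: 'X^2 + 4 *: 'X - 1.

(* For a subset of a field, closure under 1, subtraction and division
   ([x / 0 = 0]) says that it is a subfield; so this is Q(a) when [K] has
   characteristic 0. *)
Definition Qadjoin (K : fieldType) (a : K) : set K :=
  smallest (fun S : set K => divring_closed (mem S)) [set a].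

(* A field embedding of the subfield [S] of [K] in [L]; the values of [psi]
   outside of [S] are irrelevant. *)
Definition field_embedding (K L : fieldType) (S : set K) (psi : K -> L) : Prop :=
  [/\ psi 1 = 1,
      (forall x y, S x -> S y -> psi (x + y) = psi x + psi y) &
      (forall x y, S x -> S y -> psi (x * y) = psi x * psi y)].

(* [m] is the minimal polynomial of [a] over Q. *)
Definition galois_conjugate (K L : fieldType) (a : K) (z : L) : Prop :=
  exists m : {poly rat}, [/\ m \is monic, irreducible_poly m,
    root (map_poly ratr m) a & root (map_poly ratr m) z].

(* The complex plane is [R[i]^o], the library's name for the field [R[i]] seen
   as a normed space over itself, which carries the usual topology. *)

Section TentTile.
Variables (R : realType) (psi : R -> R[i]) (alpha : R).

Definition tent_beta : R := alpha / (alpha - 1).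

Definition tent_L (x : R[i]) : R[i] := psi alpha * x.

Definition tent_R (x : R[i]) : R[i] := psi tent_beta * (psi 1 - x).

Definition is_tent_tile (F : set R[i]^o) : Prop :=
  [/\ F !=set0, compact F & F = tent_L @` F `|` tent_R @` F].

End TentTile.

Definition boundary (T : topologicalType) (A : set T) : set T :=
  closure A `\` A°.

Section Hausdorff.
Variables (R : realType) (T : choiceType) (dist : T -> T -> R).
Local Open Scope ereal_scope.

(* [-oo] on the empty set. *)
Definition diam (U : set T) : \bar R :=
  ereal_sup [set (dist p.1 p.2)%:E | p in U `*` U].

(* The empty set counts for 0 also when [s = 0]. *)
Definition hausdorff_gauge (s : R) (U : set T) : \bar R :=
  if U == set0 then 0 else poweR (diam U) s.

Definition hausdorff_premeasure (s delta : R) (A : set T) : \bar R :=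
  ereal_inf [set \sum_(0 <= k <oo) hausdorff_gauge s (U k) | U in
    [set U : nat -> set T | A `<=` \bigcup_k U k /\
                            forall k, diam (U k) <= delta%:E]].

Definition hausdorff_measure (s : R) (A : set T) : \bar R :=
  ereal_sup [set hausdorff_premeasure s delta A |
             delta in [set delta : R | (0 < delta)%R]].

Definition hausdorff_dim (A : set T) : \bar R :=
  ereal_inf [set s%:E | s in
    [set s : R | (0 <= s)%R /\ hausdorff_measure s A = 0]].

End Hausdorff.

Definition complex_dist (R : realType) (x y : R[i]) : R := normc (x - y).

Definition dominant_root (R : realType) (p : {poly R[i]}) (z : R[i]) : Prop :=
  root p z /\ forall w, root p w -> w != z -> normc w < normc z.

Definition mu_poly (K : nzRingType) : {poly K} :=
  'X^21 - 'X^20 + 'X^19 - 'X^18 + 'X^17 - 2 *: 'X^16 + 'X^15 - 2 *: 'X^14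
  + 2 *: 'X^13 - 3 *: 'X^12 + 'X^11 + 'X^9 - 2 *: 'X^8 - 3 *: 'X^6
  - 2 *: 'X^5 - 2 *: 'X^4 - 'X^3 - 'X^2 + 'X + 1.

(* [decimal_expansion R n [:: d_1; ...; d_k]] is the number n.d_1...d_k *)
Definition decimal_expansion (R : realType) (n : nat) (ds : seq nat) : R :=
  n%:R + foldr (fun d x => (d%:R + x) / 10) 0 ds.

(* The printed decimal is correctly rounded: the error is at most half a unit
   in its last place. *)
Definition rounds_to (R : realType) (x : R) (n : nat) (ds : seq nat) : Prop :=
  `|x - decimal_expansion R n ds| <= 2^-1 / 10 ^+ size ds.

(* Main.v *)
(* Here [beta] is the plastic number, [beta^3 = beta + 1], and [alpha = beta^5]. With
   [b = psi beta], where [|b|^2 = 1/beta], the tile [F] is the attractor of the maps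
   [z |-> b^5 z] and [z |-> b (1 - z)]. Pairs [(F, gF)], where [g] is a neighbor map
   [z |-> +-b^j z + t] with [t] in [Z[b]], are subdivided along the branches into pairs
   of the same kind; up to similarity only finitely many of them meet. They form the
   boundary graph, in which the number of pieces of size [|b|^n] grows like [mu^n].

   Upper bound: the orbits of the points of [Z[beta]] under the tent map show that the
   images [+-b^j F + t] with [j <= 4] cover the plane, only finitely many of them near any
   point. So one of them, and hence [F], has interior points, and the boundary of [F]
   is covered by finitely many intersections [F `&` gF], each of which is covered by
   [O(mu^n)] discs of radius [O(|b|^n)].

   Lower bound: since [mu < beta], these intersections have no interior points, so
   [F `&` gF] lies in the boundary of [F]. The eigenvector of the graph for [mu] defines
   a mass distribution on its infinite paths. A disc of radius [|b|^n] meets a bounded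
   number of the tiles of that size, because distinct words of equal weight give
   distinct maps with translation parts in a bounded box of [Z[beta]]; hence it has
   mass [O(mu^-n)]. *)

Require Import Defs.
From Stdlib Require Import BinInt.
From HB Require Import structures.
From mathcomp Require Import all_boot all_order all_algebra.
From mathcomp Require Import complex.
From mathcomp Require Import all_classical all_reals all_analysis.
From mathcomp Require Import ring lra zify ssrZ.

Set Implicit Arguments.
Unset Strict Implicit.
Unset Printing Implicit Defensive.

Import Order.TTheory GRing.Theory Num.Theory.
Import numFieldNormedType.Exports.
Import ComplexField.Normc.

Local Open Scope classical_set_scope.
Local Open Scope ring_scope.
Local Open Scope complex_scope.

(** * Balls and compact sets in the complex plane *)

(** Every geometric decision reduces to integer arithmetic. A translation is a triple of integers,
    read in R through [beta] and in C through [b]; the two readings make Z[beta] a lattice in R x C,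
    so bounds on both values leave finitely many elements. This is behind each finiteness claim. The
    ratios b^5 and b differ in size, so pieces are counted by weight instead of word length, and
    always the larger tile of a pair is subdivided; this keeps the exponent of a neighbor map at
    most 5. Perron-Frobenius theory is replaced by an explicit eigenvector with entries in Z[mu],
    whose equation is checked modulo [mu_poly]. It is not strictly positive: some pairs survive
    every subdivision and yet carry no growth. They have entry 0, and an integer correction accounts
    for them in the count. No measure is constructed for the lower bound. A Hausdorff cover is first
    replaced by finitely many discs; if their total were too small, a walk down the tree of pairs
    avoiding the cylinders near the discs would reach a point of [F] and [gF] that no disc
    covers. *)

Section ComplexMetric.
Variable R : realType.
Implicit Types (z w : R[i]) (A : set R[i]^o).

Lemma normcE_norm z : `|z| = (normc z)%:C.
Proof. by []. Qed.

Lemma normc_ge0 z : 0 <= normc z.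
Proof. by case: z => a b /=; rewrite sqrtr_ge0. Qed.

Lemma normcD z w : normc (z + w) <= normc z + normc w.
Proof. exact: le_normcD. Qed.

Lemma normcN z : normc (- z) = normc z.
Proof. exact: normcN. Qed.

Lemma normcB z w : normc (z - w) = normc (w - z).
Proof. by rewrite -normcN opprB. Qed.

Lemma normcX z n : normc (z ^+ n) = normc z ^+ n.
Proof. by elim: n => [|n IH]; rewrite ?expr0 ?normc1// !exprS normcM IH. Qed.

Lemma normc_eq0 z : (normc z == 0) = (z == 0).
Proof.
by apply/eqP/eqP => [/eq0_normc//|->]; exact: normc0.
Qed.

Lemma normc_gt0 z : (0 < normc z) = (z != 0).
Proof. by rewrite lt_def normc_ge0 andbT normc_eq0. Qed.

Lemma normc_real (x : R) : normc x%:C = `|x|.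
Proof. by rewrite /= expr0n addr0 sqrtr_sqr. Qed.

Lemma normc_dist z w t : normc (z - t) <= normc (z - w) + normc (w - t).
Proof. by rewrite -[z - t](subrKA w) normcD. Qed.

(** A positive element of R[i] is real, so balls with radii in R[i] may be exchanged for balls with
    real radii. *)
Lemma nbhs_normc z (A : set R[i]^o) : nbhs (z : R[i]^o) A <->
  exists2 e : R, 0 < e & forall w, normc (w - z) < e -> A w.
Proof.
split=> [/nbhs_ballP[e /= e0 zA]|[e e0 zA]].
  have eR : e = (complex.Re e)%:C.
    by move: e0; case: e {zA} => a b; rewrite ltcE /= => /andP[/eqP -> _].
  exists (complex.Re e) => [|w wz].
    by rewrite -ltcR -eR.
  apply: zA; rewrite -ball_normE /= normcE_norm eR ltcR.
  by rewrite normcB.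
apply/nbhs_ballP; exists e%:C; first by rewrite /= ltcR.
move=> w; rewrite -ball_normE /= normcE_norm ltcR => zw.
by apply: zA; rewrite normcB.
Qed.

Lemma interior_normc A z : A° z <->
  exists2 e : R, 0 < e & forall w, normc (w - z) < e -> A w.
Proof. exact: nbhs_normc. Qed.

Lemma closure_normc A z : closure A z <->
  forall e : R, 0 < e -> exists2 w, A w & normc (w - z) < e.
Proof.
split=> [clA e e0|H B].
  have /clA[w [Aw wz]] : nbhs (z : R[i]^o) [set w | normc (w - z) < e].
    by apply/nbhs_normc; exists e.
  by exists w.
move=> /nbhs_normc[e e0 eB]; have [w Aw wz] := H _ e0.
by exists w; split=> //; exact: eB.
Qed.

(** Compactness with a real radius chosen at each point of [K]; the freedom in this choice gives
    separation, boundedness and finite subcovers directly. *)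
Definition ball_cover_compact (K : set R[i]) := forall e : R[i] -> R,
  (forall p, K p -> 0 < e p) ->
  exists2 s : seq R[i], (forall p, p \in s -> K p) &
    forall q, K q -> exists2 p, p \in s & normc (q - p) < e p.

Lemma compact_normc (K : set R[i]^o) : compact K -> ball_cover_compact K.
Proof.
rewrite compact_cover => cK e epos.
pose f (p : R[i]) : set R[i]^o := interior [set w : R[i]^o | normc (w - p) < e p].
have [D DK KD] : finite_subset_cover K f K.
  apply: cK => [p Kp|q Kq]; first exact: open_interior.
  exists q => //; apply/interior_normc; exists (e q); first exact: epos.
  by move=> w.
exists (finmap.enum_fset D) => [p pD|q /KD[p pD pq]].
  by move: (DK _ pD); rewrite inE.
exists p => //; have /interior_normc[r r0 H] := pq.
by apply: H; rewrite subrr normc0.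
Qed.

Lemma ball_cover_closed (K : set R[i]) : ball_cover_compact K ->
  forall z, ~ K z -> exists2 e : R, 0 < e & forall w, K w -> e <= normc (w - z).
Proof.
move=> cK z Kz.
have pos p : K p -> 0 < normc (p - z) / 2.
  by move=> Kp; rewrite divr_gt0// normc_gt0 subr_eq0; apply: contra_notN Kz => /eqP <-.
have [s sK Ks] := cK _ pos.
have [e e0 es] : exists2 e : R, 0 < e & forall p, p \in s -> e <= normc (p - z) / 2.
  elim: s sK {Ks} => [_|p s IH sK]; first by exists 1.
  have [|e e0 es] := IH; first by move=> q qs; apply: sK; rewrite inE qs orbT.
  exists (Num.min e (normc (p - z) / 2)).
    by rewrite lt_min e0 pos//; apply: sK; rewrite mem_head.
  move=> q; rewrite inE => /orP[/eqP ->|/es qs]; first by rewrite ge_min lexx orbT.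
  by rewrite ge_min qs.
exists e => // w /Ks[p ps wp].
have := es _ ps; have := normc_dist p w z; rewrite (normcB p w).
lra.
Qed.

Lemma ball_cover_bounded (K : set R[i]) : ball_cover_compact K ->
  exists2 M : R, 0 < M & forall w, K w -> normc w <= M.
Proof.
move=> cK; have [s _ Ks] := cK (fun=> 1) (fun _ _ => ltr01).
exists (\sum_(p <- s) (normc p) + 1).
  by rewrite ltr_wpDl// sumr_ge0// => i _; exact: normc_ge0.
move=> w /Ks[p ps wp].
have : normc p <= \sum_(p <- s) (normc p).
  by rewrite (big_rem p)//= lerDl sumr_ge0// => i _; exact: normc_ge0.
have := normcD (w - p) p; rewrite subrK.
lra.
Qed.

End ComplexMetric.

(** * Hausdorff measures and finite covers *)

Section HausdorffCovers.
Variable R : realType.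
Notation dist := (@complex_dist R).
Implicit Types (A K U : set R[i]) (s d : R).

Lemma diam_ge (U : set R[i]) x y : U x -> U y ->
  ((normc (x - y))%:E <= diam dist U)%E.
Proof. by move=> Ux Uy; apply: ereal_sup_ubound; exists (x, y). Qed.

Lemma diam_le (U : set R[i]) d :
  (forall x y, U x -> U y -> normc (x - y) <= d) -> (diam dist U <= d%:E)%E.
Proof.
move=> Ud; apply: ge_ereal_sup => _ [[x y] [/= Ux Uy] <-].
by rewrite lee_fin; exact: Ud.
Qed.

Lemma diam_fin U d : U !=set0 -> (diam dist U <= d%:E)%E ->
  exists2 e, 0 <= e <= d & diam dist U = e%:E.
Proof.
move=> [x Ux] Ud; have := diam_ge Ux Ux; rewrite subrr normc0.
move: Ud; case: (diam dist U) => [e| |] //.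
by rewrite !lee_fin => ed e0; exists e; rewrite ?ed ?e0.
Qed.

Lemma hausdorff_gauge_ge0 s U : (0 <= hausdorff_gauge dist s U)%E.
Proof.
by rewrite /hausdorff_gauge; case: ifP => // _; exact: poweR_ge0.
Qed.

Lemma hausdorff_premeasure_ge0 s d A : (0 <= hausdorff_premeasure dist s d A)%E.
Proof.
apply: le_ereal_inf_tmp => _ [U _ <-]; apply: nneseries_ge0 => k _ _.
exact: hausdorff_gauge_ge0.
Qed.

Lemma hausdorff_measure_ge0 s A : (0 <= hausdorff_measure dist s A)%E.
Proof.
apply: (le_trans (hausdorff_premeasure_ge0 s 1 A)).
by apply: ereal_sup_ubound; exists 1 => //=.
Qed.

Lemma gauge_le s d U : 0 <= s ->
  (forall x y, U x -> U y -> normc (x - y) <= d) ->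
  (hausdorff_gauge dist s U <= (d `^ s)%:E)%E.
Proof.
move=> s0 Ud; rewrite /hausdorff_gauge; case: ifPn => [_|/set0P U0].
  by rewrite lee_fin powR_ge0.
have [e /andP[e0 ed] ->] := diam_fin U0 (diam_le Ud).
by rewrite poweR_EFin lee_fin ge0_ler_powR// nnegrE ?(le_trans e0).
Qed.

Lemma hausdorff_measure0_cover s A : 0 < s ->
  (forall delta eps : R, 0 < delta -> 0 < eps ->
    exists (m : nat) (d : R) (U : nat -> set R[i]),
    [/\ 0 <= d <= delta,
        forall k x y, (k < m)%N -> U k x -> U k y -> normc (x - y) <= d,
        forall z, A z -> exists2 k, (k < m)%N & U k z &
        m%:R * d `^ s <= eps]) ->
  hausdorff_measure dist s A = 0%E.
Proof.
move=> s0 H; apply/eqP; rewrite eq_le hausdorff_measure_ge0 andbT.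
apply: ge_ereal_sup => _ [delta /= delta0 <-].
apply/lee_addgt0Pr => eps eps0; rewrite add0e.
have [m [d [U [/andP[d0 dd] Ud AU mde]]]] := H _ _ delta0 eps0.
(* The empty set has gauge 0, so it can pad the finite cover to a sequence. *)
pose V k := if (k < m)%N then U k else set0.
have Vd k x y : V k x -> V k y -> normc (x - y) <= d.
  by rewrite /V; case: ifP => // km; exact: Ud.
apply: (@le_trans _ _ (\sum_(0 <= k <oo) hausdorff_gauge dist s (V k))%E).
  apply: ereal_inf_lbound; exists V => //; split=> [z /AU[k km Uk]|k].
    by exists k => //; rewrite /V km.
  by apply: diam_le => x y /Vd/[apply] /le_trans; apply.
rewrite (nneseries_split 0%N m) => [|k _]; last exact: hausdorff_gauge_ge0.
rewrite [X in (_ + X)%E]eseries0 ?adde0; last first.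
  move=> i /= mi _; rewrite /V ltnNge; move: mi; rewrite add0n => -> /=.
  by rewrite /hausdorff_gauge eqxx.
apply: (@le_trans _ _ (\sum_(0 <= k < m) (d `^ s)%:E)%E); last first.
  by rewrite sumEFin lee_fin sumr_const_nat subn0 -mulr_natl.
rewrite add0n !big_mkord; apply: lee_sum => k _; apply: gauge_le; first exact: ltW.
exact: Vd.
Qed.

Lemma sum_half_lt (N : nat) : \sum_(0 <= k < N) (2^-1 ^+ k.+1 : R) <= 1.
Proof.
suff -> : \sum_(0 <= k < N) (2^-1 ^+ k.+1 : R) = 1 - 2^-1 ^+ N.
  by rewrite gerBl exprn_ge0// invr_ge0.
elim: N => [|N IH]; first by rewrite big_nil expr0 subrr.
by rewrite big_nat_recr//= IH exprS; field.
Qed.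

Lemma ler_sum_uniq (f : nat -> R) (ks : seq nat) (N : nat) : uniq ks ->
  (forall k, 0 <= f k) -> (forall k, k \in ks -> (k < N)%N) ->
  \sum_(k <- ks) f k <= \sum_(0 <= k < N) f k.
Proof.
move=> uks f0 ksN.
rewrite (perm_big [seq k <- index_iota 0 N | k \in ks]) /=.
  rewrite big_filter big_mkcond/=; apply: ler_sum => k _.
  by case: ifP.
apply: uniq_perm => //; first by rewrite filter_uniq// iota_uniq.
move=> k; rewrite mem_filter mem_index_iota /=.
by case: (boolP (k \in ks)) => //= /ksN ->.
Qed.

(** Each set [U k] of an economical cover is enlarged to balls of radius [rho k] slightly above its
    diameter, with rho^s at most diam^s plus a term of a geometric series; compactness then selects
    finitely many. Recentring the balls at one point of [U k] doubles the radius, whence the factor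
    2^s. Diameters at most 1/4 leave room for [rho k] up to 1/2 and final radii up to 1. *)
Lemma hausdorff_measure0_balls s A K : 0 <= s ->
  hausdorff_measure dist s A = 0%E -> K `<=` A -> ball_cover_compact K ->
  forall eps : R, 0 < eps -> exists B : seq (R[i] * R),
  [/\ forall c, c \in B -> 0 < c.2 <= 1,
      forall z, K z -> exists2 c, c \in B & normc (z - c.1) < c.2 &
      \sum_(c <- B) c.2 `^ s <= eps].
Proof.
move=> s0 HA KA cK eps eps0.
have pos2s : (0 : R) < 2 `^ s by rewrite powR_gt0.
pose et : R := Num.min (eps / 2 `^ s / 2) 2^-1.
have et0 : 0 < et by rewrite /et lt_min invr_gt0 ltr0n andbT !divr_gt0.
have etle : et <= eps / 2 `^ s / 2 by rewrite /et ge_min lexx.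
have et1 : et < 1.
  by apply: (@le_lt_trans _ _ (2^-1)); [rewrite /et ge_min lexx orbT|lra].
have : (hausdorff_premeasure dist s (4^-1) A < et%:E)%E.
  apply: (@le_lt_trans _ _ 0%E); last by rewrite lte_fin.
  by rewrite -HA; apply: ereal_sup_ubound; exists 4^-1 => /=; [lra|].
move=> /ereal_inf_lt[_ [U [AU Ud] <-] sumU].
have part N : (\sum_(0 <= k < N) hausdorff_gauge dist s (U k) < et%:E)%E.
  apply: le_lt_trans sumU; apply: nneseries_lim_ge => k _ _.
  exact: hausdorff_gauge_ge0.
have one k : (hausdorff_gauge dist s (U k) < et%:E)%E.
  apply: le_lt_trans (part k.+1); rewrite big_nat_recr//= leeDr//.
  by apply: sume_ge0 => i _; exact: hausdorff_gauge_ge0.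
(* For s = 0 a nonempty set has gauge 1, so a sum below 1 forces all [U k], and hence [K], to be
   empty. *)
have [s00|sn0] := eqVneq s 0.
  exists [::]; split=> //; last by rewrite big_nil ltW.
  move=> z /KA /AU[k _ Uz]; have := one k.
  rewrite /hausdorff_gauge; case: eqP => [U0|_]; first by rewrite U0 in Uz.
  by rewrite s00 poweRe0 lte_fin ltNge ltW.
have sp : 0 < s by rewrite lt_def sn0.
pose fg k := fine (hausdorff_gauge dist s (U k)).
have fgE k : hausdorff_gauge dist s (U k) = (fg k)%:E.
  rewrite /fg fineK// ge0_fin_numE ?hausdorff_gauge_ge0//.
  by apply: (lt_trans (one k)); rewrite ltry.
have fg0 k : 0 <= fg k by rewrite -lee_fin -fgE hausdorff_gauge_ge0.
pose eta k : R := et * 2^-1 ^+ k.+1.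
have eta0 k : 0 < eta k by rewrite /eta mulr_gt0// exprn_gt0// invr_gt0.
pose rho k := Num.min ((fg k + eta k) `^ s^-1) 2^-1.
have rho0 k : 0 < rho k.
  by rewrite /rho lt_min invr_gt0 ltr0n andbT powR_gt0// ltr_wpDl.
have rhos k : rho k `^ s <= fg k + eta k.
  apply: (@le_trans _ _ (((fg k + eta k) `^ s^-1) `^ s)).
    apply: ge0_ler_powR; rewrite ?nnegrE ?powR_ge0//; try exact: ltW.
    by rewrite /rho ge_min lexx.
  by rewrite -powRrM mulVf// powRr1// addr_ge0// ltW.
have rhod k x y : U k x -> U k y -> normc (x - y) < rho k.
  move=> Ux Uy; have Un : U k !=set0 by exists x.
  have [d /andP[d0 d4] dE] := diam_fin Un (Ud k).
  have := diam_ge Ux Uy; rewrite dE lee_fin => /le_lt_trans; apply.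
  rewrite /rho lt_min; apply/andP; split; last by lra.
  have -> : fg k = d `^ s.
    have := fgE k; rewrite /hausdorff_gauge; case: eqP => [U0|_].
      by rewrite U0 in Ux.
    by rewrite dE poweR_EFin => -[->].
  rewrite -[ltLHS](powRr1 d0) -(mulfV sn0) powRrM.
  by rewrite gt0_ltr_powR ?invr_gt0// ?nnegrE ?addr_ge0 ?powR_ge0 ?ltW// ltrDl.
have kP (z : R[i]) : exists k, K z -> U k z.
  have [/KA/AU[k _ Uz]|] := pselect (K z); first by exists k.
  by exists 0%N.
have [kk kkP] := choice kP.
have xP (k : nat) : exists x, (exists z, U k z) -> U k x.
  have [[z Uz]|] := pselect (exists z, U k z); first by exists z.
  by exists 0.
have [xx xxP] := choice xP.
have [t tK Kt] := cK (fun p => rho (kk p)) (fun p _ => rho0 (kk p)).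
(* Several centres may share an index; without duplicates each term of the series is used once. *)
pose ks := undup (map kk t).
exists [seq (xx k, 2 * rho k) | k <- ks]; split=> [_ /mapP[k _ ->] /=|z|].
- rewrite mulr_gt0//=.
  have : rho k <= 2^-1 by rewrite /rho ge_min lexx orbT.
  lra.
- move=> /Kt[p pt zp]; exists (xx (kk p), 2 * rho (kk p)).
    by apply/mapP; exists (kk p) => //; rewrite mem_undup map_f.
  have Up := kkP _ (tK _ pt).
  have := rhod _ _ _ Up (xxP _ (ex_intro _ _ Up)).
  have /= := normc_dist z p (xx (kk p)).
  lra.
rewrite big_map /=.
apply: (@le_trans _ _ (2 `^ s * \sum_(k <- ks) (fg k + eta k))).
  rewrite big_distrr/=; apply: ler_sum => k _.
  by rewrite powRM// ?(ltW (rho0 k))// ler_wpM2l// ltW.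
suff : \sum_(k <- ks) (fg k + eta k) <= et + et.
  move=> h; apply: (@le_trans _ _ (2 `^ s * (et + et))); first by rewrite ler_wpM2l// ltW.
  have -> : eps = 2 `^ s * (eps / 2 `^ s / 2 + eps / 2 `^ s / 2).
    by field; rewrite gt_eqF.
  by apply: ler_wpM2l; [exact: ltW|apply: lerD].
pose N := (\max_(k <- ks) k).+1.
apply: (@le_trans _ _ (\sum_(0 <= k < N) (fg k + eta k))).
  apply: ler_sum_uniq => [|k|k kks]; first exact: undup_uniq.
    by rewrite addr_ge0// ltW.
  by rewrite ltnS; apply: leq_bigmax_seq.
rewrite big_split/=; apply: lerD.
  have := part N; rewrite (eq_bigr (fun k => (fg k)%:E)) => [|k _]; last exact: fgE.
  by rewrite sumEFin lte_fin => /ltW.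
rewrite /eta -big_distrr/= -[leRHS]mulr1 ler_wpM2l ?(ltW et0)//.
exact: sum_half_lt.
Qed.

Lemma hausdorff_dimE A s : 0 <= s ->
  (forall t, s < t -> hausdorff_measure dist t A = 0%E) ->
  (forall t, 0 <= t < s -> hausdorff_measure dist t A <> 0%E) ->
  hausdorff_dim dist A = s%:E.
Proof.
move=> s0 up low; apply/eqP; rewrite eq_le; apply/andP; split.
  apply/lee_addgt0Pr => e e0; apply: ereal_inf_lbound.
  exists (s + e) => //; split; first by rewrite addr_ge0// ltW.
  by apply: up; rewrite ltrDl.
apply: le_ereal_inf_tmp => _ [t [t0 Ht] <-]; rewrite lee_fin leNgt.
by apply/negP => ts; apply: (low t) => //; rewrite t0.
Qed.

End HausdorffCovers.

(** * Arithmetic in Z[beta] and neighbor maps *)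

Delimit Scope Z_scope with coq_Z.

(* [(p, q, s)] stands for [p + q x + s x^2], where [x^3 = x + 1]. *)
Definition zbeta : Type := (Z * Z * Z)%type.

Definition zadd (t u : zbeta) : zbeta :=
  let: (p, q, s) := t in let: (p', q', s') := u in
  (Z.add p p', Z.add q q', Z.add s s').

Definition zopp (t : zbeta) : zbeta :=
  let: (p, q, s) := t in (Z.opp p, Z.opp q, Z.opp s).

Definition zsub (t u : zbeta) : zbeta := zadd t (zopp u).

Definition zone : zbeta := (1%coq_Z, 0%coq_Z, 0%coq_Z).

Definition zmulx (t : zbeta) : zbeta :=
  let: (p, q, s) := t in (s, Z.add p s, q).

(** The generator is a unit: 1/x = x^2 - 1. *)
Definition zdivx (t : zbeta) : zbeta :=
  let: (p, q, s) := t in (Z.sub q p, s, p).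

Definition zsign (e : bool) (t : zbeta) : zbeta := if e then zopp t else t.

Section Evaluation.
Variables (K : comNzRingType) (x : K).

(* Locked, since unfolding it turns binary numerals into unary ones. *)
Definition zr (n : Z) : K := locked (fun m => (int_of_Z m)%:~R) n.

Lemma zrE n : zr n = (int_of_Z n)%:~R.
Proof. by rewrite /zr -lock. Qed.


Lemma zrD m n : zr (Z.add m n) = zr m + zr n.
Proof. by rewrite !zrE -intrD; congr (_%:~R); lia. Qed.
Lemma zrN m : zr (Z.opp m) = - zr m.
Proof. by rewrite !zrE -mulrNz; congr (_%:~R); lia. Qed.
Lemma zrB m n : zr (Z.sub m n) = zr m - zr n.
Proof. by rewrite -Z.add_opp_r zrD zrN. Qed.
Lemma zrM m n : zr (Z.mul m n) = zr m * zr n.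
Proof. by rewrite !zrE -intrM; congr (_%:~R); lia. Qed.
Lemma zr0 : zr 0%coq_Z = 0.
Proof. by rewrite zrE. Qed.
Lemma zr1 : zr 1%coq_Z = 1.
Proof. by rewrite zrE. Qed.

Definition zev (t : zbeta) : K :=
  let: (p, q, s) := t in zr p + zr q * x + zr s * x ^+ 2.

Lemma zevD t u : zev (zadd t u) = zev t + zev u.
Proof. by case: t u => [[p q] s] [[p' q'] s'] /=; rewrite !zrD; ring. Qed.

Lemma zevN t : zev (zopp t) = - zev t.
Proof. by case: t => [[p q] s] /=; rewrite !zrN; ring. Qed.

Lemma zevB t u : zev (zsub t u) = zev t - zev u.
Proof. by rewrite zevD zevN. Qed.

Lemma zev1 : zev zone = 1.
Proof. by rewrite /= zr1 zr0; ring. Qed.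

Lemma zev_sign e t : zev (zsign e t) = (-1) ^+ e * zev t.
Proof. by case: e; rewrite /= ?zevN ?expr0 ?expr1 ?mulN1r ?mul1r. Qed.

Hypothesis x3 : x ^+ 3 = x + 1.

Lemma zev_mulx t : zev (zmulx t) = x * zev t.
Proof.
case: t => [[p q] s] /=; rewrite zrD.
have -> : x * (zr p + zr q * x + zr s * x ^+ 2)
  = zr p * x + zr q * x ^+ 2 + zr s * x ^+ 3 by ring.
by rewrite x3; ring.
Qed.

Lemma zdivxK : cancel zdivx zmulx.
Proof. by case=> [[p q] s] /=; congr (_, _, _); lia. Qed.

Lemma zev_divx t : x * zev (zdivx t) = zev t.
Proof. by rewrite -zev_mulx zdivxK. Qed.

Lemma zev_mulxn n t : zev (iter n zmulx t) = x ^+ n * zev t.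
Proof. by elim: n => [|n IH] /=; rewrite ?mul1r// zev_mulx IH exprS mulrA. Qed.

Lemma zev_divxn n t : x ^+ n * zev (iter n zdivx t) = zev t.
Proof.
elim: n => [|n IH] /=; first by rewrite mul1r.
by rewrite exprSr -mulrA zev_divx.
Qed.

End Evaluation.

Arguments zadd : simpl never.
Arguments zopp : simpl never.
Arguments zsub : simpl never.
Arguments zmulx : simpl never.
Arguments zdivx : simpl never.
Arguments zev : simpl never.

(* The letters [false] and [true] stand for the branches [f_L] and [f_R], whose
   ratios are [x^5] and [- x]. *)
Definition wt1 (s : bool) : nat := if s then 1 else 5.

Section Branches.
Variables (K : comNzRingType) (x : K).

Definition branch (s : bool) (z : K) : K :=
  if s then x * (1 - z) else x ^+ 5 * z.

Definition fword (u : seq bool) (z : K) : K := foldr branch z u.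

End Branches.

Definition weight (u : seq bool) : nat := sumn (map wt1 u).
Definition sgw (u : seq bool) : bool := odd (count id u).

Definition zbranch (s : bool) (t : zbeta) : zbeta :=
  if s then zmulx (zsub zone t) else iter 5 zmulx t.

Definition zword (u : seq bool) (t : zbeta) : zbeta := foldr zbranch t u.

Definition offset (u : seq bool) : zbeta := zword u (0, 0, 0)%coq_Z.

(* [(j, e, t)] stands for the map [z |-> (-1)^e x^j z + t]. *)
Definition nbmap : Type := (nat * bool * zbeta)%type.

Definition act (K : comNzRingType) (x : K) (g : nbmap) (z : K) : K :=
  let: (j, e, t) := g in (-1) ^+ e * x ^+ j * z + zev x t.

Section Words.
Variables (K : comNzRingType) (x : K).
Hypothesis x3 : x ^+ 3 = x + 1.

Lemma zev0 : zev x (0%coq_Z, 0%coq_Z, 0%coq_Z) = 0.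
Proof. by rewrite /zev /= zr0; ring. Qed.

Lemma zev_branch s t : zev x (zbranch s t) = branch x s (zev x t).
Proof.
rewrite /zbranch /branch; case: s; first by rewrite zev_mulx// zevB zev1.
exact: zev_mulxn.
Qed.

Lemma zev_word u t : zev x (zword u t) = fword x u (zev x t).
Proof. by elim: u => //= s u IH; rewrite zev_branch IH. Qed.

Lemma fword_diff u z w :
  fword x u z - fword x u w = (-1) ^+ sgw u * x ^+ weight u * (z - w).
Proof.
elim: u => [|s u IH]; first by rewrite !mul1r.
rewrite /weight /sgw; case: s => /=.
  rewrite add1n add0n exprS.
  have -> : (-1) ^+ (~~ odd (count id u)) = - (-1) ^+ odd (count id u) :> K.
    by case: (odd _); rewrite /= ?opprK// expr1.
  rewrite -mulrBr (_ : 1 - _ - _ = - (fword x u z - fword x u w)); last by ring.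
  by rewrite IH /weight /sgw; ring.
by rewrite -mulrBr IH add0n exprD /weight /sgw; ring.
Qed.

Lemma fwordE u z :
  fword x u z = (-1) ^+ sgw u * x ^+ weight u * z + zev x (offset u).
Proof.
by rewrite zev_word zev0 -[X in _ * X + _](subr0 z) -fword_diff subrK.
Qed.

Lemma fword_cat u v z : fword x (u ++ v) z = fword x u (fword x v z).
Proof. by rewrite /fword foldr_cat. Qed.

Lemma fword_rcons u s z : fword x (rcons u s) z = fword x u (branch x s z).
Proof. by rewrite -cats1 fword_cat. Qed.

End Words.

Lemma weight_cat u v : weight (u ++ v) = (weight u + weight v)%N.
Proof. by rewrite /weight map_cat sumn_cat. Qed.

Lemma weight_rcons u s : weight (rcons u s) = (weight u + wt1 s)%N.
Proof. by rewrite -cats1 weight_cat /weight /= addn0. Qed.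

Lemma size_weight u : (size u <= weight u)%N.
Proof.
elim: u => //= s u IH; rewrite /weight /= -/(weight u).
by case: s => /=; lia.
Qed.

(** Lexicographic order, used only to choose between a map and its inverse. *)
Definition zle (t u : zbeta) : bool :=
  let: (p, q, s) := t in let: (p', q', s') := u in
  if Z.ltb p p' then true else if Z.ltb p' p then false else
  if Z.ltb q q' then true else if Z.ltb q' q then false else Z.leb s s'.

(* The inverse of [(-1)^e z + t] is [(-1)^e z + flip e t]; one of these two maps
   is chosen as the representative. *)
Definition flip (e : bool) (t : zbeta) : zbeta := zopp (zsign e t).

(* Subdividing the larger tile [F] of a pair [(F, gF)] leads to the pairs
   [(f_s F, gF)]. Each is the image of a pair [(F, hF)] or [(hF, F)] with
   [h = child s g], by [f_s] or by [g], in which the first tile is again the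
   larger one; the boolean tells in which of the two cases we are. *)
Definition child (s : bool) (g : nbmap) : bool * nbmap :=
  let: (j, e, t) := g in
  let e' := s (+) e in
  let t' := if s then zsub zone (zdivx t) else iter 5 zdivx t in
  let w := wt1 s in
  if (w <= j)%N then
    if (w == j) && ~~ zle t' (flip e' t') then (true, (0%N, e', flip e' t'))
    else (false, ((j - w)%N, e', t'))
  else (true, ((w - j)%N, e', flip e' (iter (w - j) zmulx t'))).

(** After the subdivision the two tiles have exponents [wt1 s] and [g.1.1]; the larger tile is the
    one with the smaller exponent, and this is the loss of size of the pair. *)
Definition lvl (s : bool) (g : nbmap) : nat := minn (wt1 s) g.1.1.

Section Child.
Variables (K : comNzRingType) (x : K).
Hypothesis x3 : x ^+ 3 = x + 1.

Lemma zev_flip e t : zev x (flip e t) = - ((-1) ^+ e * zev x t).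
Proof. by rewrite zevN zev_sign. Qed.

(** [h] is g^-1 f_s in the first case and f_s^-1 g in the second. Written without inverses, the
    relation holds in any commutative ring with x^3 = x + 1, and so for [beta] and for [b]. *)
Lemma childP s g (h := (child s g).2) :
  if (child s g).1 then forall z, act x g (act x h z) = branch x s z
  else forall z, branch x s (act x h z) = act x g z.
Proof.
rewrite {}/h; case: g => [[j e] t].
set e' := s (+) e.
set t' := if s then zsub zone (zdivx t) else iter 5 zdivx t.
have sge (k : bool) : (-1) ^+ k * (-1) ^+ k = 1 :> K by rewrite -expr2 sqrr_sign.
have main z : branch x s (zev x t' + z) = (if s then -1 else 1) * x ^+ wt1 s * z + zev x t.
  rewrite /t' /branch; case: s {e' t'}.
    by rewrite zevB zev1 /= -[zev x t in RHS](zev_divx x3); ring.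
  by rewrite /= -[zev x t in RHS](zev_divxn x3 5); ring.
have e'E : (-1) ^+ e' = (if s then -1 else 1) * (-1) ^+ e :> K.
  by rewrite /e' signr_addb; case: s {main e' t'}; rewrite /= ?expr1 ?expr0.
have s2 : (if s then -1 else 1) * (if s then -1 else 1) = 1 :> K.
  by case: (s); rewrite ?mulN1r ?opprK ?mul1r.
rewrite /child -/e' -/t'; case: leqP => wj.
  case: (boolP (_ && _)) => [/andP[/eqP wE _]|_] z /=.
    rewrite zev_flip e'E expr0 mulr1.
    have := main (- zev x t' + z); rewrite addrA subrr add0r => ->; rewrite wE.
    have := sge e; set b := (-1) ^+ e; set a := (if s then _ else _) => bb.
    have -> : b * x ^+ j * (a * b * z - a * b * zev x t') + zev x t
      = a * (b * b) * x ^+ j * (z - zev x t') + zev x t by ring.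
    by rewrite bb; ring.
  rewrite addrC main e'E -[in RHS](subnKC wj) exprD.
  set a := (if s then _ else _) in s2 *.
  have -> : a * x ^+ wt1 s * (a * (-1) ^+ e * x ^+ (j - wt1 s) * z) + zev x t =
    (a * a) * x ^+ wt1 s * ((-1) ^+ e * x ^+ (j - wt1 s) * z) + zev x t by ring.
  by rewrite s2; ring.
move=> z /=; rewrite zev_flip zev_mulxn// e'E.
have := main (- zev x t' + z); rewrite addrA subrr add0r => ->.
have := sge e; set b := (-1) ^+ e; set a := (if s then _ else _) => bb.
rewrite -[in RHS](subnKC (ltnW wj)) exprD; set y := x ^+ (wt1 s - j).
have -> : b * x ^+ j * (a * b * y * z - a * b * (y * zev x t')) + zev x t
  = (b * b) * (a * (x ^+ j * y) * (z - zev x t')) + zev x t by ring.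
by rewrite bb; ring.
Qed.

Lemma lvl_child s g (h := (child s g).2) :
  if (child s g).1 then lvl s g = g.1.1 /\ (g.1.1 + h.1.1 = wt1 s)%N
  else lvl s g = wt1 s /\ (wt1 s + h.1.1 = g.1.1)%N.
Proof.
rewrite {}/h; case: g => [[j e] t]; rewrite /child /lvl.
case: leqP => wj.
  case: (boolP (_ && _)) => [/andP[/eqP wE _]|_] /=; last by split; lia.
  by move: wE; split; lia.
by split=> /=; lia.
Qed.

End Child.

(** * The plastic number and its conjugate *)

Lemma zr_complex (R : realType) n : zr R[i] n = (zr R n)%:C.
Proof. by rewrite !zrE rmorph_int. Qed.

Lemma zr_le (R : numDomainType) m n : (zr R m <= zr R n) = (Z.leb m n).
Proof. by rewrite !zrE ler_int; lia. Qed.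

Lemma zr_lt (R : numDomainType) m n : (zr R m < zr R n) = (Z.ltb m n).
Proof. by rewrite !zrE ltr_int; lia. Qed.

Lemma zr_nat (K : comNzRingType) n : zr K (Z.of_nat n) = n%:R.
Proof. by rewrite zrE (_ : int_of_Z (Z.of_nat n) = n)//; lia. Qed.

(** Real bounds are kept as integers in units of 10^-6; this is the scaling factor. *)
Definition mega (K : comNzRingType) : K := zr K 1000000%coq_Z.

(** The roots of x^3 - x - 1 have sum 0 and product 1. This gives the real part - beta/2 and |b|^2 =
    1/beta = beta^2 - 1, from which the imaginary part follows up to sign. *)
Definition plastic_pair (R : realType) (beta : R) (b : R[i]) : Prop :=
  [/\ beta ^+ 3 = beta + 1, zr R 1324717%coq_Z <= beta * mega R <= zr R 1324718%coq_Z,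
      complex.Re b = - beta / 2 &
      complex.Im b ^+ 2 = beta ^+ 2 - 1 - beta ^+ 2 / 4].

(* [|p + q b + s b^2|^2], as an element of [Z[beta]], obtained from
   [b + b^* = - beta] and [b b^* = beta^2 - 1]. *)
Definition znorm2 (t : zbeta) : zbeta :=
  let: (p, q, s) := t in
  (p * p - q * q + s * s + 2 * p * s - q * s, s * s - p * q, q * q - s * s - p * s)%coq_Z.

(* [10^6] times a lower bound for the value at [beta]. *)
Definition zlow (t : zbeta) : Z :=
  let: (p, q, s) := t in
  (p * 1000000 + q * (if Z.leb 0 q then 1324717 else 1324718)
   + s * (if Z.leb 0 s then 1754874 else 1754878))%coq_Z.

(* [b^-2]; the tile lies in the disc of radius 3/2 around it. *)
Definition zctr : zbeta := (1, 1, -1)%coq_Z.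

Definition act_ctr (g : nbmap) : zbeta :=
  let: (j, e, t) := g in
  zsub (zadd (zsign e (iter j zmulx zctr)) t) zctr.

(* [10^6] times upper bounds for [|b|^j]. *)
Definition rpow (j : nat) : Z :=
  nth 495102%coq_Z [:: 1000000; 868839; 754879; 655869; 569843; 495102]%coq_Z j.

(** With c = b^-2, the discs of radius 3/2 around c and 3/2 |b|^j around g(c) contain the two tiles.
    They are disjoint when 4 |g(c) - c|^2 > 9 (1 + |b|^j)^2; both sides are multiplied by 10^18. *)
Definition far (g : nbmap) : bool :=
  Z.ltb (9 * (1000000 + rpow g.1.1) * (1000000 + rpow g.1.1) * 1000000)
        (zlow (znorm2 (act_ctr g)) * 4000000000000).

Section Plastic.
Variables (R : realType) (beta : R) (b : R[i]).
Hypothesis pp : plastic_pair beta b.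

Let beta3 : beta ^+ 3 = beta + 1. Proof. by case: pp. Qed.
Let Reb : complex.Re b = - beta / 2. Proof. by case: pp. Qed.
Let Imb2 : complex.Im b ^+ 2 = beta ^+ 2 - 1 - beta ^+ 2 / 4. Proof. by case: pp. Qed.

Lemma mega_gt0 : 0 < mega R.
Proof. by rewrite -(zr0 R) zr_lt. Qed.

Lemma mega_mul x y m n k : 0 <= x -> 0 <= y -> x * mega R <= zr R m ->
  y * mega R <= zr R n -> Z.leb (m * n) (1000000 * k) -> (x * y) * mega R <= zr R k.
Proof.
move=> x0 y0 xm yn mnk; rewrite -(ler_pM2r mega_gt0).
have -> : x * y * mega R * mega R = (x * mega R) * (y * mega R) by ring.
apply: (@le_trans _ _ (zr R m * zr R n)); first by rewrite ler_pM// mulr_ge0// ltW// mega_gt0.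
by rewrite /mega -!zrM zr_le (Z.mul_comm k).
Qed.

Lemma mega_mul_ge x y m n k : Z.leb 0 m -> Z.leb 0 n -> zr R m <= x * mega R ->
  zr R n <= y * mega R -> Z.leb (1000000 * k) (m * n) -> zr R k <= (x * y) * mega R.
Proof.
move=> m0 n0 xm yn mnk; rewrite -(ler_pM2r mega_gt0).
have -> : x * y * mega R * mega R = (x * mega R) * (y * mega R) by ring.
apply: (@le_trans _ _ (zr R m * zr R n)); last by rewrite ler_pM// -(zr0 R) zr_le.
by rewrite /mega -!zrM zr_le (Z.mul_comm k).
Qed.

Lemma beta_bounds : zr R 1324717%coq_Z <= beta * mega R <= zr R 1324718%coq_Z.
Proof. by case: pp. Qed.

Lemma beta_coarse : 13 / 10 < beta < 133 / 100.
Proof.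
have /andP[h1 h2] := beta_bounds; apply/andP; split.
  rewrite ltr_pdivrMr// -(ltr_pM2r (_ : 0 < zr R 100000%coq_Z)) -?[0](zr0 R) ?zr_lt//.
  rewrite -mulrA -(zr_nat _ 10) -zrM; apply: lt_le_trans h1.
  by rewrite -(zr_nat _ 13) -zrM zr_lt.
rewrite ltr_pdivlMr// -(ltr_pM2r (_ : 0 < zr R 10000%coq_Z)) -?[0](zr0 R) ?zr_lt//.
rewrite -mulrA -(zr_nat _ 100) -zrM; apply: (le_lt_trans h2).
by rewrite -(zr_nat _ 133) -zrM zr_lt.
Qed.

Lemma beta_gt0 : 0 < beta.
Proof. by have /andP[h _] := beta_coarse; apply: lt_trans h; lra. Qed.

Lemma beta2_bounds : zr R 1754874%coq_Z <= beta ^+ 2 * mega R <= zr R 1754878%coq_Z.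
Proof.
have /andP[h1 h2] := beta_bounds; have b0 := ltW beta_gt0.
by rewrite expr2 (mega_mul_ge _ _ h1 h1)// (mega_mul b0 b0 h2 h2).
Qed.

Lemma bE : b = Complex (- beta / 2) (complex.Im b).
Proof. by rewrite -Reb; case: (b). Qed.

Lemma b3 : b ^+ 3 = b + 1.
Proof.
rewrite bE; set y := complex.Im b; have y2 : y ^+ 2 = beta ^+ 2 - 1 - beta ^+ 2 / 4 := Imb2.
rewrite !exprS expr0 mulr1; apply/eqP; rewrite eq_complex; apply/andP; split; apply/eqP => /=.
  have -> : - beta / 2 * (- beta / 2 * (- beta / 2) - y * y) - y * (- beta / 2 * y + y * (- beta / 2))
    = - beta ^+ 3 / 8 + 3 / 2 * beta * y ^+ 2 by field.
  rewrite y2.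
  have -> : - beta ^+ 3 / 8 + 3 / 2 * beta * (beta ^+ 2 - 1 - beta ^+ 2 / 4) =
    beta ^+ 3 - 3 / 2 * beta by field.
  by rewrite beta3; field.
have -> : - beta / 2 * (- beta / 2 * y + y * (- beta / 2)) + y * (- beta / 2 * (- beta / 2) - y * y)
  = y * (3 / 4 * beta ^+ 2 - y ^+ 2) by field.
by rewrite y2; field.
Qed.

Lemma sqr_normcE (z : R[i]) : normc z ^+ 2 = complex.Re z ^+ 2 + complex.Im z ^+ 2.
Proof. by case: z => x y /=; rewrite sqr_sqrtr// addr_ge0 ?sqr_ge0. Qed.

Lemma Re_zev t : complex.Re (zev b t) =
  zr R t.1.1 - zr R t.1.2 * beta / 2 + zr R t.2 * (1 - beta ^+ 2 / 2).
Proof.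
case: t => [[p q] s]; rewrite /zev /= !zr_complex expr2.
move: bE Imb2; set y := complex.Im b => -> y2 /=.
rewrite !(mul0r, addr0, subr0).
have -> : - beta / 2 * (- beta / 2) - y * y = beta ^+ 2 / 4 - y ^+ 2 by field.
by rewrite y2; field.
Qed.

Lemma Im_zev t : complex.Im (zev b t) = complex.Im b * (zr R t.1.2 - beta * zr R t.2).
Proof.
case: t => [[p q] s]; rewrite /zev /= !zr_complex expr2.
by move: bE; set y := complex.Im b => -> /=; field.
Qed.

Lemma zev_znorm2 t : normc (zev b t) ^+ 2 = zev beta (znorm2 t).
Proof.
rewrite sqr_normcE Re_zev Im_zev exprMn Imb2; case: t => [[p q] s].
rewrite /zev /znorm2 ?(zrD, zrB, zrM) (zr_nat _ 2); cbn [fst snd].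
set P := zr R p; set Q := zr R q; set S := zr R s.
have -> : (P - Q * beta / 2 + S * (1 - beta ^+ 2 / 2)) ^+ 2 +
  (beta ^+ 2 - 1 - beta ^+ 2 / 4) * (Q - beta * S) ^+ 2 =
  P * P - Q * Q + S * S + 2 * P * S + (- P * Q + Q * S) * beta
    + (Q * Q - P * S - 2 * S * S) * beta ^+ 2
    + beta ^+ 3 * (- Q * S + S * S * beta) by field.
by rewrite beta3; ring.
Qed.

Lemma b_neq0 : b != 0.
Proof.
apply: contra_eqN b3 => /eqP ->.
by rewrite expr0n add0r eq_sym oner_eq0.
Qed.

Lemma r_gt0 : 0 < normc b.
Proof. by rewrite normc_gt0 b_neq0. Qed.

Lemma beta_r2 : beta * normc b ^+ 2 = 1.
Proof.
rewrite sqr_normcE Imb2 Reb.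
have -> : beta * ((- beta / 2) ^+ 2 + (beta ^+ 2 - 1 - beta ^+ 2 / 4)) = beta ^+ 3 - beta.
  by field.
by rewrite beta3; ring.
Qed.

Lemma r2_bound : normc b ^+ 2 * mega R <= zr R 754879%coq_Z.
Proof.
rewrite leNgt; apply/negP => /ltW h; have /andP[h1 _] := beta_bounds.
have := @mega_mul_ge _ _ 1324717%coq_Z 754879%coq_Z 1000001%coq_Z isT isT h1 h isT.
by rewrite beta_r2 mul1r zr_le.
Qed.

Lemma r_bound : normc b * mega R <= zr R 868839%coq_Z.
Proof.
rewrite leNgt; apply/negP => /ltW h.
have := le_trans (@mega_mul_ge _ _ 868839%coq_Z 868839%coq_Z 754881%coq_Z isT isT h h isT) r2_bound.
by rewrite zr_le.
Qed.

Lemma r_lt1 : normc b < 1.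
Proof.
by rewrite -(ltr_pM2r mega_gt0) mul1r (le_lt_trans r_bound)// zr_lt.
Qed.

Lemma rpow_ge j : (j <= 5)%N -> normc b ^+ j * mega R <= zr R (rpow j).
Proof.
have r0 n : 0 <= normc b ^+ n by rewrite exprn_ge0// ltW// r_gt0.
have r1 := r_bound; rewrite -[normc b]expr1 in r1.
have step m n c d k : normc b ^+ m * mega R <= zr R c -> normc b ^+ n * mega R <= zr R d ->
    Z.leb (c * d) (1000000 * k) -> normc b ^+ (m + n) * mega R <= zr R k.
  by move=> hc hd hk; rewrite exprD (mega_mul _ _ hc hd).
case: j => [|[|[|[|[|[|//]]]]]] _; rewrite /rpow [nth _ _ _]/=.
- by rewrite mul1r.
- exact: r1.
- exact: r2_bound.
- exact: (step _ _ _ _ _ r1 r2_bound).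
- exact: (step _ _ _ _ _ r2_bound r2_bound).
- by apply: (step 1 4)%N; [exact: r1|exact: (step _ _ _ _ 569843%coq_Z r2_bound r2_bound)|].
Qed.

Lemma zr_mul_if n lo hi (x : R) : zr R lo <= x <= zr R hi ->
  zr R n * zr R (if Z.leb 0 n then lo else hi) <= zr R n * x.
Proof.
move=> /andP[lox xhi]; case: ifP => h.
  by rewrite ler_wpM2l// -(zr0 R) zr_le.
by rewrite ler_wnM2l// -(zr0 R) zr_le; lia.
Qed.

Lemma zlow_le t : zr R (zlow t) <= zev beta t * mega R.
Proof.
case: t => [[p q] s]; rewrite /zlow /zev !zrD !zrM -/(mega R) !mulrDl.
apply: lerD; first apply: lerD => //.
  by rewrite -mulrA; apply: zr_mul_if; exact: beta_bounds.
by rewrite -mulrA; apply: zr_mul_if; exact: beta2_bounds.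
Qed.

End Plastic.

(** * The tile *)

Lemma pow_small (R : realType) (r e : R) : 0 <= r < 1 -> 0 < e ->
  exists N, forall n, (N <= n)%N -> r ^+ n < e.
Proof.
move=> /andP[r0 r1] e0.
have /cvgr0Pnorm_lt /(_ _ e0)[N _ HN] : (fun n => r ^+ n) @ \oo --> (0 : R).
  by apply: cvg_expr; rewrite ger0_norm.
by exists N => n /HN /=; rewrite ger0_norm// exprn_ge0.
Qed.

Definition is_tile (R : realType) (b : R[i]) (F : set R[i]) : Prop :=
  [/\ F !=set0, ball_cover_compact F &
      forall z, F z <-> exists s y, F y /\ z = branch b s y].

Definition zrng (n : nat) : seq Z :=
  [seq Z.sub (Z.of_nat i) (Z.of_nat n) | i <- iota 0 (2 * n).+1].

Definition zbox (n m k : nat) : seq zbeta :=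
  [seq (pq, s) | pq <- [seq (p, q) | p <- zrng n, q <- zrng m], s <- zrng k].

Lemma mem_zrng n p : Z.leb (Z.abs p) (Z.of_nat n) -> p \in zrng n.
Proof.
move=> h; apply/mapP; exists (Z.to_nat (p + Z.of_nat n)%coq_Z); last by lia.
rewrite mem_iota; lia.
Qed.

Lemma mem_zbox n m k (t : zbeta) : Z.leb (Z.abs t.1.1) (Z.of_nat n) ->
  Z.leb (Z.abs t.1.2) (Z.of_nat m) -> Z.leb (Z.abs t.2) (Z.of_nat k) -> t \in zbox n m k.
Proof.
case: t => [[p q] s] hp hq hs; apply: allpairs_f; last exact: mem_zrng.
by apply: allpairs_f; exact: mem_zrng.
Qed.

Section Tile.
Variables (R : realType) (beta : R) (b : R[i]) (F : set R[i]).
Hypothesis pp : plastic_pair beta b.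
Hypothesis tF : is_tile b F.

Let beta3 : beta ^+ 3 = beta + 1. Proof. by case: pp. Qed.
Let b3 := b3 pp.
Let r := normc b.
Let c := zev b zctr.

Lemma act_dist g z w :
  normc (act b g z - act b g w) = r ^+ g.1.1 * normc (z - w).
Proof.
case: g => [[j e] t] /=; rewrite opprD addrACA subrr addr0 -mulrBr !normcM.
by rewrite -signr_odd !normcX normcN normc1 expr1n mul1r.
Qed.

Lemma branch_dist s z w :
  normc (branch b s z - branch b s w) = r ^+ wt1 s * normc (z - w).
Proof.
rewrite /branch; case: s => /=; rewrite -mulrBr normcM ?normcX//.
by rewrite expr1 (_ : 1 - z - (1 - w) = - (z - w)) ?normcN//; ring.
Qed.

Lemma fword_dist u z w :
  normc (fword b u z - fword b u w) = r ^+ weight u * normc (z - w).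
Proof.
elim: u => [|s u IH]; first by rewrite mul1r.
by rewrite [fword b (s :: u) z]/= [fword b (s :: u) w]/= branch_dist IH mulrA -exprD.
Qed.

Lemma tile_branch s z : F z -> F (branch b s z).
Proof. by move=> Fz; case: tF => _ _ FE; apply/FE; exists s, z. Qed.

Lemma tile_fword u z : F z -> F (fword b u z).
Proof. by move=> Fz; elim: u => //= s u; exact: tile_branch. Qed.

Lemma tile_split z : F z -> exists s y, F y /\ z = branch b s y.
Proof. by case: tF => _ _ FE /FE. Qed.

Lemma act_ctrE g : zev b (act_ctr g) = act b g c - c.
Proof.
case: g => [[j e] t]; rewrite /act_ctr zevB zevD zev_sign zev_mulxn//=.
by rewrite mulrA.
Qed.

Lemma ctr_R : branch b true c = c.
Proof. by rewrite /branch -(zev1 b) -zevB -zev_mulx. Qed.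

(** Since b^5 = b^4 + 1, f_L moves c by b^4 c = b^2, of modulus 1/beta < 0.757, and 0.757 + 3/2
    |b|^5 is just below 3/2. So f_L maps the disc into itself, and the radius 3/2 is close to the
    least possible one. *)
Lemma ctr_L : normc (branch b false c - c) + r ^+ 5 * (3 / 2) <= 3 / 2.
Proof.
have -> : branch b false c - c = zev b (zsub (iter 5 zmulx zctr) zctr).
  by rewrite zevB zev_mulxn.
set d := zsub _ _; set a := normc _.
have a0 : 0 <= a := normc_ge0 _.
have am : a * mega R <= zr R 757000%coq_Z.
  rewrite leNgt; apply/negP => /ltW h.
  have := @mega_mul_ge _ _ _ 757000%coq_Z 757000%coq_Z 573000%coq_Z isT isT h h isT.
  have := zlow_le pp (zopp (znorm2 d)); rewrite zevN -(zev_znorm2 pp) mulNr expr2 -/a.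
  move=> h1 h2; have : zr R (zlow (zopp (znorm2 d))) <= zr R (Z.opp 573000)%coq_Z.
    by rewrite zrN (le_trans h1)// lerN2.
  by rewrite zr_le.
have := rpow_ge pp (leqnn 5); rewrite -/r => rm.
rewrite -(ler_pM2r (mega_gt0 R)).
have -> : 3 / 2 * mega R = 2^-1 * zr R 3000000%coq_Z.
  rewrite (_ : 3000000%coq_Z = (3 * 1000000)%coq_Z)// zrM (zr_nat _ 3) /mega.
  by field.
rewrite mulrDl.
have : zr R (2 * 757000 + 3 * 495102)%coq_Z <= zr R 3000000%coq_Z by rewrite zr_le.
rewrite zrD !zrM (zr_nat _ 2) (zr_nat _ 3); move: rm am; rewrite /rpow /=; lra.
Qed.

(** Both branches map the disc into itself, f_R because it fixes c. Each subdivision multiplies the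
    excess of |z - c| over 3/2 by at most |b|, and [F] is bounded, so there is no excess. *)
Lemma tile_disc z : F z -> normc (z - c) <= 3 / 2.
Proof.
have [F0 cF _] := tF.
have r0 := ltW (r_gt0 pp); have r1 := r_lt1 pp; rewrite -/r in r0 r1.
have [M M0 FM] := ball_cover_bounded cF.
pose E := M + normc c.
have E0 : 0 <= E by rewrite addr_ge0 ?normc_ge0// ltW.
have H n y : F y -> normc (y - c) <= 3 / 2 + r ^+ n * E.
  elim: n y => [|n IH] y Fy.
    have := normcD y (- c); rewrite normcN; have := FM _ Fy.
    by rewrite expr0 mul1r /E; lra.
  have [s [x [Fx ->]]] := tile_split Fy.
  have hx := IH _ Fx; have hd := branch_dist s x c.
  have rnE : 0 <= r ^+ n * E by rewrite mulr_ge0 ?exprn_ge0.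
  case: s hd => /= hd.
    rewrite -{1}ctr_R hd expr1 exprS -mulrA.
    apply: (le_trans (ler_wpM2l r0 hx)); rewrite mulrDr lerD2r.
    by move: r1; lra.
  have := normc_dist (b ^+ 5 * x) (b ^+ 5 * c) c; rewrite /= in hd *; rewrite hd => h.
  have := ctr_L; rewrite /= => hL.
  have r5 : r ^+ 5 <= r by rewrite exprS -[leRHS]mulr1; apply: ler_wpM2l => //; apply: exprn_ile1; rewrite ?r0 ?ltW.
  have : r ^+ 5 * normc (x - c) <= r ^+ 5 * (3 / 2 + r ^+ n * E) by rewrite ler_wpM2l ?exprn_ge0.
  have : r ^+ 5 * (r ^+ n * E) <= r * (r ^+ n * E) by rewrite ler_wpM2r.
  have -> : r ^+ n.+1 * E = r * (r ^+ n * E) by rewrite exprS mulrA.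
  lra.
move=> Fz; apply/ler_addgt0Pr => e e0.
have E1 : 0 < E + 1 by rewrite ltr_wpDl.
have [||N /(_ _ (leqnn N))] := @pow_small _ r (e / (E + 1)); [by rewrite r0|exact: divr_gt0|].
rewrite ltr_pdivlMr// => hN; have := H N _ Fz.
have : 0 <= r ^+ N by rewrite exprn_ge0.
lra.
Qed.

Lemma far_disjoint g z y : (g.1.1 <= 5)%N -> far g -> F z -> F y -> z <> act b g y.
Proof.
move=> g5; rewrite /far -(zr_lt R) => gfar Fz Fy zE.
have h1 := tile_disc Fz; have h2 := tile_disc Fy.
have h3 := act_dist g y c; rewrite -zE in h3.
have h4 := normc_dist (act b g c) z c; rewrite (normcB _ z) h3 in h4.
have r0 := ltW (r_gt0 pp); rewrite -/r in r0.
set a := normc (act b g c - c) in h4.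
have a0 : 0 <= a := normc_ge0 _.
have h5 : a <= (1 + r ^+ g.1.1) * (3 / 2).
  have : r ^+ g.1.1 * normc (y - c) <= r ^+ g.1.1 * (3 / 2) by rewrite ler_wpM2l ?exprn_ge0.
  by lra.
have h6 := rpow_ge pp g5; rewrite -/r in h6.
have M0 := mega_gt0 R.
have h7 : 2 * (a * mega R) <= 3 * (mega R + zr R (rpow g.1.1)).
  have := ler_wpM2r (ltW M0) h5.
  have -> : (1 + r ^+ g.1.1) * (3 / 2) * mega R = 3 / 2 * (mega R + r ^+ g.1.1 * mega R) by ring.
  by lra.
have h8 := zlow_le pp (znorm2 (act_ctr g)).
rewrite -(zev_znorm2 pp) act_ctrE -/a in h8.
have : 4 * (a ^+ 2 * mega R * mega R) <= 9 * (mega R + zr R (rpow g.1.1)) ^+ 2.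
  have -> : 4 * (a ^+ 2 * mega R * mega R) = (2 * (a * mega R)) ^+ 2 by ring.
  have -> : 9 * (mega R + zr R (rpow g.1.1)) ^+ 2 = (3 * (mega R + zr R (rpow g.1.1))) ^+ 2 by ring.
  apply: lerXn2r => //; rewrite nnegrE; first by rewrite !mulr_ge0// ltW.
  by apply: le_trans h7; rewrite !mulr_ge0// ltW.
move=> h9; move: gfar; apply/negP; rewrite -leNgt.
rewrite (_ : 4000000000000%coq_Z = (4 * 1000000 * 1000000)%coq_Z)//.
rewrite !(zrM, zrD) (zr_nat _ 4) (zr_nat _ 9) -/(mega R).
apply: (@le_trans _ _ (4 * (a ^+ 2 * mega R * mega R) * mega R)).
  have := ler_wpM2r (ltW M0) (ler_wpM2r (ltW M0) h8).
  by lra.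
apply: le_trans (ler_wpM2r (ltW M0) h9) _.
by rewrite expr2 !mulrA.
Qed.

Let y := complex.Im b.

Lemma Imb_coarse : 2^-1 < `|y|.
Proof.
rewrite ltNge; apply/negP => h; have /andP[h1 h2] := beta_coarse pp.
have h3 : y ^+ 2 <= 2^-1 ^+ 2 by rewrite -real_normK ?num_real// ler_sqr ?nnegrE//; lra.
have h4 : y ^+ 2 = beta ^+ 2 - 1 - beta ^+ 2 / 4 by case: pp.
have h5 : 13 / 10 * beta <= beta ^+ 2 by rewrite expr2 ler_pM2r ?(beta_gt0 pp)// ltW.
by move: h3; rewrite h4; lra.
Qed.

(** The coefficients are recovered from the two embeddings: the imaginary part gives Q - beta S, and
    then S comes with the factor 3 beta^2 - 1, the derivative of x^3 - x - 1 at [beta]. *)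
Lemma zcoord_le t A B : `|zev beta t| <= A -> normc (zev b t) <= B ->
  [/\ `|zr R t.2| * 4 <= A + 5 * B,
      `|zr R t.1.2| <= 2 * B + 133 / 100 * `|zr R t.2| &
      `|zr R t.1.1| <= A + 133 / 100 * `|zr R t.1.2| + 2 * `|zr R t.2|].
Proof.
move=> hA hB; have /andP[b1 b2] := beta_coarse pp; have y2 := Imb_coarse.
have bb0 := ltW (beta_gt0 pp).
have bb : beta ^+ 2 <= 2 by rewrite expr2 -[leRHS](_ : 133/100 * (133/100) + (2 - 133/100 * (133/100)) = 2); [nra|lra].
have bb1 : 169 / 100 <= beta ^+ 2 by nra.
have B0 : 0 <= B := le_trans (normc_ge0 _) hB.
set P := zr R t.1.1; set Q := zr R t.1.2; set S := zr R t.2.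
have [hX hY] : `|complex.Re (zev b t)| <= B /\ `|complex.Im (zev b t)| <= B.
  have /= := sqr_normcE (zev b t).
  have hB2 : normc (zev b t) ^+ 2 <= B ^+ 2 by rewrite ler_sqr ?nnegrE ?normc_ge0.
  move=> hh; rewrite hh in hB2; split.
    by rewrite -ler_sqr ?nnegrE// real_normK ?num_real// (le_trans _ hB2)// lerDl sqr_ge0.
  by rewrite -ler_sqr ?nnegrE// real_normK ?num_real// (le_trans _ hB2)// lerDr sqr_ge0.
have hw : `|Q - beta * S| <= 2 * B.
  have : `|Q - beta * S| * 2^-1 <= `|complex.Im (zev b t)|.
    by rewrite (Im_zev pp) normrM mulrC ler_wpM2r// ltW.
  by lra.
have hZ : zev beta t = P + Q * beta + S * beta ^+ 2.
  by rewrite /P /Q /S; case: (t) => [[]].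
have hS : S * (3 * beta ^+ 2 - 1) = zev beta t - complex.Re (zev b t) - 3 / 2 * beta * (Q - beta * S).
  by rewrite (Re_zev pp) hZ -/P -/Q -/S; field.
have Sbound : `|S| * 4 <= A + 5 * B.
  have : `|S| * (3 * beta ^+ 2 - 1) = `|zev beta t - complex.Re (zev b t) - 3 / 2 * beta * (Q - beta * S)|.
    by rewrite -hS normrM (ger0_norm (_ : 0 <= 3 * beta ^+ 2 - 1))//; lra.
  have := ler_normB (zev beta t - complex.Re (zev b t)) (3 / 2 * beta * (Q - beta * S)).
  have := ler_normB (zev beta t) (complex.Re (zev b t)).
  have -> : `|3 / 2 * beta * (Q - beta * S)| = 3 / 2 * beta * `|Q - beta * S|.
    by rewrite normrM ger0_norm// mulr_ge0.
  have : beta * `|Q - beta * S| <= 133 / 100 * (2 * B) by apply: ler_pM => //; exact: ltW.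
  have : `|S| * 4 <= `|S| * (3 * beta ^+ 2 - 1) by rewrite ler_wpM2l//; lra.
  lra.
split=> //.
  have := ler_normD (Q - beta * S) (beta * S); rewrite subrK normrM (ger0_norm bb0).
  have : beta * `|S| <= 133 / 100 * `|S| by rewrite ler_wpM2r// ltW.
  lra.
have -> : P = zev beta t - Q * beta - S * beta ^+ 2 by rewrite hZ; ring.
have := ler_normB (zev beta t - Q * beta) (S * beta ^+ 2).
have := ler_normB (zev beta t) (Q * beta).
rewrite [`|Q * beta|]normrM [`|S * beta ^+ 2|]normrM (ger0_norm bb0) (ger0_norm (sqr_ge0 beta)).
have : `|Q| * beta <= 133 / 100 * `|Q| by rewrite mulrC ler_wpM2r// ltW.
have : `|S| * beta ^+ 2 <= 2 * `|S| by rewrite mulrC ler_wpM2r.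
lra.
Qed.

Lemma zbox_fin A B : exists l : seq zbeta, forall t,
  `|zev beta t| <= A -> normc (zev b t) <= B -> t \in l.
Proof.
pose C := 10 * (`|A| + `|B|).
have C0 : 0 <= C by rewrite mulr_ge0// addr_ge0.
have [n Hn] : exists n : nat, C <= n%:R by exists (Num.bound C); apply/ltW/archi_boundP.
exists (zbox n n n) => t hA hB; have [hs hq hp] := zcoord_le hA hB.
have A1 := ler_norm A; have B1 := ler_norm B; have A0 := normr_ge0 A; have B0 := normr_ge0 B.
have zabs m : `|zr R m| <= C -> Z.leb (Z.abs m) (Z.of_nat n).
  move=> h; rewrite -(zr_le R) zr_nat; apply: le_trans Hn; apply: le_trans h.
  by case: (Z.abs_spec m) => -[_ ->]; rewrite ?zrN ?ler_norm// -normrN ler_norm.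
by apply: mem_zbox; apply: zabs; rewrite /C; lra.
Qed.

End Tile.

(** * Covering the plane by tiles *)

Lemma sep_finite (R : realType) (I : eqType) (X : I -> set R[i]) (l : seq I) (z : R[i]) :
  (forall i, i \in l -> ball_cover_compact (X i)) -> (forall i, i \in l -> ~ X i z) ->
  exists2 e : R, 0 < e & forall i w, i \in l -> X i w -> e <= normc (w - z).
Proof.
elim: l => [|i l IH] cX nX; first by exists 1.
have [|j jl|e e0 He] := IH; first by move=> j jl; apply: cX; rewrite inE jl orbT.
  by apply: nX; rewrite inE jl orbT.
have [d d0 Hd] := ball_cover_closed (cX i (mem_head _ _)) (nX i (mem_head _ _)).
exists (Num.min e d) => [|j w]; first by rewrite lt_min e0.
rewrite inE => /orP[/eqP -> Xw|jl Xw].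
  by rewrite ge_min (Hd _ Xw) orbT.
by rewrite ge_min (He _ _ jl Xw).
Qed.

(** A finite Baire argument: if the ball is not contained in the first set, some smaller ball in it
    misses that set and is covered by the others. *)
Lemma ball_in_union (R : realType) (I : eqType) (X : I -> set R[i]) (l : seq I) (z : R[i]) (e : R) :
  (forall i, i \in l -> ball_cover_compact (X i)) -> 0 < e ->
  (forall w, normc (w - z) < e -> exists2 i, i \in l & X i w) ->
  exists i z' (e' : R), [/\ i \in l, 0 < e' & forall w, normc (w - z') < e' -> X i w].
Proof.
elim: l z e => [|i l IH] z e cX e0 cov.
  by have [] := cov z; rewrite ?subrr ?normc0.
have [H|/existsNP[w /not_implyP[wz Xw]]] := pselect (forall w, normc (w - z) < e -> X i w).
  by exists i, z, e; rewrite mem_head.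
have [d d0 Hd] := ball_cover_closed (cX i (mem_head _ _)) Xw.
have [||v|j [z' [e' [jl e'0 H]]]] := IH w (Num.min d (e - normc (w - z))).
- by move=> j jl; apply: cX; rewrite inE jl orbT.
- by rewrite lt_min d0 subr_gt0.
- rewrite lt_min => /andP[vd ve].
  have [|j] := cov v; first by have := normc_dist v w z; lra.
  rewrite inE => /orP[/eqP -> Xv|jl Xj]; last by exists j.
  by have := Hd _ Xv; rewrite leNgt vd.
by exists j, z', e'; rewrite inE jl orbT.
Qed.

Section Covering.
Variables (R : realType) (beta : R) (b : R[i]) (F : set R[i]).
Hypothesis pp : plastic_pair beta b.
Hypothesis tF : is_tile b F.

Let beta3 : beta ^+ 3 = beta + 1. Proof. by case: pp. Qed.
Let b3 := b3 pp.
Let r := normc b.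

Let r0 : 0 <= r. Proof. exact: ltW (r_gt0 pp). Qed.
Let r1 : r < 1. Proof. exact: r_lt1 pp. Qed.

Let rI : 0 <= r < 1. Proof. by rewrite r0. Qed.

(** Equivalently 1/beta + 1/beta^5 = 1: the intervals of the two branches of the tent map fill
    [0, 1]. *)
Lemma beta5 : beta ^+ 5 = beta ^+ 4 + 1.
Proof.
have -> : beta ^+ 5 = beta ^+ 3 * beta ^+ 2 by ring.
have -> : beta ^+ 4 = beta ^+ 3 * beta by ring.
have -> : beta ^+ 3 * beta ^+ 2 = beta ^+ 3 + beta ^+ 2 by rewrite {1}beta3; ring.
by rewrite beta3; ring.
Qed.

(* The orbit of [t] under the tent map, started infinitesimally to the right
   ([e = false]) or to the left of a point of [Z[beta]]; [0 < j] means that the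
   branch of weight 5 is being applied, and that [j] units of it are done. *)
Definition germ (j : nat) (e : bool) (t : zbeta) : Prop :=
  let k := if j == 0%N then 1 else beta ^+ 5 in
  if e then 0 < zev beta t /\ zev beta t * k <= 1
  else 0 <= zev beta t /\ zev beta t * k < 1.

(** Prefixing a letter to the word is a step of the tent map, x -> beta^5 x on [0, beta^-5] and x ->
    beta (1 - x) on [beta^-5, 1]. A step of weight w takes w units of time, so there is a state at
    every time n; the second branch reverses the orientation and hence flips the side. *)
Lemma germ_orbit n e t0 : germ 0 e t0 -> exists u j,
  [/\ (j <= 4)%N, (weight u + j)%N = n & germ j (e (+) sgw u) (zword u t0)].
Proof.
have b0 := beta_gt0 pp.
move=> g0; elim: n => [|n [u [j [j4 wu gj]]]]; first by exists [::], 0%N; rewrite addbF.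
case: j j4 wu gj => [|j] j4 wu gj; last first.
  move: j4; rewrite leq_eqVlt => /orP[/eqP j4|j4]; last first.
    by exists u, j.+2; split=> //; rewrite addnS wu.
  exists (false :: u), 0%N; split=> //.
    by move: wu j4; rewrite /weight /=; lia.
  have E : zev beta (zword (false :: u) t0) = zev beta (zword u t0) * beta ^+ 5.
    by rewrite mulrC; exact: (zev_branch beta3 false).
  move: gj; rewrite /germ E [_ == _]/= [_ == _]/= mulr1 /sgw /= add0n.
  case: ifP => _ [h1 h2]; split=> //; first by rewrite mulr_gt0// exprn_gt0.
  by rewrite mulr_ge0// exprn_ge0// ltW.
rewrite addn0 in wu.
have [h|h] := pselect (germ 1 (e (+) sgw u) (zword u t0)).
  by exists u, 1%N; rewrite addn1 wu.
exists (true :: u), 0%N; split=> //; first by move: wu; rewrite /weight /=; lia.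
have -> : e (+) sgw (true :: u) = ~~ (e (+) sgw u) by rewrite /sgw /= add0n addbN.
move: gj h; rewrite /germ /= !mulr1 zev_mulx// zevB zev1; set T := zev beta _.
have key : 1 < T * beta ^+ 5 -> beta * (1 - T) < 1.
  move=> h; rewrite -(ltr_pM2r (exprn_gt0 4 b0)) mul1r.
  have -> : beta * (1 - T) * beta ^+ 4 = beta ^+ 5 - T * beta ^+ 5 by ring.
  by rewrite {1}beta5; lra.
have key' : 1 <= T * beta ^+ 5 -> beta * (1 - T) <= 1.
  move=> h; rewrite -(ler_pM2r (exprn_gt0 4 b0)) mul1r.
  have -> : beta * (1 - T) * beta ^+ 4 = beta ^+ 5 - T * beta ^+ 5 by ring.
  by rewrite {1}beta5; lra.
case: (e (+) sgw u) => /= -[h1 h2] /not_andP[//|/negP]; rewrite -?ltNge -?leNgt => h3.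
  by split; [rewrite mulr_ge0 ?(ltW b0)// subr_ge0|exact: key].
by split; [rewrite mulr_gt0// subr_gt0|exact: key'].
Qed.

(** Rounding the coordinates of z / b^k in the basis 1, b costs O(|b|^k) after multiplication by
    b^k. Adding x^m for large m then makes the real value positive and moves the point in the plane
    by |b|^m only. *)
Lemma zbeta_dense (z : R[i]) (eps : R) : 0 < eps ->
  exists t, 0 < zev beta t /\ normc (zev b t - z) < eps.
Proof.
move=> e0; have b0 := beta_gt0 pp; have bn0 := b_neq0 pp.
have e4 : 0 < eps / 4 by lra.
have e2 : 0 < eps / 2 by lra.
have [k Hk] := pow_small rI e4.
have := Hk k (leqnn k); set y := complex.Im b => {}Hk.
have y0 : y != 0 by have := Imb_coarse pp; rewrite -normr_gt0; apply: lt_trans; rewrite invr_gt0.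
pose w := z / b ^+ k; pose q := complex.Im w / y; pose p := complex.Re w - q * complex.Re b.
have wE : w = p%:C + q%:C * b.
  rewrite (bE pp) -/y; apply/eqP; rewrite eq_complex; apply/andP; split; apply/eqP => /=.
    by rewrite mul0r subr0 /p; case: pp => _ _ -> _; rewrite subrK.
  by rewrite mul0r addr0 add0r /q divfK.
pose t1 := iter k zmulx (Z_of_int (Num.floor p), Z_of_int (Num.floor q), 0%coq_Z).
have h1 : normc (zev b t1 - z) < eps / 2.
  have -> : zev b t1 - z = b ^+ k * ((Num.floor p)%:~R - p)%:C +
      b ^+ k * (((Num.floor q)%:~R - q)%:C * b).
    have -> : z = b ^+ k * w by rewrite /w mulrC divfK// expf_neq0.
    rewrite /t1 zev_mulxn// /zev !zr_complex !zrE !Z_of_intK wE !rmorphB /=.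
    by rewrite -complexr0; ring.
  have fl (x : R) : `|(Num.floor x)%:~R - x| <= 1.
    by rewrite distrC ger0_norm ?subr_ge0 ?floor_le// lerBlDl ltW// -intrD1 floorD1_gt.
  apply: le_lt_trans (normcD _ _) _; rewrite !normcM !normcX !normc_real.
  have a1 : r ^+ k * `|(Num.floor p)%:~R - p| <= r ^+ k by rewrite ler_piMr// exprn_ge0.
  have a2 : r ^+ k * (`|(Num.floor q)%:~R - q| * r) <= r ^+ k.
    by rewrite ler_piMr ?exprn_ge0// mulr_ile1// ltW.
  rewrite -/r; lra.
have ib : 0 <= beta^-1 < 1.
  have /andP[? _] := beta_coarse pp.
  by rewrite invr_ge0 ltW//= invf_lt1//; lra.
pose A := `|zev beta t1| + 1.
have A0 : 0 < A by rewrite ltr_wpDl.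
have [K HK] := pow_small rI e2.
have [|K' HK'] := @pow_small _ beta^-1 A^-1 ib; first by rewrite invr_gt0.
pose m := maxn K K'.
exists (zadd t1 (iter m zmulx zone)); rewrite !zevD !(zev_mulxn _ m zone)// !zev1 !mulr1; split.
  have := HK' m (leq_maxr _ _); rewrite exprVn ltf_pV2 ?posrE ?exprn_gt0// /A.
  have := ler_norm (- zev beta t1); rewrite normrN; lra.
have := HK m (leq_maxl _ _); have := normcD (zev b t1 - z) (b ^+ m); rewrite normcX -/r.
by rewrite addrAC; lra.
Qed.

Definition tile_map (j : nat) (e : bool) (t : zbeta) : nbmap :=
  (j, e, iter j zmulx (if e then t else zopp t)).

Lemma act_tile_map j e t y :
  act b (tile_map j e t) y = - (-1) ^+ e * b ^+ j * (zev b t - y).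
Proof.
rewrite /tile_map /act zev_mulxn//; case: e => /=; rewrite ?zevN; ring.
Qed.

(** Let x in Z[beta] be close to z, with positive real value. For large n the real value of x /
    beta^n lies in (0, 1], so its tent orbit has a state (j, t) at time n, reached by a word u of
    weight n - j. As f_u is affine with ratio +-b^(n - j), the point x - b^n p is exactly the image
    of f_u(p) under the tile map of that state. *)
Lemma covering_approx z (eps : R) : 0 < eps -> exists j e t y,
  [/\ (j <= 4)%N, germ j e t, F y & normc (z - act b (tile_map j e t) y) < eps].
Proof.
move=> e0; have b0 := beta_gt0 pp.
have [x [x0 xz]] := zbeta_dense z (divr_gt0 e0 (ltr0n _ 2)).
have [[p Fp] _ _] := tF.
have [|N HN] := @pow_small _ r (eps / 2 / (normc p + 1)) rI.
  by rewrite !divr_gt0// ltr_wpDl// normc_ge0.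
have ib : 0 <= beta^-1 < 1.
  have /andP[? _] := beta_coarse pp.
  by rewrite invr_ge0 ltW//= invf_lt1//; lra.
have [|K HK] := @pow_small _ beta^-1 (zev beta x)^-1 ib; first by rewrite invr_gt0.
pose n := maxn N K.
have bn0 : 0 < beta ^+ n by rewrite exprn_gt0.
have xn : beta ^+ n * zev beta (iter n zdivx x) = zev beta x := zev_divxn beta3 n x.
have g0 : germ 0 true (iter n zdivx x).
  rewrite /germ /= mulr1; split; first by rewrite -(pmulr_rgt0 _ bn0) xn.
  rewrite -(ler_pM2l bn0) xn mulr1; have := HK n (leq_maxr _ _).
  by rewrite exprVn ltf_pV2 ?posrE// => /ltW.
have [u [j [j4 wu gj]]] := germ_orbit n g0.
exists j, (~~ sgw u), (zword u (iter n zdivx x)), (fword b u p); split=> //.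
  exact: tile_fword.
rewrite act_tile_map zev_word// fword_diff.
have -> : - (-1) ^+ (~~ sgw u) * b ^+ j * ((-1) ^+ sgw u * b ^+ weight u *
    (zev b (iter n zdivx x) - p)) = zev b x - b ^+ n * p.
  rewrite -[in RHS](zev_divxn b3 n x); set Z := zev b (iter n zdivx x).
  rewrite -[in RHS]wu exprD.
  by case: (sgw u) => /=; rewrite ?expr1 ?expr0; ring.
have hn := HN n (leq_maxl _ _).
have : r ^+ n * normc p < eps / 2.
  have n0 : 0 < normc p + 1 by rewrite ltr_wpDl// normc_ge0.
  move: hn; rewrite ltr_pdivlMr//; have := exprn_ge0 n r0; lra.
have := normcD (z - zev b x) (b ^+ n * p); rewrite normcM normcX -/r.
have -> : z - (zev b x - b ^+ n * p) = z - zev b x + b ^+ n * p by ring.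
rewrite (normcB z); lra.
Qed.

Lemma act_image_compact g : ball_cover_compact (act b g @` F).
Proof.
move=> e epos; have [_ cF _] := tF.
have [p Fp|s sF Fs] := cF (fun p => e (act b g p)); first by apply: epos; exists p.
exists (map (act b g) s) => [_ /mapP[p ps ->]|_ [q Fq <-]].
  by exists p => //; exact: sF.
have [p ps qp] := Fs _ Fq; exists (act b g p); first exact: map_f.
apply: le_lt_trans qp; rewrite act_dist ler_piMl ?normc_ge0//.
by rewrite exprn_ile1 ?r0// ltW.
Qed.

(* Only finitely many of the tiles that cover the plane meet a given disc. *)
Lemma covering_local (M : R) : exists L : seq nbmap,
  (forall g, g \in L -> exists j e t, [/\ (j <= 4)%N, germ j e t & g = tile_map j e t]) /\
  forall z, normc z <= M -> exists2 g, g \in L & (act b g @` F) z.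
Proof.
have [_ cF _] := tF; have [D D0 FD] := ball_cover_bounded cF.
have r40 : 0 < r ^+ 4 by rewrite exprn_gt0// (r_gt0 pp).
have [l Hl] := zbox_fin pp 1 (D + (`|M| + 1) / r ^+ 4).
pose L0 := [seq (je, t) | je <- [seq (j, e) | j <- iota 0 5, e <- [:: false; true]], t <- l].
pose ok (x : nat * bool * zbeta) := `[< germ x.1.1 x.1.2 x.2 >].
pose L := [seq tile_map x.1.1 x.1.2 x.2 | x <- L0 & ok x].
exists L; split.
  move=> g /mapP[[[j e] t]]; rewrite mem_filter => /andP[/asboolP gj].
  move=> /allpairsP[p [/allpairsP[q [hj _ eq]] _ ejet]] ->.
  exists j, e, t; split=> //; move: ejet hj; rewrite eq => -[-> _ _].
  by rewrite mem_iota add0n ltnS => /andP[_ ->].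
(* Tiles that approximate z belong to the finite list, since the real value of t is in [0, 1] and
   its conjugate is bounded; but finitely many compact sets that miss z keep a positive distance
   from it. *)
move=> z zM; apply: contrapT => H.
have [|g gL gz|e e0 He] := @sep_finite _ _ (fun g => act b g @` F) L z.
- by move=> g _; exact: act_image_compact.
- by apply: H; exists g.
have [|j [d [t [y [j4 gj Fy zy]]]]] := @covering_approx z (Num.min e 1); first by rewrite lt_min e0 ltr01.
move: zy; rewrite lt_min => /andP[ze z1].
suff gL : tile_map j d t \in L.
  have := He _ (act b (tile_map j d t) y) gL (ex_intro2 _ _ y Fy erefl).
  by rewrite leNgt normcB ze.
apply/mapP; exists (j, d, t) => //; rewrite mem_filter; apply/andP; split; first exact/asboolP.
have [t0 t1] : 0 <= zev beta t /\ zev beta t <= 1.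
  have b5 : 1 <= beta ^+ 5 by rewrite exprn_ege1//; have /andP[? _] := beta_coarse pp; lra.
  have kk (T : R) : 0 <= T -> T * (if j == 0%N then 1 else beta ^+ 5) <= 1 -> 0 <= T /\ T <= 1.
    move=> T0 h; split=> //; apply: le_trans h; case: ifP => _; first by rewrite mulr1.
    by rewrite ler_peMr.
  by move: gj; rewrite /germ; case: (d) => -[h1 h2]; apply: kk => //; exact: ltW.
apply: allpairs_f; first apply: allpairs_f; first by rewrite mem_iota; lia.
  by case: (d).
apply: Hl; first by rewrite ger0_norm.
have h1 : normc (act b (tile_map j d t) y) <= `|M| + 1.
  have := normcD (act b (tile_map j d t) y - z) z; rewrite subrK (normcB _ z).
  by have := ler_norm M; lra.
have h2 : r ^+ 4 * normc (zev b t - y) <= `|M| + 1.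
  apply: le_trans h1; rewrite act_tile_map !normcM normcN -signr_odd !normcX normcN normc1.
  rewrite expr1n mul1r ler_wpM2r ?normc_ge0// -/r.
  by apply: ler_wiXn2l; rewrite ?r0 ?ltW.
have := normcD (zev b t - y) y; rewrite subrK; have := FD _ Fy.
have : normc (zev b t - y) <= (`|M| + 1) / r ^+ 4 by rewrite ler_pdivlMr// mulrC.
lra.
Qed.

End Covering.

(** * The boundary graph *)

(* Polynomials as lists of coefficients, the constant one first. *)
Definition pev (K : comNzRingType) (x : K) (l : seq Z) : K :=
  foldr (fun c y => zr K c + x * y) 0 l.

Fixpoint padd (k l : seq Z) : seq Z :=
  match k, l with
  | [::], _ => l
  | _, [::] => k
  | c :: k', d :: l' => Z.add c d :: padd k' l'
  end.

Definition pscale (n : Z) (l : seq Z) : seq Z := map (Z.mul n) l.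

Section PolyEval.
Variables (K : comNzRingType) (x : K).

Lemma pev_add k l : pev x (padd k l) = pev x k + pev x l.
Proof.
elim: k l => [|c k IH] [|d l]; rewrite /= ?add0r ?addr0//.
by rewrite zrD IH; ring.
Qed.

Lemma pev_scale n l : pev x (pscale n l) = zr K n * pev x l.
Proof. by elim: l => [|c l IH]; rewrite /= ?mulr0// zrM IH; ring. Qed.

Lemma pev_cat k l : pev x (k ++ l) = pev x k + x ^+ size k * pev x l.
Proof.
elim: k => [|c k IH]; first by rewrite add0r mul1r.
by rewrite /= IH exprS; ring.
Qed.

Lemma pev0 l : all (Z.eqb 0) l -> pev x l = 0.
Proof.
elim: l => // c l IH; rewrite (_ : all _ (c :: l) = Z.eqb 0 c && all (Z.eqb 0) l)//.
by move=> /andP[/Z.eqb_spec <- /IH h]; rewrite /= h zr0; ring.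
Qed.

End PolyEval.

(* The coefficients of [mu_poly] below the leading one. *)
Definition mu_coefs : seq Z :=
  [:: 1; 1; -1; -1; -2; -2; -3; 0; -2; 1; 0; 1; -3; 2; -2; 1; -2; 1; -1; 1; -1]%coq_Z.

(* Multiplication by the variable, modulo [mu_poly]. *)
Definition mulmu (l : seq Z) : seq Z :=
  padd (0%coq_Z :: take 20 l) (pscale (Z.opp (nth 0%coq_Z l 20)) mu_coefs).

Lemma pev_mulmu (K : comNzRingType) (x : K) l : pev x mu_coefs + x ^+ 21 = 0 ->
  (size l <= 21)%N -> pev x (mulmu l) = x * pev x l.
Proof.
move=> rx sl; have rx' : x ^+ 21 = - pev x mu_coefs by apply/eqP; rewrite -addr_eq0 addrC rx.
rewrite /mulmu pev_add pev_scale zrN; move: rx'; set q := pev x mu_coefs => rx'.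
have [s20|s20] := ltnP 20 (size l); last first.
  by rewrite nth_default// take_oversize// zr0 /= zr0; ring.
have {3}-> : l = take 20 l ++ [:: nth 0%coq_Z l 20].
  rewrite -{1}(cat_take_drop 20 l) (drop_nth 0%coq_Z)//; congr (_ ++ _ :: _).
  by apply/size0nil; rewrite size_drop; lia.
rewrite pev_cat size_takel ?(ltnW s20)// /= zr0.
have -> : x * (pev x (take 20 l) + x ^+ 20 * (zr K (nth 0%coq_Z l 20) + x * 0))
  = x * pev x (take 20 l) + x ^+ 21 * zr K (nth 0%coq_Z l 20) by ring.
by rewrite rx'; ring.
Qed.

Lemma size_mulmu l : (size l <= 21)%N -> (size (mulmu l) <= 21)%N.
Proof.
have size_padd (k m : seq Z) : size (padd k m) = maxn (size k) (size m).
  by elim: k m => [|c k IH] [|d m]; rewrite /= ?maxn0 ?max0n// IH maxnSS.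
by move=> sl; rewrite /mulmu size_padd size_map /= size_take; case: ifP; lia.
Qed.

Lemma pev_mulmun (K : comNzRingType) (x : K) n l : pev x mu_coefs + x ^+ 21 = 0 ->
  (size l <= 21)%N -> pev x (iter n mulmu l) = x ^+ n * pev x l.
Proof.
move=> rx sl; have [//] : pev x (iter n mulmu l) = x ^+ n * pev x l /\ (size (iter n mulmu l) <= 21)%N.
elim: n => [|n [IH1 IH2]]; first by rewrite mul1r.
by rewrite iterS pev_mulmu// IH1 exprS mulrA size_mulmu.
Qed.

(* A lower bound for [d ^ size l] times the value at any point of
   [[lo / d, hi / d]]. *)
Fixpoint plow (lo hi d : Z) (l : seq Z) : Z :=
  match l with
  | [::] => 0%coq_Z
  | c :: l' => let y := plow lo hi d l' in
    Z.add (c * Z.pow d (Z.of_nat (size l))) (if Z.leb 0 y then lo * y else hi * y)%coq_Z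
  end.

Lemma zrX (K : comNzRingType) d n : zr K (Z.pow d (Z.of_nat n)) = zr K d ^+ n.
Proof.
elim: n => [|n IH]; first by rewrite zr1.
have -> : Z.of_nat n.+1 = Z.succ (Z.of_nat n) by lia.
by rewrite Z.pow_succ_r ?zrM ?IH ?exprS//; lia.
Qed.

Lemma plowP (R : realType) (x : R) lo hi d l : 0 < zr R d -> Z.leb 0 lo ->
  zr R lo <= x * zr R d <= zr R hi -> zr R (plow lo hi d l) <= pev x l * zr R d ^+ size l.
Proof.
move=> d0 lo0 /andP[xlo xhi]; elim: l => [|c l IH]; first by rewrite /= zr0 mul0r.
set y := plow lo hi d l in IH *; set v := pev x l in IH *.
have -> : plow lo hi d (c :: l) = Z.add (Z.mul c (Z.pow d (Z.of_nat (size (c :: l)))))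
  (if Z.leb 0 y then Z.mul lo y else Z.mul hi y) by [].
rewrite zrD zrM zrX [pev x _]/= -/v mulrDl lerD//.
rewrite [size (_ :: _)]/= exprS.
have -> : x * v * (zr R d * zr R d ^+ size l) = x * zr R d * (v * zr R d ^+ size l) by ring.
have x0 : 0 <= x * zr R d by apply: le_trans xlo; rewrite -(zr0 R) zr_le.
apply: le_trans (ler_wpM2l x0 IH); case: ifP => hy; rewrite zrM.
  by rewrite ler_wpM2r// -(zr0 R) zr_le.
by rewrite ler_wnM2r// -(zr0 R) zr_le; lia.
Qed.


(* The certificate: a neighbor map [g], the coefficients of the [g]-entry
   of an eigenvector with eigenvalue [mu], as a polynomial in [mu] (zero if
   [F] meets [gF] in finitely many points only), and an integer correcting
   the count of pieces for the latter. *)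
Definition cert_row : Type := (nbmap * seq Z * Z)%type.

(** The table is closed: [closed_row] checks that each child is listed or dies. The entries of the
    eigenvector are reduced modulo [mu_poly] to degree at most 20 and scaled so that every nonzero
    one exceeds 1 at mu. *)
Definition survivors : seq cert_row := [::
  ((0%N, true, (1, 1, -1)), [::0; 0; 0; 0; 0; 0; 0; 0; 0; 0; 0; 122788; 0; 0; 0; 0; 0; 0; 0; 0; 0], -16);
  ((0%N, true, (1, 2, -2)), [::-6502; -14248; -5562; 40780; 43948; -16108; 15726; 8386; 25034; 46512; 44760; -19690; -18228; 19064; 9428; -21822; 4834; -12716; 19038; 17236; -12962], -22);
  ((0%N, true, (1, 2, -1)), [::12962; 6460; -27210; -18524; 14856; 18024; -54994; 15726; -17538; 37996; 46512; 57722; -58576; 7696; -6860; 22390; -47746; 17796; -25678; 32000; 4274], -24);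
  ((0%N, true, (2, 2, -2)), [::2090; 11926; 21900; -14468; -49592; -24660; -27150; -35536; -51746; 20118; -24642; -9364; 22100; -5788; -6392; 11018; 15008; 23312; 8686; -12962; 4412], -17);
  ((0%N, false, (-1, -1, 1)), [::-18137; -20274; 22481; 23504; 24806; 31286; 66113; 15423; 8777; -6000; -10906; 861; 14136; -1002; 2712; -10015; 30707; -2668; -7873; -7102; 3161], -4);
  ((0%N, false, (-1, 0, 1)), [::-2137; 4344; 5367; -11468; -4988; 11702; 15423; -27497; 12137; -10906; 18998; -40275; 35272; -33562; 8122; -5567; 15469; -26010; 11035; -14976; 18137], -2);
  ((0%N, false, (0, -1, 1)), [::-1002; -34564; -28712; 47944; 39462; 38554; 34754; -14042; -4508; 12210; 8994; -18482; 4386; 23220; 5532; 10404; -13834; 19550; 6352; -10412; -7814], 1);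
  ((1%N, true, (-1, 0, 1)), [::-18137; -20274; 22481; 23504; 24806; 31286; 66113; 15423; 8777; -6000; -10906; 861; 14136; -1002; 2712; -10015; 30707; -2668; -7873; -7102; 3161], -4);
  ((1%N, true, (-1, 1, 0)), [::6481; 3230; -13605; -9262; 7428; 9012; -27497; 7863; -8769; 18998; -38138; 28861; -29288; 3848; -3430; 11195; -23873; 8898; -12839; 16000; 2137], -2);
  ((1%N, true, (1, 1, -1)), [::-2137; 4344; 5367; -11468; -4988; 11702; 15423; -27497; 12137; -10906; 18998; -40275; 35272; -33562; 8122; -5567; 15469; -26010; 11035; -14976; 18137], -4);
  ((1%N, true, (1, 2, -1)), [::-33562; -29714; 46942; 37458; 36550; 31748; -14042; -6512; 13212; 8994; -17480; 1380; 25224; 3528; 11406; -15838; 20552; 5350; -9410; -8816; 1002], 1);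
  ((1%N, false, (1, 0, -1)), [::3051; 4514; -13121; -18418; -53066; -3980; -26415; 42389; -12559; 15944; -41172; 114729; -34126; 21572; -46990; 35413; -22947; 19696; -23569; 21410; -5985], 18);
  ((1%N, false, (1, 1, -2)), [::-6502; -14248; -5562; 40780; 43948; -16108; 15726; 8386; 25034; 46512; 44760; -19690; -18228; 19064; 9428; -21822; 4834; -12716; 19038; 17236; -12962], -23);
  ((1%N, false, (1, 1, -1)), [::6481; 3230; -13605; -9262; 7428; 9012; -27497; 7863; -8769; 18998; 84650; 28861; -29288; 3848; -3430; 11195; -23873; 8898; -12839; 16000; 2137], -20);
  ((1%N, false, (2, 1, -2)), [::5963; 17958; 4761; -29940; -35036; -22770; -31343; -41551; -16859; -2262; -18048; 9503; 6066; -4000; 1268; 15103; 18115; 17044; -3183; -3230; 1161], -19);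
  ((2%N, true, (1, 0, 0)), [::212; 8906; 18084; 15100; -33348; 33630; -9804; 23068; -35564; 19842; -46386; 82828; -52396; 25968; -31316; 34194; -21214; 23926; -15804; 12374; -7660], 0);
  ((2%N, true, (1, 1, -1)), [::-3251; -7124; -2781; 20390; 21974; -8054; 7863; 4193; 12517; 84650; 22380; -9845; -9114; 9532; 4714; -10911; 2417; -6358; 9519; 8618; -6481], -5);
  ((2%N, true, (2, 0, -1)), [::15425; 9440; -24461; -13954; -11744; -462; -42633; 21935; -4435; -14994; 6574; -519; -11088; -4530; -8694; 5823; 10155; -8018; 1537; 1714; 2159], 0);
  ((2%N, false, (-1, 1, 0)), [::-2137; 4344; 5367; -11468; -4988; 11702; 15423; -27497; 12137; -10906; 18998; -40275; 35272; -33562; 8122; -5567; 15469; -26010; 11035; -14976; 18137], -2);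
  ((2%N, false, (0, 0, 0)), [::-1002; -34564; -28712; 47944; 39462; 38554; 34754; -14042; -4508; 12210; 8994; -18482; 4386; 23220; 5532; 10404; -13834; 19550; 6352; -10412; -7814], -6);
  ((2%N, false, (0, 2, -1)), [::-3251; -7124; -2781; 20390; 21974; -8054; 7863; 4193; 12517; -38138; 22380; -9845; -9114; 9532; 4714; -10911; 2417; -6358; 9519; 8618; -6481], -2);
  ((2%N, false, (1, 1, -1)), [::6481; 3230; -13605; -9262; 7428; 9012; -27497; 7863; -8769; 18998; -38138; 28861; -29288; 3848; -3430; 11195; -23873; 8898; -12839; 16000; 2137], 0);
  ((3%N, true, (0, 1, 0)), [::-18137; -20274; 22481; 23504; 24806; 31286; 66113; 15423; 8777; -6000; -10906; 861; 14136; -1002; 2712; -10015; 30707; -2668; -7873; -7102; 3161], -6);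
  ((3%N, true, (0, 2, -1)), [::6481; 3230; -13605; -9262; 7428; 9012; -27497; 7863; -8769; 18998; -38138; 28861; -29288; 3848; -3430; 11195; -23873; 8898; -12839; 16000; 2137], -2);
  ((3%N, true, (1, 1, -1)), [::-4714; 2946; 12586; 5960; 19852; 9208; -34526; 10650; -376; 3034; -27904; 15128; -24584; 50420; -27648; 5934; -14228; 14160; -8840; 11552; -3430], 0);
  ((3%N, true, (1, 2, -2)), [::-3873; -6032; 17139; 15472; -14556; -1890; 4193; 6015; -34887; 22380; -6594; -18867; 16034; -1788; -7660; -4085; -3107; 6268; 11869; -9732; 3251], -2);
  ((3%N, false, (0, 0, 0)), [::18226; 26040; -11414; -60604; -72978; -4136; -30844; 15112; -1698; -11444; 3306; 30436; -37870; -5472; -16438; 25818; -23106; 13002; -24246; 29962; -4060], -6);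
  ((3%N, false, (1, 1, -1)), [::-3873; -6032; 17139; 15472; -14556; -1890; 4193; 6015; 87901; 22380; -6594; -18867; 16034; -1788; -7660; -4085; -3107; 6268; 11869; -9732; 3251], -5);
  ((4%N, true, (0, 1, 0)), [::7814; 6812; -42378; -36526; 32316; 23834; 15112; 34754; -29670; 3306; 12210; 16808; -41924; 20014; 7592; 13346; -5224; -6020; 11736; 14166; -18226], 1);
  ((4%N, true, (1, 1, -1)), [::-2159; 13266; 11599; -22302; -9636; -7426; 6015; 80155; 26253; -6594; -14994; 4415; 5958; -15406; -212; -10853; 10141; 7996; -5859; -622; 3873], -5);
  ((4%N, false, (0, 1, -1)), [::-2137; 4344; 5367; -11468; -4988; 11702; 15423; -27497; 12137; -10906; 18998; -40275; 35272; -33562; 8122; -5567; 15469; -26010; 11035; -14976; 18137], -4);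
  ((4%N, false, (1, 1, -1)), [::5985; 9036; -1471; -19106; -30388; -65036; -21935; -26415; 30419; -6574; 15944; -35187; 96774; -22156; 9602; -41005; 23443; -16962; 13711; -17584; 15425], -12);
  ((4%N, false, (1, 2, -2)), [::-3251; -7124; -2781; 20390; 21974; -8054; 7863; 4193; 12517; -38138; 22380; -9845; -9114; 9532; 4714; -10911; 2417; -6358; 9519; 8618; -6481], -2);
  ((5%N, true, (1, 1, -1)), [::-3051; -4514; 13121; 18418; 53066; 3980; 26415; -42389; 12559; -15944; 41172; 8059; 34126; -21572; 46990; -35413; 22947; -19696; 23569; -21410; 5985], -34);
  ((5%N, true, (1, 2, -1)), [::6481; 3230; -13605; -9262; 7428; 9012; -27497; 7863; -8769; 18998; -38138; 28861; -29288; 3848; -3430; 11195; -23873; 8898; -12839; 16000; 2137], -4);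
  ((5%N, true, (2, 2, -2)), [::-3873; -6032; 17139; 15472; -14556; -1890; 4193; 6015; -34887; 22380; -6594; -18867; 16034; -1788; -7660; -4085; -3107; 6268; 11869; -9732; 3251], 2);
  ((5%N, false, (0, 1, -1)), [::-1002; -34564; -28712; 47944; 39462; 38554; 34754; -14042; -4508; 12210; 8994; -18482; 4386; 23220; 5532; 10404; -13834; 19550; 6352; -10412; -7814], 1);
  ((5%N, false, (1, 1, -1)), [::15425; 9440; -24461; -13954; -11744; -462; 80155; 21935; -4435; -14994; 6574; -519; -11088; -4530; -8694; 5823; 10155; -8018; 1537; 1714; 2159], -5);
  ((0%N, true, (0, 1, 0)), [::], 2);
  ((0%N, true, (0, 2, -1)), [::], 2);
  ((0%N, true, (1, 3, -2)), [::], 2);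
  ((0%N, true, (2, 1, -1)), [::], 2);
  ((0%N, true, (2, 3, -3)), [::], 2);
  ((0%N, true, (3, 2, -3)), [::], 2);
  ((0%N, true, (3, 3, -3)), [::], 2);
  ((1%N, false, (0, 0, 0)), [::], 1);
  ((1%N, false, (0, 1, -1)), [::], 2);
  ((1%N, false, (1, 2, -2)), [::], 2);
  ((1%N, false, (2, 2, -3)), [::], 2);
  ((1%N, false, (3, 1, -3)), [::], 2);
  ((1%N, false, (3, 1, -2)), [::], 2);
  ((1%N, false, (3, 2, -3)), [::], 2);
  ((2%N, true, (0, 1, 0)), [::], 1);
  ((2%N, true, (2, 2, -2)), [::], 2);
  ((2%N, false, (-1, 0, 1)), [::], 1);
  ((3%N, true, (-1, 1, 0)), [::], 1);
  ((3%N, false, (0, 1, -1)), [::], 1);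
  ((3%N, false, (2, 1, -2)), [::], 2);
  ((4%N, true, (2, 1, -1)), [::], 2);
  ((4%N, false, (0, 0, 0)), [::], 1);
  ((4%N, false, (0, 2, -1)), [::], 1);
  ((5%N, true, (0, 1, 0)), [::], 1);
  ((5%N, true, (1, 2, -2)), [::], 1);
  ((5%N, true, (2, 1, -1)), [::], 2);
  ((5%N, false, (1, 0, -1)), [::], 2)]%coq_Z.

Definition nbeq (g h : nbmap) : bool :=
  let: (j, e, (p, q, s)) := g in let: (j', e', (p', q', s')) := h in
  [&& j == j', e == e', Z.eqb p p', Z.eqb q q' & Z.eqb s s'].

Definition lookup (g : nbmap) : option (seq Z * Z) :=
  omap (fun r : cert_row => (r.1.2, r.2)) (ohead [seq r <- survivors | nbeq r.1.1 g]).

(* Conditionals rather than [||] and [&&], so that computation is lazy. *)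
Fixpoint dead (n : nat) (g : nbmap) : bool :=
  if far g then true else
  if n is m.+1 then if dead m (child false g).2 then dead m (child true g).2 else false
  else false.

Definition evec (g : nbmap) : seq Z := oapp fst [::] (lookup g).
Definition corr (g : nbmap) : Z := oapp snd 0%coq_Z (lookup g).

Definition closed_row (r : cert_row) : bool :=
  all (fun s => if isSome (lookup (child s r.1.1).2) then true
    else dead 15 (child s r.1.1).2) [:: false; true].

(** The eigenvector equation is v(g) = sum over s of mu^(- lvl s g) v(child s g). It is multiplied
    by mu^5, because [lvl] is at most 5. *)
Definition eigen_term (s : bool) (g : nbmap) : seq Z :=
  iter (5 - lvl s g) mulmu (evec (child s g).2).

Definition eigen_row (r : cert_row) : bool :=
  let: (g, v, _) := r in
  all (Z.eqb 0) (padd (iter 5 mulmu v)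
    (pscale (-1)%coq_Z (padd (eigen_term false g) (eigen_term true g)))).

(** What the induction on the number of pieces needs: corrections add up along the subdivision, they
    are at least -100, they are at least 1 where the eigenvector vanishes, and elsewhere the entry
    exceeds 1. The integers enclose mu to nine decimals. *)
Definition bounded_row (r : cert_row) : bool :=
  let: (g, v, w) := r in
  [&& Z.leb (corr (child false g).2 + corr (child true g).2) w, Z.leb (-100) w,
      (g.1.1 <= 5)%N, (size v <= 21)%N &
      if v is [::] then Z.leb 1 w else
      Z.ltb (Z.pow 1000000000 21) (plow 1310065735 1310065736 1000000000 v)].

Lemma eigen_rowP (K : comNzRingType) (x : K) g v w : eigen_row (g, v, w) ->
  pev x (iter 5 mulmu v) = pev x (eigen_term false g) + pev x (eigen_term true g).
Proof.
rewrite /eigen_row => /(pev0 x); rewrite pev_add pev_scale pev_add.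
have -> : zr K (-1)%coq_Z = -1 by rewrite (zrN _ 1%coq_Z) zr1.
rewrite mulN1r => /eqP; rewrite subr_eq0 => /eqP h; exact: h.
Qed.

Lemma bounded_rowP g v w : bounded_row (g, v, w) ->
  [/\ Z.leb (corr (child false g).2 + corr (child true g).2) w, Z.leb (-100) w,
      (g.1.1 <= 5)%N, (size v <= 21)%N &
      is_true (if v is [::] then Z.leb 1 w else
      Z.ltb (Z.pow 1000000000 21) (plow 1310065735 1310065736 1000000000 v))].
Proof. by rewrite /bounded_row => /and5P[-> -> -> -> ->]. Qed.

Lemma survivors_closed : all closed_row survivors.
Proof. by vm_compute. Qed.

Lemma survivors_eigen : all eigen_row survivors.
Proof. by vm_compute. Qed.

Lemma survivors_bounded : all bounded_row survivors.
Proof. by vm_compute. Qed.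

Lemma nbeqP g h : reflect (g = h) (nbeq g h).
Proof.
case: g h => [[j e] [[p q] s]] [[j' e'] [[p' q'] s']].
apply: (iffP and5P) => [[/eqP -> /eqP -> /Z.eqb_spec -> /Z.eqb_spec -> /Z.eqb_spec ->]//|].
by case=> -> -> -> -> ->; rewrite !eqxx !Z.eqb_refl.
Qed.

Lemma lookup_mem g v w : lookup g = Some (v, w) -> (g, v, w) \in survivors.
Proof.
rewrite /lookup; case E: [seq r <- survivors | nbeq r.1.1 g] => [//|[[g' v'] w'] l] [<- <-].
have : (g', v', w') \in [seq r <- survivors | nbeq r.1.1 g] by rewrite E mem_head.
by rewrite mem_filter => /andP[/nbeqP /= ->].
Qed.

Lemma lookup_row r : r \in survivors -> isSome (lookup r.1.1).
Proof.
move=> rs; rewrite /lookup; case E: [seq r' <- survivors | nbeq r'.1.1 r.1.1] => [|//].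
have : r \in [seq r' <- survivors | nbeq r'.1.1 r.1.1].
  by rewrite mem_filter rs andbT; exact/nbeqP.
by rewrite E.
Qed.

(** * The tiles of the covering that meet F *)

Definition idmap : nbmap := (0%N, false, (0, 0, 0)%coq_Z).

Definition reduced (g : nbmap) : nbmap :=
  let: (j, e, t) := g in
  if (j == 0%N) && ~~ zle t (flip e t) then (0%N, e, flip e t) else g.

Definition zupp (t : zbeta) : Z := Z.opp (zlow (zopp t)).

(* A necessary condition, with numerical slack except at the excluded end
   point, for the translation part [t] of [tile_map j e t0] when [germ j e t0]. *)
Definition germ_range (j : nat) (e : bool) (t : zbeta) : bool :=
  let t1 := if e then t else zopp t in
  let t2 := if j == 0%N then t1 else iter (5 - j) zmulx t1 in
  if Z.ltb (zupp t1) 0 then false else if Z.ltb 1000000 (zlow t2) then false else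
  if e then ~~ nbeq (0%N, false, t1) (0%N, false, (0, 0, 0)%coq_Z)
  else ~~ nbeq (0%N, false, t2) (0%N, false, zone).

(** This makes the table exhaustive: a tile of the covering that meets [F] is [F] itself, or its
    reduced map is listed. *)
Definition init_ok (j : nat) (e : bool) (t : zbeta) : bool :=
  let g := (j, e, t) in
  if ~~ germ_range j e t then true else
  if nbeq g idmap then true else
  if isSome (lookup (reduced g)) then true else dead 15 g.

Definition unit_range (q s : Z) : seq zbeta :=
  let hi := Z.div (1000000 - zlow (0, q, s)%coq_Z) 1000000 in
  let lo := Z.opp (Z.div (1000000 - zlow (zopp (0, q, s)%coq_Z)) 1000000) in
  [seq (Z.add lo (Z.of_nat i), q, s) | i <- iota 0 (Z.to_nat (hi - lo + 1)%coq_Z)].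

(** The ranges come from [zcoord_le] with real value at most 1 and modulus at most 6: 4 |s| <= 31
    gives 7, and |q| <= 12 + 1.33 * 7.75 gives 22. *)
Lemma init_check : all (fun q => all (fun s => all (fun t =>
    all (fun j => all (fun e => init_ok j e t) [:: false; true]) (iota 0 5))
  (unit_range q s)) (zrng 7)) (zrng 22).
Proof. by vm_compute. Qed.

Lemma mem_unit_range p q s : Z.leb (zlow (p, q, s)) 1000000 ->
  Z.leb (zlow (zopp (p, q, s))) 1000000 -> (p, q, s) \in unit_range q s.
Proof.
rewrite /unit_range /zlow /zopp.
set a := Z.mul q _; set d := Z.mul s _; set a' := Z.mul (Z.opp q) _; set d' := Z.mul (Z.opp s) _.
move=> h1 h2; set lo := Z.opp (Z.div _ _); set hi := Z.div _ _.
have h3 : Z.le p hi by apply: Z.div_le_lower_bound; lia.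
have h4 : Z.le lo p.
  suff : Z.le (Z.opp p) (Z.opp lo) by lia.
  by rewrite /lo Z.opp_involutive; apply: Z.div_le_lower_bound; lia.
apply/mapP; exists (Z.to_nat (p - lo)%coq_Z); last by congr (_, _, _); lia.
rewrite mem_iota; lia.
Qed.

Lemma zr_abs_lt (R : realType) m n : `|zr R m| < n%:R + 1 -> Z.leb (Z.abs m) (Z.of_nat n).
Proof.
move=> h; suff : Z.ltb (Z.abs m) (Z.of_nat n + 1) by lia.
rewrite -(zr_lt R) zrD zr_nat zr1; apply: le_lt_trans h.
by case: (Z.abs_spec m) => -[_ ->]; rewrite ?zrN ?ler_norm// -normrN ler_norm.
Qed.

Lemma child_le5 s g : (g.1.1 <= 5)%N -> ((child s g).2.1.1 <= 5)%N.
Proof.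
have w5 : (wt1 s <= 5)%N by case: s.
by have := lvl_child s g; case: (child s g) => [[] h] /= [_ hE]; lia.
Qed.

Section Pairs.
Variables (R : realType) (beta : R) (b : R[i]) (F : set R[i]).
Hypothesis pp : plastic_pair beta b.
Hypothesis tF : is_tile b F.

Let beta3 : beta ^+ 3 = beta + 1. Proof. by case: pp. Qed.
Let b3 := b3 pp.
Let r := normc b.
Let r0 : 0 <= r. Proof. exact: ltW (r_gt0 pp). Qed.
Let r1 : r < 1. Proof. exact: r_lt1 pp. Qed.

Definition meet (g : nbmap) : set R[i] := [set z | F z /\ exists2 y, F y & z = act b g y].

Lemma act_inj g : injective (act b g).
Proof.
move=> z w /eqP; rewrite -subr_eq0 -normc_eq0 act_dist mulf_eq0 expf_eq0.
by rewrite (gt_eqF (r_gt0 pp)) andbF normc_eq0 subr_eq0 => /eqP.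
Qed.

Lemma branch_inj s : injective (branch b s).
Proof.
move=> z w /eqP; rewrite -subr_eq0 -normc_eq0 branch_dist mulf_eq0 expf_eq0.
by rewrite (gt_eqF (r_gt0 pp)) andbF normc_eq0 subr_eq0 => /eqP.
Qed.

Lemma meet_child g z : meet g z -> exists s w, meet (child s g).2 w /\
  z = if (child s g).1 then act b g w else branch b s w.
Proof.
move=> [Fz [y Fy zE]]; have [s [x [Fx zx]]] := tile_split tF Fz.
have := childP b3 s g; case E : (child s g) => [[] h] /= H; exists s; rewrite E.
  exists y; split=> //; split=> //; exists x => //.
  by apply: (@act_inj g); rewrite -zE zx H.
exists x; split=> //; split=> //; exists y => //.
by apply: (@branch_inj s); rewrite -zx zE H.
Qed.

Lemma dead_meet n g z : (g.1.1 <= 5)%N -> dead n g -> ~ meet g z.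
Proof.
elim: n g z => [|n IH] g z g5 /=; case: ifP => [gfar _ [Fz [y Fy zE]]|_]//;
  try exact: (far_disjoint pp tF g5 gfar Fz Fy zE).
case: ifP => // d0 d1 /meet_child[s [w [hw _]]].
by case: s hw; apply: IH => //; exact: child_le5.
Qed.

(** The centre b^-2 has modulus beta < 1.33, to which the radius 3/2 is added. *)
Lemma normc_tile z : F z -> normc z <= 283 / 100.
Proof.
move=> Fz; have := tile_disc pp tF Fz; set c := zev b zctr.
have /andP[_ bb] := beta_coarse pp.
have : normc c <= 133 / 100.
  have : normc c ^+ 2 = beta ^+ 2.
    rewrite (zev_znorm2 pp) /znorm2 /zctr /zev /= !zr0 zr1; ring.
  move=> h; have -> : normc c = beta; last exact: ltW.
  by apply: (@pexpIrn _ 2) h; rewrite ?nnegrE ?normc_ge0// ltW// (beta_gt0 pp).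
have := normcD (z - c) c; rewrite subrK; lra.
Qed.

Lemma zupp_ge t : zev beta t * mega R <= zr R (zupp t).
Proof.
by rewrite /zupp zrN lerNr; have := zlow_le pp (zopp t); rewrite zevN mulNr.
Qed.

Lemma germ_rangeP j e t : (j <= 4)%N -> germ beta j e t ->
  germ_range j e (iter j zmulx (if e then t else zopp t)).
Proof.
move=> j4 gj; rewrite /germ_range.
set t1 := if e then _ else _.
have t1E : t1 = iter j zmulx t.
  rewrite /t1; case: (e) => //; elim: (j) => /= [|k]; first by case: (t) => [[p q] s]; congr (_, _, _); lia.
  set u := iter k _ _; set v := iter k _ _ => <-.
  by case: u => [[p q] s]; rewrite /zopp /zmulx; congr (_, _, _); lia.
set t2 := if _ == _ then _ else _.
have b0 := beta_gt0 pp.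
have t1v : zev beta t1 = beta ^+ j * zev beta t by rewrite t1E zev_mulxn.
have t2v : zev beta t2 = zev beta t * (if j == 0%N then 1 else beta ^+ 5).
  rewrite /t2; case: eqP => [j0|j0]; first by rewrite t1v j0 mul1r mulr1.
  rewrite (zev_mulxn beta3 (5 - j) t1) t1v mulrA -exprD subnK; last exact: ltnW.
  by rewrite mulrC.
have bj : 0 < beta ^+ j by rewrite exprn_gt0.
have M0 := mega_gt0 R.
have nb u v : nbeq (0%N, false, u) (0%N, false, v) -> u = v by move/nbeqP => [].
have neg : ~ (zev beta t1 < 0) -> Z.ltb (zupp t1) 0 = false.
  move=> h; apply/negP; rewrite -(zr_lt R) zr0 => /(le_lt_trans (zupp_ge t1)) h2.
  by apply: h; rewrite -(pmulr_llt0 _ M0).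
have big : zev beta t2 <= 1 -> Z.ltb 1000000 (zlow t2) = false.
  move=> h; apply/negP; rewrite -(zr_lt R) => /lt_le_trans /(_ (zlow_le pp t2)).
  by rewrite -/(mega R) -[ltLHS]mul1r ltr_pM2r// ltNge h.
move: gj; rewrite /germ -t2v; case: (e) => -[h1 h2].
  rewrite neg ?big//; last by apply/negP; rewrite -leNgt t1v mulr_ge0// ltW.
  apply/negP => /nb h; move: h1; rewrite -(pmulr_rgt0 _ bj) -t1v h /zev zr0.
  by rewrite !mul0r !addr0 ltxx.
rewrite neg ?big ?ltW//; last by apply/negP; rewrite -leNgt t1v mulr_ge0// ltW.
by apply/negP => /nb h; move: h2; rewrite h zev1 ltxx.
Qed.

Lemma init_meet j e t z : (j <= 4)%N -> germ beta j e t -> meet (tile_map j e t) z ->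
  tile_map j e t = idmap \/ isSome (lookup (reduced (tile_map j e t))).
Proof.
move=> j4 gj mz; have gr := germ_rangeP j4 gj; move: mz.
rewrite /tile_map; set u := iter j _ _ in gr *; move=> mz.
have [Fz [y Fy zE]] := mz.
have b1 : 1 <= beta by have /andP[? _] := beta_coarse pp; lra.
have u1 : `|zev beta u| <= 1.
  have uE : `|zev beta u| = beta ^+ j * zev beta t.
    rewrite /u zev_mulxn// normrM ger0_norm ?exprn_ge0 ?(le_trans ler01)//.
    by congr (_ * _); move: gj; rewrite /germ; case: (e) => -[h _];
      rewrite ?zevN ?normrN ger0_norm// ltW.
  have t0 : 0 <= zev beta t by move: gj; rewrite /germ; case: (e) => -[h _]//; exact: ltW.
  have tk : zev beta t * (if j == 0%N then 1 else beta ^+ 5) <= 1.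
    by move: gj; rewrite /germ; case: (e) => -[_ h]//; exact: ltW.
  rewrite uE mulrC; apply: le_trans tk; rewrite ler_wpM2l//.
  case: eqP => [->//|_]; apply: ler_weXn2l => //; lia.
have u2 : normc (zev b u) <= 6.
  have -> : zev b u = z - (-1) ^+ e * b ^+ j * y by rewrite zE /act addrAC subrr add0r.
  have := normcD z (- ((-1) ^+ e * b ^+ j * y)); rewrite normcN !normcM -signr_odd !normcX normcN normc1 expr1n mul1r.
  have : normc b ^+ j * normc y <= normc y by rewrite ler_piMl ?normc_ge0// exprn_ile1// ltW.
  have := normc_tile Fz; have := normc_tile Fy; lra.
have [hs hq _] := zcoord_le pp u1 u2.
have M0 := mega_gt0 R.
have hr (v : zbeta) : `|zev beta v| <= 1 -> Z.leb (zlow v) 1000000.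
  move=> h; rewrite -(zr_le R); apply: (le_trans (zlow_le pp v)).
  by rewrite -/(mega R) ger_pMl// (le_trans (ler_norm _)).
have S7 : `|zr R u.2| < 7%:R + 1 by lra.
have Q22 : `|zr R u.1.2| < 22%:R + 1 by lra.
have /allP/(_ _ (mem_zrng (zr_abs_lt Q22)))/allP/(_ _ (mem_zrng (zr_abs_lt S7))) := init_check.
have uR : u \in unit_range u.1.2 u.2.
  have h1 := hr _ u1; have h2 := hr (zopp u); rewrite zevN normrN in h2.
  by case: (u) h1 (h2 u1) => [[p q] s]; exact: mem_unit_range.
move=> /allP/(_ _ uR)/allP/(_ j); rewrite mem_iota => /(_ j4)/allP/(_ e).
have -> : e \in [:: false; true] by case: (e).
move=> /(_ isT); rewrite /init_ok gr [~~ true]/=.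
case: ifP => [/nbeqP ->|_]; first by left.
case: ifP => [|_ hd]; first by right.
by case: (@dead_meet 15 (j, e, u) z (leqW j4) hd mz).
Qed.

(** Points outside [F] close to z lie in tiles of the covering other than [F]. Near z there are
    finitely many of these and they are compact, so one of them contains z. *)
Lemma boundary_meet z : F z -> (forall e : R, 0 < e -> exists2 w, ~ F w & normc (w - z) < e) ->
  exists g, meet g z /\ isSome (lookup (reduced g)).
Proof.
move=> Fz zb; have [L [LP Lcov]] := covering_local pp tF (normc z + 1).
have [[g [gL gid gz]]|H] := pselect (exists g, [/\ g \in L, g <> idmap & (act b g @` F) z]).
  have [j [e [t [j4 gj gE]]]] := LP _ gL; have [y Fy yz] := gz.
  have mz : meet g z by split=> //; exists y.
  exists g; split=> //; rewrite gE in gid mz *.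
  by have [/gid|] := init_meet j4 gj mz.
have [|g gL gz|e e0 He] := @sep_finite _ _ (fun g => act b g @` F) [seq g <- L | g != idmap] z.
- by move=> g _; exact: (act_image_compact pp tF).
- move: gL; rewrite mem_filter => /andP[/eqP gid gL] .
  by apply: H; exists g.
have [|w Fw] := zb (Num.min e 1); first by rewrite lt_min e0 ltr01.
rewrite lt_min => /andP[we w1]; have [|g gL gw] := Lcov w.
  by have := normcD (w - z) z; rewrite subrK; lra.
have [gid|gid] := eqVneq g idmap.
  move: gw => [y Fy]; rewrite gid /act /= zev0 addr0 !mul1r => yw.
  by case: Fw; rewrite -yw.
have := He g w; rewrite mem_filter gid gL => /(_ isT gw).
by rewrite leNgt we.
Qed.

(** Finitely many images of [F] cover a disc, so one contains a disc. The map g does not increase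
    distances, so a disc of the same radius lies in [F]. *)
Lemma tile_interior : exists z (e : R), 0 < e /\ forall w, normc (w - z) < e -> F w.
Proof.
have [L [_ Lcov]] := covering_local pp tF 1.
have [||w w1|g [z [e [gL e0 H]]]] := @ball_in_union _ _ (fun g => act b g @` F) L 0 1.
- by move=> g _; exact: (act_image_compact pp tF).
- exact: ltr01.
- by apply: Lcov; move: w1; rewrite subr0 => /ltW.
have [w Fw wz] : (act b g @` F) z by apply: H; rewrite subrr normc0.
exists w, e; split=> // v vw.
have [|v' Fv' /act_inj <-//] := H (act b g v).
rewrite -wz act_dist; apply: le_lt_trans vw.
by rewrite ler_piMl ?normc_ge0// exprn_ile1// ltW.
Qed.

End Pairs.

(* Any map with a positive entry in the eigenvector would do. *)
Definition g_start : nbmap := (0%N, true, (1, 1, -1)%coq_Z).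

Lemma g_start_lookup : isSome (lookup g_start).
Proof. by vm_compute. Qed.

Lemma g_start_corr : Z.ltb (corr g_start) 1.
Proof. by vm_compute. Qed.


(** * Counting the pieces of the boundary *)

(* Otherwise unification may evaluate the table on symbolic arguments. *)
Opaque lookup.

Lemma lvl_le5 s g : (lvl s g <= 5)%N.
Proof. by rewrite /lvl; case: s => /=; lia. Qed.

(** [lvl] is 0 when the tiles have equal size, so n alone need not decrease. But n + (n - j), what
    the two tiles still have to lose, drops by [wt1 s] in every case. *)
Lemma child_measure s g m n : (g.1.1 <= 5)%N -> (5 < n)%N ->
  (2 * n + 5 - g.1.1 <= m.+1)%N -> (2 * (n - lvl s g) + 5 - (child s g).2.1.1 <= m)%N.
Proof.
have := lvl_child s g; have := lvl_le5 s g.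
by case: (child s g) => [[] h] /=; case: s => /= ? [] ? ? ? ? ?; lia.
Qed.

Lemma subn5_le d n : (n - 5 <= d + (n - d - 5))%N.
Proof. lia. Qed.

Lemma subn5E d n : (d <= 5)%N -> (5 < n)%N -> (n - d = n - 5 + (5 - d))%N.
Proof. lia. Qed.

Lemma eigen_combine (R : fieldType) (k v v1 v2 a c1 c2 p : R) : p != 0 ->
  p * v = c1 * v1 + c2 * v2 ->
  k * v1 * (a * c1 / p) + k * v2 * (a * c2 / p) = k * v * a.
Proof.
move=> p0 pv; have -> : k * v * a = k * a / p * (p * v) by field.
by rewrite pv; field.
Qed.

(** The inverse of [g] when its exponent is 0. *)
Definition unflip (g : nbmap) : nbmap := (0%N, g.1.2, flip g.1.2 g.2).

Lemma reduced_cases g : reduced g = g \/ g = unflip (reduced g) /\ (reduced g).1.1 = 0%N.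
Proof.
case: g => [[j e] t]; rewrite /reduced; case: ifP => [/andP[/eqP -> _]|_]; last by left.
right; split=> //; rewrite /unflip /=; congr (_, _, _).
by case: t => [[p q] s]; rewrite /flip /zsign /zopp; case: e; congr (_, _, _); lia.
Qed.

Definition mu_spec (R : realType) (mu : R) : Prop :=
  pev mu mu_coefs + mu ^+ 21 = 0 /\
  zr R 1310065735%coq_Z <= mu * zr R 1000000000%coq_Z <= zr R 1310065736%coq_Z.

Section Counting.
Variables (R : realType) (beta mu : R) (b : R[i]) (F : set R[i]).
Hypothesis pp : plastic_pair beta b.
Hypothesis tF : is_tile b F.
Hypothesis muP : mu_spec mu.

Let beta3 : beta ^+ 3 = beta + 1. Proof. by case: pp. Qed.
Let b3 := b3 pp.
Let r := normc b.
Let r0 : 0 <= r. Proof. exact: ltW (r_gt0 pp). Qed.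
Let r1 : r < 1. Proof. exact: r_lt1 pp. Qed.

Let giga_gt0 : 0 < zr R 1000000000%coq_Z.
Proof. by rewrite -(zr0 R) zr_lt. Qed.

Lemma mu_gt1 : 1 < mu.
Proof.
case: muP => _ /andP[h _]; rewrite -(ltr_pM2r giga_gt0) mul1r; apply: lt_le_trans h.
by rewrite zr_lt.
Qed.

Lemma mu_lt_beta : mu < beta.
Proof.
case: muP => _ /andP[_ h]; rewrite -(ltr_pM2r giga_gt0); apply: (le_lt_trans h).
have /andP[h2 _] := beta_bounds pp.
rewrite (_ : 1000000000%coq_Z = (1000000 * 1000)%coq_Z)// zrM mulrA -/(mega R).
have k0 : 0 < zr R 1000%coq_Z by rewrite -(zr0 R) zr_lt.
apply: lt_le_trans (ler_wpM2r (ltW k0) h2); by rewrite -zrM zr_lt.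
Qed.

Definition weightv (g : nbmap) : R := pev mu (evec g).

Lemma lookupE g : isSome (lookup g) -> lookup g = Some (evec g, corr g).
Proof. by rewrite /evec /corr; case: (lookup g) => [[v w]|]. Qed.

Lemma lookupN g : ~~ isSome (lookup g) -> weightv g = 0 /\ corr g = 0%coq_Z.
Proof. by rewrite /weightv /evec /corr; case: (lookup g). Qed.

Lemma survivor_bounded g : isSome (lookup g) -> bounded_row (g, evec g, corr g).
Proof. by move=> /lookupE/lookup_mem gm; have /allP/(_ _ gm) := survivors_bounded. Qed.

Lemma survivor_le5 g : isSome (lookup g) -> (g.1.1 <= 5)%N.
Proof. by move=> /survivor_bounded/bounded_rowP[_ _ h _ _]; exact: h. Qed.

Lemma size_evec g : (size (evec g) <= 21)%N.
Proof.
have [/survivor_bounded/bounded_rowP[_ _ _ h _]|] := boolP (isSome (lookup g)); first exact: h.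
by rewrite /evec; case: (lookup g).
Qed.

Lemma weightv_eq g : isSome (lookup g) -> mu ^+ 5 * weightv g =
  mu ^+ (5 - lvl false g) * weightv (child false g).2 +
  mu ^+ (5 - lvl true g) * weightv (child true g).2.
Proof.
move=> /lookupE/lookup_mem gm.
have /allP/(_ _ gm)/(eigen_rowP mu) := survivors_eigen.
have [rt _] := muP.
have e1 := pev_mulmun 5 rt (size_evec g).
have e2 := pev_mulmun (5 - lvl false g) rt (size_evec (child false g).2).
have e3 := pev_mulmun (5 - lvl true g) rt (size_evec (child true g).2).
move=> h; exact: (etrans (esym e1) (etrans h (congr2 +%R e2 e3))).
Qed.

Lemma corr_le g : isSome (lookup g) ->
  zr R (corr (child false g).2) + zr R (corr (child true g).2) <= zr R (corr g).
Proof. by move=> /survivor_bounded/bounded_rowP[h _ _ _ _]; rewrite -zrD zr_le; exact: h. Qed.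

Lemma corr_ge g : isSome (lookup g) -> -100 <= zr R (corr g).
Proof.
move=> /survivor_bounded/bounded_rowP[_ h _ _ _].
by move: h; rewrite -(zr_le R) (zrN _ 100%coq_Z) (zr_nat _ 100).
Qed.

Lemma weightv_cases g : isSome (lookup g) ->
  (weightv g = 0 /\ 1 <= zr R (corr g)) \/ 1 < weightv g.
Proof.
move=> /survivor_bounded/bounded_rowP[_ _ _ + +].
rewrite /weightv; case: (evec g) => [|c l] h2 h3.
  by left; move: h3; rewrite -(zr_le R) zr1.
right; move: h3; rewrite -(zr_lt R) (zrX R _ 21) => h3.
have [_ mub] := muP; have := @plowP R mu 1310065735%coq_Z 1310065736%coq_Z _ (c :: l) giga_gt0 isT mub.
set x := pev mu (c :: l); move=> h4.
have g1 : 1 <= zr R 1000000000%coq_Z by rewrite -(zr1 R) zr_le.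
have := lt_le_trans h3 h4; rewrite -(subnKC h2) exprD; set D := _ ^+ size (c :: l).
have D0 : 0 < D by rewrite exprn_gt0.
rewrite mulrC ltr_pM2r//; apply: le_lt_trans.
exact: exprn_ege1.
Qed.

Lemma weightv_ge0 g : 0 <= weightv g.
Proof.
have [h|/lookupN[-> _]//] := boolP (isSome (lookup g)).
by have [[-> _]|/ltW] := weightv_cases h => //; apply: le_trans.
Qed.

(** An entry above 1 times 101, plus a correction of at least -100, is at least 1; mu^5 cancels the
    division in [meet_cover]. *)
Let kk := 101 * mu ^+ 5.

Let mu0 : 0 < mu. Proof. exact: lt_trans mu_gt1. Qed.

Definition pair_lift (s : bool) (g : nbmap) : R[i] -> R[i] :=
  if (child s g).1 then act b g else branch b s.

Lemma pair_lift_dist s g z w : normc (pair_lift s g z - pair_lift s g w) = r ^+ lvl s g * normc (z - w).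
Proof.
rewrite /pair_lift; have := lvl_child s g; case: ifP => _ [-> _]; first exact: act_dist.
exact: branch_dist.
Qed.

(** The bound for g dominates the sum of those for its children: the main terms by the eigenvector
    equation, the corrections by [corr_le]. It is at least 1 when n <= 5, where one disc suffices.
    Children outside the table are dead and need no discs. *)
Lemma meet_cover m g n : isSome (lookup g) -> (2 * n + 5 - g.1.1 <= m)%N ->
  exists2 l : seq R[i], (size l)%:R <= kk * weightv g * (mu ^+ n / mu ^+ 5) + zr R (corr g) &
    forall z, meet b F g z -> exists2 c, c \in l & normc (z - c) <= 3 / 2 * r ^+ (n - 5).
Proof.
have mun0 : mu != 0 by rewrite gt_eqF.
have c5 : mu ^+ 5 != 0 by rewrite expf_neq0.
have base h k : isSome (lookup h) -> 1 <= kk * weightv h * (mu ^+ k / mu ^+ 5) + zr R (corr h).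
  move=> sh; have := corr_ge sh; have [[-> h1]|h1] := weightv_cases sh.
    by rewrite mulr0 mul0r add0r.
  have -> : kk * weightv h * (mu ^+ k / mu ^+ 5) = 101 * (weightv h * mu ^+ k).
    by rewrite /kk; field; rewrite ?mun0.
  have : 1 <= weightv h * mu ^+ k by rewrite mulr_ege1 ?exprn_ege1// ltW// mu_gt1.
  lra.
have small h k : isSome (lookup h) -> (k <= 5)%N ->
    exists2 l : seq R[i], (size l)%:R <= kk * weightv h * (mu ^+ k / mu ^+ 5) + zr R (corr h) &
    forall z, meet b F h z -> exists2 c, c \in l & normc (z - c) <= 3 / 2 * r ^+ (k - 5).
  move=> sh k5; exists [:: zev b zctr] => [|z [Fz _]]; first exact: base.
  exists (zev b zctr); first by rewrite mem_head.
  by rewrite (eqP k5) expr0 mulr1; exact: (tile_disc pp tF).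
elim: m g n => [|m IH] g n sg mn.
  by apply: small => //; have := survivor_le5 sg; move: mn; lia.
have [n5|n5] := leqP n 5; first exact: small.
have ch s : exists2 l : seq R[i],
    (size l)%:R <= kk * weightv (child s g).2 * (mu ^+ (n - lvl s g) / mu ^+ 5) + zr R (corr (child s g).2) &
    forall z, meet b F (child s g).2 z ->
      exists2 c, c \in l & normc (pair_lift s g z - pair_lift s g c) <= 3 / 2 * r ^+ (n - 5).
  have [sh|nh] := boolP (isSome (lookup (child s g).2)).
    have [|l lsz lcov] := IH (child s g).2 (n - lvl s g)%N sh.
      exact: child_measure (survivor_le5 sg) n5 mn.
    exists l => // z /lcov[c cl zc]; exists c => //; rewrite pair_lift_dist.
    apply: le_trans (ler_wpM2l (exprn_ge0 _ r0) zc) _.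
    rewrite mulrCA ler_wpM2l// -exprD ler_wiXn2l ?(ltW r1)//.
    exact: subn5_le.
  exists [::] => [|z mz]; first by have [-> ->] := lookupN nh; rewrite mulr0 mul0r zr0 addr0.
  have := survivors_closed; have /lookupE/lookup_mem gm := sg.
  move=> /allP/(_ _ gm)/allP/(_ s); have -> : s \in [:: false; true] by case: (s).
  move=> /(_ isT); rewrite (negbTE nh) => hd.
  by case: (dead_meet pp tF (child_le5 s (survivor_le5 sg)) hd mz).
have [lf szf covf] := ch false; have [lt szt covt] := ch true.
exists (map (pair_lift false g) lf ++ map (pair_lift true g) lt).
  rewrite size_cat !size_map natrD.
  apply: (le_trans (lerD szf szt)); rewrite addrACA; apply: lerD; last exact: corr_le.
  have split s : mu ^+ (n - lvl s g) = mu ^+ (n - 5) * mu ^+ (5 - lvl s g).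
    by rewrite -exprD (subn5E (lvl_le5 s g) n5).
  rewrite !split -[in leRHS](subnK (ltnW n5)) exprD mulfK//.
  rewrite (eigen_combine kk (mu ^+ (n - 5)) c5 (weightv_eq sg)); exact: lexx.
move=> z /(meet_child pp tF)[s [w [mw zE]]].
have [c cl wc] : exists2 c, c \in (if s then lt else lf) & normc (pair_lift s g w - pair_lift s g c) <= 3 / 2 * r ^+ (n - 5).
  by case: s mw {zE} => [/covt|/covf].
exists (pair_lift s g c); last by rewrite zE; move: wc; rewrite /pair_lift; case: ifP.
by rewrite mem_cat; case: s cl {mw zE wc} => cl; rewrite map_f ?orbT.
Qed.

Let tile_boundary (z : R[i]) : Prop :=
  F z /\ forall e : R, 0 < e -> exists2 w, ~ F w & normc (w - z) < e.

Lemma act_unflip g z : g.1.1 = 0%N -> act b g (act b (unflip g) z) = z.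
Proof.
case: g => [[j e] t] /= ->; rewrite zev_flip expr0 !mulr1 mulrDr mulrN !mulrA -expr2.
by rewrite sqrr_sign; ring.
Qed.

(** The table may list g^-1 in place of g. Then g is an isometry and maps the intersection of [F]
    and g^-1 F onto that of [F] and [gF], so its discs are moved along; this is the second case of
    [near_]. *)
Lemma boundary_cover : exists2 C : R, 0 <= C & forall n, exists2 l : seq R[i],
  (size l)%:R <= C * mu ^+ n &
  forall z, tile_boundary z -> exists2 c, c \in l & normc (z - c) <= 3 / 2 * r ^+ (n - 5).
Proof.
pose near_ g z := meet b F g z \/ exists2 y, meet b F g y & z = act b (unflip g) y.
have H (L : seq nbmap) : (forall g, g \in L -> isSome (lookup g)) ->
    exists2 C : R, 0 <= C & forall n, exists2 l : seq R[i], (size l)%:R <= C * mu ^+ n &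
      forall g z, g \in L -> near_ g z ->
      exists2 c, c \in l & normc (z - c) <= 3 / 2 * r ^+ (n - 5).
  elim: L => [_|g L IH sL]; first by exists 0 => // n; exists [::] => //; rewrite mul0r.
  have [|C C0 HC] := IH; first by move=> h hL; apply: sL; rewrite inE hL orbT.
  have sg := sL _ (mem_head _ _).
  set V := weightv g; have V0 : 0 <= V := weightv_ge0 g; set w := zr R (corr g).
  have kk0 : 0 <= kk by rewrite mulr_ge0// exprn_ge0// ltW.
  exists (C + 2 * (kk * V + `|w|)).
    by rewrite addr_ge0// mulr_ge0// addr_ge0// mulr_ge0.
  move=> n; have [l szl covl] := HC n; have [l' szl' covl'] := @meet_cover _ g n sg (leqnn _).
  have mun : 1 <= mu ^+ n by rewrite exprn_ege1// ltW// mu_gt1.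
  have szk : (size l')%:R <= (kk * V + `|w|) * mu ^+ n.
    apply: (le_trans szl'); rewrite mulrDl; apply: lerD; last first.
      by apply: (le_trans (ler_norm _)); rewrite ler_peMr.
    apply: ler_wpM2l; first by rewrite mulr_ge0.
    rewrite ler_pdivrMr ?exprn_gt0// ler_peMr ?(le_trans ler01)//.
    by rewrite exprn_ege1// ltW// mu_gt1.
  exists (l ++ l' ++ map (act b (unflip g)) l').
    rewrite !size_cat size_map !natrD; set x := (size l')%:R in szk *; lra.
  move=> h z; rewrite inE => /orP[/eqP -> [mz|[y my ->]]|hL nz].
  - by have [c cl zc] := covl' _ mz; exists c; rewrite // !mem_cat cl orbT.
  - have [c cl zc] := covl' _ my; exists (act b (unflip g) c).
      by rewrite !mem_cat map_f// !orbT.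
    by rewrite act_dist expr0 mul1r.
  - by have [c cl zc] := covl _ _ hL nz; exists c; rewrite // mem_cat cl.
have [|C C0 HC] := H (map (fun x : cert_row => x.1.1) survivors).
  by move=> g /mapP[row rs ->]; exact: lookup_row.
exists C => // n; have [l szl cov] := HC n; exists l => // z [Fz zb].
have [g [mz sg]] := boundary_meet pp tF Fz zb.
have kg : reduced g \in map (fun x : cert_row => x.1.1) survivors.
  by have /lookupE/lookup_mem gm := sg; apply/mapP; exists (reduced g, evec (reduced g), corr (reduced g)).
apply: (cov _ _ kg); have [gE|[gE g0]] := reduced_cases g; first by left; rewrite gE.
right; have [_ [y Fy zE]] := mz; exists y; last by rewrite -gE.
by split=> //; exists z; rewrite // zE {2}gE act_unflip.
Qed.

End Counting.

(** * Intersections of neighboring tiles have no interior *)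

Lemma Re_le_normc (R : realType) (z : R[i]) : `|complex.Re z| <= normc z.
Proof.
rewrite -ler_sqr ?nnegrE ?normc_ge0// real_normK ?num_real// sqr_normcE.
by rewrite lerDl sqr_ge0.
Qed.

Lemma Im_le_normc (R : realType) (z : R[i]) : `|complex.Im z| <= normc z.
Proof.
rewrite -ler_sqr ?nnegrE ?normc_ge0// real_normK ?num_real// sqr_normcE.
by rewrite lerDr sqr_ge0.
Qed.

(* Each ball of the cover contains at most one point of a grid of width [3 rho]. *)
Lemma disc_cover_card (R : realType) (A : set R[i]) (z : R[i]) (e rho : R) (l : seq R[i]) (m : nat) :
  (forall w, normc (w - z) < e -> A w) -> 0 < rho -> m%:R * (6 * rho) <= e ->
  (forall w, A w -> exists2 c, c \in l & normc (w - c) <= rho) -> (m ^ 2 <= size l)%N.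
Proof.
move=> zA rho0 me cov.
pose p (x : 'I_m * 'I_m) : R[i] := z + (Complex (3 * rho * x.1%:R) (3 * rho * x.2%:R)).
have pA x : A (p x).
  apply: zA; rewrite /p addrAC subrr add0r; set u := 3 * rho * x.1%:R; set v := 3 * rho * x.2%:R.
  have -> : Complex u v = u%:C + Complex 0 1 * v%:C.
    by apply/eqP; rewrite eq_complex /=; apply/andP; split; apply/eqP; ring.
  have : normc (u%:C + Complex 0 1 * v%:C) <= u + v.
    apply: (le_trans (normcD _ _)); rewrite normcM !normc_real /= expr0n expr1n add0r sqrtr1 mul1r.
    by rewrite !ger0_norm// mulr_ge0// mulr_ge0// ltW.
  move=> /le_lt_trans; apply; apply: lt_le_trans me.
  rewrite /u /v -mulrDr -natrD.
  have : (x.1 + x.2)%:R + 1 <= 2 * m%:R :> R.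
    have : ((x.1 + x.2).+1%:R <= (2 * m)%:R :> R).
      by rewrite ler_nat; have := ltn_ord x.1; have := ltn_ord x.2; lia.
    by rewrite -addn1 natrD natrM.
  have k0 : 0 < 3 * rho by rewrite mulr_gt0.
  have -> : m%:R * (6 * rho) = 3 * rho * (2 * m%:R) by ring.
  by move=> h; rewrite ltr_pM2l//; lra.
have pc x : exists c, c \in l /\ normc (p x - c) <= rho.
  by have [c cl pc] := cov _ (pA x); exists c.
have [c cP] := boolp.choice pc.
have cinj : injective c.
  move=> x y cxy; have [_ hx] := cP x; have [_ hy] := cP y.
  have hd : normc (p x - p y) <= 2 * rho.
    by have := normc_dist (p x) (c x) (p y); rewrite cxy in hx *; rewrite (normcB (c y)); lra.
  have key (i k : nat) : `|3 * rho * i%:R - 3 * rho * k%:R| <= 2 * rho -> i = k.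
    have k3 : 0 <= 3 * rho by rewrite mulr_ge0// ltW.
    rewrite -mulrBr normrM (ger0_norm k3) => h.
    have {}h : `|i%:R - k%:R| < 1 :> R.
      rewrite -(ltr_pM2l (_ : 0 < 3 * rho)) ?mulr_gt0//; apply: (le_lt_trans h); lra.
    apply/eqP; rewrite eqn_leq; apply/andP; split; rewrite -ltnS -(ltr_nat R) -addn1 natrD;
      by have := ler_norm (i%:R - k%:R : R); have := ler_norm (k%:R - i%:R : R); rewrite (distrC k%:R); lra.
  have pE : p x - p y = Complex (3 * rho * x.1%:R - 3 * rho * y.1%:R) (3 * rho * x.2%:R - 3 * rho * y.2%:R).
    by rewrite /p opprD addrACA subrr add0r.
  have := Re_le_normc (p x - p y); have := Im_le_normc (p x - p y); rewrite {1 3}pE /= => h2 h1.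
  have e1 : x.1 = y.1 by apply/val_inj/key/(le_trans h1).
  have e2 : x.2 = y.2 by apply/val_inj/key/(le_trans h2).
  by rewrite [x]surjective_pairing [y]surjective_pairing e1 e2.
have : uniq (map c (enum {: 'I_m * 'I_m})) by rewrite map_inj_uniq ?enum_uniq.
move=> /uniq_leq_size; rewrite size_map -cardE card_prod card_ord mulnn; apply.
by move=> _ /mapP[x _ ->]; have [] := cP x.
Qed.

Lemma affine_le_scaled (R : realDomainType) (x w m n : R) : 0 <= x -> 1 <= m -> 1 <= n ->
  x * n + w <= (x + `|w|) * m * n.
Proof.
move=> x0 m1 n1; have n0 := le_trans ler01 n1.
have mn : n <= m * n by rewrite ler_peMl.
rewrite -mulrA mulrDl; apply: lerD; first exact: ler_wpM2l.
by apply: le_trans (ler_norm w) _; rewrite ler_peMr// (le_trans n1).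
Qed.

Section Interior.
Variables (R : realType) (beta mu : R) (b : R[i]) (F : set R[i]).
Hypothesis pp : plastic_pair beta b.
Hypothesis tF : is_tile b F.
Hypothesis muP : mu_spec mu.

Let r := normc b.
Let r0 : 0 < r. Proof. exact: r_gt0 pp. Qed.
Let r1 : r < 1. Proof. exact: r_lt1 pp. Qed.
Let mu0 : 0 < mu. Proof. exact: lt_trans (mu_gt1 muP). Qed.

(* Covering a disc takes at least [c beta^n] sets of diameter [beta^(-n/2)],
   and [mu < beta]. *)
Lemma meet_no_interior g z (e : R) : isSome (lookup g) -> 0 < e ->
  exists2 w, normc (w - z) < e & ~ meet b F g w.
Proof.
move=> sg e0; apply: contrapT => H.
have zA w : normc (w - z) < e -> meet b F g w.
  by move=> wz; apply: contrapT => h; apply: H; exists w.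
pose C := (101 * mu ^+ 5 * weightv mu g + `|zr R (corr g)|) * mu ^+ 5.
have kV : 0 <= 101 * mu ^+ 5 * weightv mu g.
  by rewrite !mulr_ge0 ?exprn_ge0 ?(weightv_ge0 muP)// ltW.
have C0 : 0 <= C by rewrite mulr_ge0 ?addr_ge0// exprn_ge0// ltW.
(* 9 = 6 * 3/2: with covering discs of radius 3/2 |b|^k, the grid of [disc_cover_card] has e / (9
   |b|^k) points per side, rounded down. *)
pose A := e / 9; have A0 : 0 < A by rewrite divr_gt0.
have q1 : 0 <= mu * r ^+ 2 < 1.
  rewrite mulr_ge0 ?exprn_ge0 ?ltW//= -(beta_r2 pp) ltr_pM2r ?exprn_gt0//.
  exact: mu_lt_beta pp muP.
have [K HK] := @pow_small _ r (A / 2) (introT andP (conj (ltW r0) r1)) (divr_gt0 A0 (ltr0n _ 2)).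
have [|N HN] := @pow_small _ (mu * r ^+ 2) ((A / 2) ^+ 2 / (C + 1)) q1.
  by rewrite divr_gt0 ?exprn_gt0 ?divr_gt0// ltr_wpDl.
pose k := maxn K N.
have hK := HK k (leq_maxl _ _); have hN := HN k (leq_maxr _ _).
have rk0 : 0 < r ^+ k by rewrite exprn_gt0.
have [l szl cov] := @meet_cover _ _ _ _ _ pp tF muP _ g (k + 5) sg (leqnn _).
(* [lra] would try to evaluate the table. *)
clear sg.
pose x := e / (9 * r ^+ k); have x0 : 0 <= x by rewrite ltW// divr_gt0// mulr_gt0.
have /andP[] := truncn_itv x0; move: (Num.truncn x) => m m1 m2.
have xr : x * r ^+ k = A by rewrite /x /A; field; rewrite gt_eqF.
rewrite addnK in cov.
have msz : (m ^ 2 <= size l)%N.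
  apply: (disc_cover_card zA _ _ cov); first by rewrite mulr_gt0// divr_gt0.
  have -> : m%:R * (6 * (3 / 2 * r ^+ k)) = m%:R * r ^+ k * 9 by field.
  by rewrite -ler_pdivlMr// -/A -xr ler_wpM2r// ltW.
have szC : (size l)%:R <= C * mu ^+ k.
  apply: (le_trans szl); rewrite exprD mulfK ?gt_eqF ?exprn_gt0// /C.
  have muk : 1 <= mu ^+ k by rewrite exprn_ege1// ltW// (mu_gt1 muP).
  have mu5 : 1 <= mu ^+ 5 by rewrite exprn_ege1// ltW// (mu_gt1 muP).
  by apply: affine_le_scaled.
have : (m%:R * r ^+ k) ^+ 2 <= C * (mu * r ^+ 2) ^+ k.
  have -> : (m%:R * r ^+ k) ^+ 2 = (m ^ 2)%:R * r ^+ (2 * k) :> R.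
    by rewrite exprMn natrX -exprM mulnC.
  have -> : C * (mu * r ^+ 2) ^+ k = C * mu ^+ k * r ^+ (2 * k).
    by rewrite exprMn mulrA -exprM.
  apply: ler_wpM2r; first by rewrite exprn_ge0// ltW.
  by apply: le_trans szC; rewrite ler_nat.
have lo : A / 2 < m%:R * r ^+ k.
  have : x * r ^+ k < m.+1%:R * r ^+ k by rewrite ltr_pM2r.
  rewrite xr -addn1 natrD mulrDl mul1r; move: hK; lra.
have : (A / 2) ^+ 2 < (m%:R * r ^+ k) ^+ 2.
  have A20 : 0 <= A / 2 by rewrite divr_ge0// ltW.
  by rewrite ltr_sqr ?nnegrE// (le_trans A20)// ltW.
have : C * (mu * r ^+ 2) ^+ k <= (A / 2) ^+ 2.
  move: hN; rewrite ltr_pdivlMr ?ltr_wpDl// mulrDr mulr1 (mulrC _ C) => hN.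
  by have /andP[q0 _] := q1; move: (exprn_ge0 k q0) hN; lra.
lra.
Qed.

Lemma tile_address n y : F y -> exists u y', [/\ size u = n, F y' & y = fword b u y'].
Proof.
elim: n y => [|n IH] y Fy; first by exists [::], y.
have [s [y1 [Fy1 ->]]] := tile_split tF Fy.
have [u [y' [su Fy' ->]]] := IH _ Fy1.
by exists (s :: u), y'; rewrite /= su.
Qed.

(** If [F] contained a disc around z, it would contain a small subtile of [gF] near z. Subtiles have
    interior points, so the intersection would have some too, against [meet_no_interior]. *)
Lemma meet_boundary g z : isSome (lookup g) -> meet b F g z ->
  forall e : R, 0 < e -> exists2 w, ~ F w & normc (w - z) < e.
Proof.
move=> sg [Fz [y Fy zE]] e e0; apply: contrapT => H.
have zF w : normc (w - z) < e -> F w.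
  by move=> wz; apply: contrapT => Fw; apply: H; exists w.
have nint := fun q d => @meet_no_interior g q d sg; clear sg.
have [p [d [d0 pF]]] := tile_interior pp tF.
have Fp : F p by apply: pF; rewrite subrr normc0.
(* Two points of [F] are at distance at most 6, and 6/13 < 1/2. *)
have [|N HN] := @pow_small _ r (e / 13) (introT andP (conj (ltW r0) r1)); first by rewrite divr_gt0.
have [u [y' [su Fy' yE]]] := tile_address N Fy.
pose q := act b g (fword b u p).
have qz : normc (q - z) < e / 2.
  rewrite /q zE yE act_dist fword_dist.
  have h1 : r ^+ weight u * normc (p - y') <= e / 13 * 6.
    apply: ler_pM; rewrite ?normc_ge0 ?exprn_ge0 ?(ltW r0)//.
      by rewrite ltW// HN// -su size_weight.
    have := normcD p (- y'); rewrite normcN.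
    have := normc_tile pp tF Fp; have := normc_tile pp tF Fy'; lra.
  have : r ^+ g.1.1 * (r ^+ weight u * normc (p - y')) <= r ^+ weight u * normc (p - y').
    rewrite ler_piMl ?mulr_ge0 ?normc_ge0 ?exprn_ge0 ?(ltW r0)//.
    by rewrite exprn_ile1// ltW.
  move=> /le_trans /(_ h1) h3; move: e0 h3; lra.
pose a := (-1) ^+ g.1.2 * b ^+ g.1.1 * ((-1) ^+ sgw u * b ^+ weight u).
have aff v : act b g (fword b u v) - q = a * (v - p).
  have act_diff x w : act b g x - act b g w = (-1) ^+ g.1.2 * b ^+ g.1.1 * (x - w).
    by case: (g) => [[j h] t]; rewrite /act /=; ring.
  by rewrite /q act_diff fword_diff mulrA.
have a0 : a != 0.
  by rewrite !mulf_neq0// ?signr_eq0 ?expf_neq0 ?(b_neq0 pp).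
have na0 : 0 < normc a by rewrite normc_gt0.
have [|w wq wn] := nint q (Num.min (e / 2) (normc a * d)).
  by rewrite lt_min divr_gt0//= mulr_gt0.
apply: wn; move: wq; rewrite lt_min => /andP[we wd].
pose v := p + (w - q) / a.
have wE : w = act b g (fword b u v).
  by apply: (addIr (- q)); rewrite aff /v addrAC subrr add0r mulrC divfK.
split.
  by apply: zF; have := normc_dist w q z; move: qz we; lra.
exists (fword b u v) => //; apply: tile_fword => //; apply: pF.
rewrite /v addrAC subrr add0r normcM normcV ltr_pdivrMr//; by rewrite mulrC.
Qed.

End Interior.

(** * The mass distribution on the boundary *)

Lemma compact_disjoint_dist (R : realType) (K L : set R[i]) :
  ball_cover_compact K -> ball_cover_compact L -> (forall z, K z -> ~ L z) ->
  exists2 e : R, 0 < e & forall z w, K z -> L w -> e <= normc (w - z).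
Proof.
move=> cK cL KL.
have sep z : exists e : R, K z -> 0 < e /\ forall w, L w -> e <= normc (w - z).
  have [Kz|nKz] := pselect (K z); last by exists 1.
  by have [e e0 He] := ball_cover_closed cL (KL _ Kz); exists e.
have [e eP] := boolp.choice sep.
have [s sK Ks] := cK (fun z => e z / 2) (fun z Kz => divr_gt0 (eP z Kz).1 (ltr0n _ 2)).
have [d d0 ds] : exists2 d : R, 0 < d & forall p, p \in s -> d <= e p / 2.
  elim: s sK {Ks} => [_|p s IH sK]; first by exists 1.
  have [|d d0 ds] := IH; first by move=> q qs; apply: sK; rewrite inE qs orbT.
  have [ep _] := eP p (sK p (mem_head _ _)).
  exists (Num.min d (e p / 2)); first by rewrite lt_min d0 divr_gt0.
  move=> q; rewrite inE => /orP[/eqP ->|/ds qs]; first by rewrite ge_min lexx orbT.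
  by rewrite ge_min qs.
exists d => // z w Kz Lw; have [p ps zp] := Ks _ Kz.
have [_ /(_ _ Lw) h] := eP p (sK _ ps); have := ds _ ps.
have := normc_dist w z p; lra.
Qed.

(** * Boundedly many tiles of one size near a point *)

Section Freeness.
Variables (R : realType) (beta : R) (b : R[i]).
Hypothesis pp : plastic_pair beta b.

Let beta3 : beta ^+ 3 = beta + 1. Proof. by case: pp. Qed.
Let b0 : 0 < beta. Proof. exact: beta_gt0 pp. Qed.
Let b1 : 1 < beta. Proof. by have /andP[? _] := beta_coarse pp; lra. Qed.

(** At [beta] the branches are expanding, and their inverses map the unit interval into itself. *)
Lemma branch_unit s z : 0 <= branch beta s z <= 1 -> 0 <= z <= 1.
Proof.
rewrite /branch; case: s => /andP[h1 h2].
  rewrite pmulr_rge0// subr_ge0 in h1; rewrite h1 andbT leNgt; apply/negP => z0.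
  have h : beta * 1 < beta * (1 - z) by rewrite ltr_pM2l//; lra.
  by move: b1; lra.
rewrite pmulr_rge0 ?exprn_gt0// in h1; rewrite h1 /=; apply: le_trans h2.
by rewrite ler_peMl// exprn_ege1// ltW.
Qed.

Lemma fword_unit u z : 0 <= fword beta u z <= 1 -> 0 <= z <= 1.
Proof. by elim: u z => //= s u IH z /branch_unit/IH. Qed.

Lemma branch_surj s y : 0 <= y <= 1 -> exists2 z, branch beta s z = y & 0 <= z <= 1.
Proof.
move=> /andP[y0 y1]; rewrite /branch; case: s.
  exists (1 - y / beta); first by field; rewrite gt_eqF.
  rewrite subr_ge0 gerBl divr_ge0// ?(ltW b0)// andbT ler_pdivrMr// mul1r.
  exact: le_trans y1 (ltW b1).
exists (y / beta ^+ 5); first by rewrite mulrC divfK// expf_neq0// gt_eqF.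
rewrite divr_ge0// ?exprn_ge0// ?(ltW b0)//= ler_pdivrMr ?exprn_gt0// mul1r.
by apply: le_trans y1 _; rewrite exprn_ege1// ltW.
Qed.

Lemma fword_surj u y : 0 <= y <= 1 -> exists2 z, fword beta u z = y & 0 <= z <= 1.
Proof.
elim: u y => [|s u IH] y y01; first by exists y.
have [y1 y1E y1u] := branch_surj s y01; have [z zE zu] := IH _ y1u.
by exists z => //=; rewrite zE.
Qed.

(* The intervals [[0, beta^-5]] and [[beta^-5, 1]] on which the two branches take values in
   [[0, 1]] have only one point in common. *)
Lemma word_free u v : weight u = weight v ->
  (forall z, fword beta u z = fword beta v z) -> u = v.
Proof.
(* If words with different last letters gave one map, every point sent into [0, 1] would be beta^-5;
   but 0 and 1 have different preimages. *)
have disj u' v' : ~ (forall z, fword beta (rcons u' false) z = fword beta (rcons v' true) z).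
  move=> H.
  have key z : 0 <= fword beta (rcons u' false) z <= 1 -> z * beta ^+ 5 = 1.
    move=> h; have h' := h; rewrite H in h'; move: h h'.
    rewrite !fword_rcons => /fword_unit /= /andP[_ h1] /fword_unit /= /andP[_ h2].
    have h3 : beta * (1 - z) * beta ^+ 4 <= beta ^+ 4 by rewrite ger_pMl ?exprn_gt0.
    apply/eqP; rewrite eq_le mulrC h1 /=.
    move: h3; have -> : beta * (1 - z) * beta ^+ 4 = beta ^+ 5 - beta ^+ 5 * z by ring.
    by rewrite {1}(beta5 pp); lra.
  have [z0 z0E _] := fword_surj (rcons u' false) (introT andP (conj (lexx 0) ler01)).
  have [z1 z1E _] := fword_surj (rcons u' false) (introT andP (conj ler01 (lexx 1))).
  have e0 := key z0; have e1 := key z1; rewrite z0E lexx ler01 in e0; rewrite z1E lexx ler01 in e1.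
  have b50 : beta ^+ 5 != 0 by rewrite expf_neq0// gt_eqF.
  have zz : z0 = z1 by apply: (mulIf b50); rewrite e0// e1.
  by move: z0E; rewrite zz z1E => /eqP; rewrite oner_eq0.
have wpos w s : (0 < weight (rcons w s))%N by rewrite weight_rcons addn_gt0; case: s; rewrite orbT.
elim/last_ind: u v => [|u s IH] v; case/lastP: v => [|v s'] //.
- by move=> h; have := wpos v s'; rewrite -h.
- by move=> h; have := wpos u s; rewrite h.
move=> wuv H; have ss : s = s'.
  by case: s s' H {wuv} => -[] // H; [case: (disj v u) => z; rewrite H|case: (disj u v)].
rewrite -{s'}ss in wuv H *; congr rcons; apply: IH.
  by move: wuv; rewrite !weight_rcons => /addIn.
move=> z; have [x <-] : exists x, branch beta s x = z.
  rewrite /branch; case: (s); first by exists (1 - z / beta); field; rewrite gt_eqF.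
  by exists (z / beta ^+ 5); rewrite mulrC divfK// expf_neq0// gt_eqF.
by rewrite -!fword_rcons.
Qed.

(** Some z in [0, 1] is mapped to 0, so the offset is beta^(weight u) z up to sign. *)
Lemma offset_le u : `|zev beta (offset u)| <= beta ^+ weight u.
Proof.
have [z zE /andP[z0 z1]] := fword_surj u (introT andP (conj (lexx 0) ler01)).
move: zE; rewrite fwordE// => /eqP; rewrite addrC addr_eq0 => /eqP ->.
rewrite normrN !normrM normr_sign mul1r (ger0_norm z0) ger0_norm ?exprn_ge0 ?(ltW b0)//.
by rewrite ler_piMr// exprn_ge0// ltW.
Qed.

Variable F : set R[i].
Hypothesis tF : is_tile b F.
Let b3 := b3 pp.
Let r := normc b.
Let r0 : 0 < r. Proof. exact: r_gt0 pp. Qed.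
Let r1 : r < 1. Proof. exact: r_lt1 pp. Qed.

(** Differences of offsets from one fixed word, divided by x^(weight u0), have bounded real value by
    [offset_le] and bounded conjugate because the tiles are near x, so finitely many occur. With the
    weight and the sign they determine the word, by [word_free]. The 9 is 4 for the overshoot of the
    level plus 5 for the exponent of the smaller tile. *)
Lemma tiles_near_bounded : exists M : nat, forall (n : nat) (x : R[i]) (us : seq (seq bool)),
  uniq us -> (forall u, u \in us -> (n <= weight u <= n + 9)%N /\
     exists2 y, F y & normc (fword b u y - x) * r <= r ^+ n) -> (size us <= M)%N.
Proof.
have r9 : 0 < r ^+ 9 by rewrite exprn_gt0.
have [l Hl] := zbox_fin pp (2 * beta ^+ 9) (2 * (3 + r^-1) / r ^+ 9).
exists (size [seq (je, t) | je <- [seq (j, e) | j <- iota 0 10, e <- [:: false; true]], t <- l]).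
move=> n x us uus near_.
have [->//|] := eqVneq us [::]; case: us uus near_ => // u0 us' + + _.
set us := u0 :: us' => uus near_; have u0us : u0 \in us by rewrite mem_head.
pose tau u := iter (weight u0) zdivx (zsub (offset u) (offset u0)).
have tauE (K : comNzRingType) (y : K) u : y ^+ 3 = y + 1 ->
    y ^+ weight u0 * zev y (tau u) = zev y (offset u) - zev y (offset u0).
  by move=> y3; rewrite zev_divxn// zevB.
pose code u : nat * bool * zbeta := ((weight u - n)%N, sgw u, tau u).
have codeI : {in us &, injective code}.
  move=> u v uus' vus' [ew es et]; have [/andP[wu _] _] := near_ _ uus'.
  have [/andP[wv _] _] := near_ _ vus'.
  have wuv : weight u = weight v by rewrite -(subnK wu) -(subnK wv) ew.
  apply: word_free => // z; rewrite !fwordE// es wuv; congr (_ + _).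
  by have := tauE _ beta u beta3; rewrite et tauE// => /addIr.
rewrite -(size_map code); apply: uniq_leq_size.
  by rewrite map_inj_in_uniq.
move=> _ /mapP[u uus' ->]; have [/andP[wu1 wu2] [y Fy hy]] := near_ _ uus'.
have [/andP[w01 w02] [y0 Fy0 hy0]] := near_ _ u0us.
apply: allpairs_f; first apply: allpairs_f.
- by rewrite mem_iota /= add0n ltnS leq_subLR.
- by case: (sgw u).
apply: Hl.
  have := tauE _ beta u beta3 => h.
  have h1 : beta ^+ weight u0 * `|zev beta (tau u)| <= beta ^+ weight u + beta ^+ weight u0.
    rewrite -[X in X * _]ger0_norm ?exprn_ge0 ?(ltW b0)// -normrM h.
    by apply: (le_trans (ler_normB _ _)); apply: lerD; exact: offset_le.
  have h2 : beta ^+ weight u + beta ^+ weight u0 <= 2 * beta ^+ 9 * beta ^+ n.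
    have hb v : (v <= n + 9)%N -> beta ^+ v <= beta ^+ 9 * beta ^+ n.
      by move=> hv; rewrite -exprD addnC; apply: ler_weXn2l => //; exact: ltW.
    by have := hb _ wu2; have := hb _ w02; lra.
  have h3 : beta ^+ n * `|zev beta (tau u)| <= beta ^+ weight u0 * `|zev beta (tau u)|.
    by rewrite ler_wpM2r// ler_weXn2l// ltW.
  rewrite -(ler_pM2l (exprn_gt0 n b0)) (mulrC _ (2 * _)).
  exact: le_trans h3 (le_trans h1 h2).
have hoff v z : F z -> (n <= weight v)%N -> normc (fword b v z - x) * r <= r ^+ n ->
    normc (zev b (offset v) - x) <= (3 + r^-1) * r ^+ n.
  move=> Fz nv; rewrite -ler_pdivlMr// => hz.
  have -> : zev b (offset v) - x = (fword b v z - x) - (-1) ^+ sgw v * b ^+ weight v * z.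
    by rewrite fwordE//; ring.
  apply: (le_trans (normcD _ _)); rewrite normcN !normcM -signr_odd !normcX normcN normc1 expr1n mul1r -/r.
  have h1 : r ^+ weight v * normc z <= 3 * r ^+ n.
    rewrite mulrC; apply: ler_pM; rewrite ?normc_ge0 ?exprn_ge0 ?(ltW r0)//.
      by have := normc_tile pp tF Fz; lra.
    by apply: ler_wiXn2l; rewrite ?ltW.
  by rewrite mulrDl addrC lerD// mulrC.
have h := tauE _ b u b3.
have h1 : r ^+ weight u0 * normc (zev b (tau u)) <= 2 * (3 + r^-1) * r ^+ n.
  rewrite /r -normcX -normcM h; have := normc_dist (zev b (offset u)) x (zev b (offset u0)).
  have := hoff _ _ Fy wu1 hy; have := hoff _ _ Fy0 w01 hy0; rewrite (normcB x) -/r.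
  by set q := (3 + r^-1) * r ^+ n; rewrite -[2 * _ * _]mulrA -/q; lra.
have h2 : r ^+ (n + 9) * normc (zev b (tau u)) <= r ^+ weight u0 * normc (zev b (tau u)).
  by rewrite ler_wpM2r ?normc_ge0//; apply: ler_wiXn2l; rewrite ?ltW.
rewrite ler_pdivlMr// -(ler_pM2r (exprn_gt0 n r0)).
apply: le_trans h1; apply: le_trans h2; rewrite exprD.
by rewrite le_eqVlt; apply/orP; left; apply/eqP; ring.
Qed.

End Freeness.

(* A word for the tile [F], a word for the tile [g0 F], whether the larger of
   the two corresponding subtiles is a subtile of [g0 F], and the map that
   takes the larger subtile to the smaller one. *)
Definition node : Type := (seq bool * seq bool * bool * nbmap)%type.

Definition node_step (nd : node) (s : bool) : node :=
  let: (u, v, sd, g) := nd in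
  let: (sw, h) := child s g in
  if sd then (u, rcons v s, sd (+) sw, h) else (rcons u s, v, sd (+) sw, h).

Definition node_run (nd : node) (p : seq bool) : node := foldl node_step nd p.

Definition large_word (nd : node) : seq bool :=
  let: (u, v, sd, _) := nd in if sd then v else u.
Definition small_word (nd : node) : seq bool :=
  let: (u, v, sd, _) := nd in if sd then u else v.

Lemma node_run_rcons nd p s : node_run nd (rcons p s) = node_step (node_run nd p) s.
Proof. by rewrite /node_run -cats1 foldl_cat. Qed.

Lemma node_step_word nd s : exists x y,
  (node_step nd s).1.1.1 = nd.1.1.1 ++ x /\ (node_step nd s).1.1.2 = nd.1.1.2 ++ y.
Proof.
case: nd => [[[u v] sd] g]; rewrite /node_step; case: (child s g) => sw h.
case: sd; first by exists [::], [:: s]; rewrite cats0 cats1.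
by exists [:: s], [::]; rewrite cats0 cats1.
Qed.

Lemma node_run_word nd p : exists x y,
  (node_run nd p).1.1.1 = nd.1.1.1 ++ x /\ (node_run nd p).1.1.2 = nd.1.1.2 ++ y.
Proof.
elim: p nd => [|s p IH] nd; first by exists [::], [::]; rewrite !cats0.
have [x [y [-> ->]]] := IH (node_step nd s); have [x' [y' [-> ->]]] := node_step_word nd s.
by exists (x' ++ x), (y' ++ y); rewrite !catA.
Qed.

Lemma node_run_size nd p :
  (size (node_run nd p).1.1.1 + size (node_run nd p).1.1.2
    = size nd.1.1.1 + size nd.1.1.2 + size p)%N.
Proof.
elim: p nd => [|s p IH] nd; first by rewrite addn0.
rewrite [node_run _ _]/= IH /=; case: nd => [[[u v] sd] g]; rewrite /node_step.
by case: (child s g) => sw h; case: sd; rewrite /= size_rcons; lia.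
Qed.

(** Where the paths first differ, different letters are appended to the same word, and later letters
    only extend it. *)
Lemma node_run_inj_size nd p p' : size p = size p' ->
  (node_run nd p).1.1 .1 = (node_run nd p').1.1.1 ->
  (node_run nd p).1.1.2 = (node_run nd p').1.1.2 -> p = p'.
Proof.
elim: p nd p' => [|s p IH] nd [|s' p'] //= [sp].
have [<- h1 h2|ss] := eqVneq s s'; first by rewrite (IH _ _ sp h1 h2).
have [x [y [-> ->]]] := node_run_word (node_step nd s) p.
have [x' [y' [-> ->]]] := node_run_word (node_step nd s') p'.
have diff (w a a' : seq bool) : rcons w s ++ a = rcons w s' ++ a' -> s :: p = s' :: p'.
  rewrite !cat_rcons => /eqP; rewrite eqseq_cat// eqxx /= => /eqP[e _].
  by rewrite e eqxx in ss.
case: nd => [[[u v] sd] g]; rewrite /node_step.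
case: (child s g) => sw h; case: (child s' g) => sw' h'.
by case: sd => /= h1 h2; [exact: diff h2|exact: diff h1].
Qed.

Lemma node_run_inj nd p p' :
  (node_run nd p).1.1.1 = (node_run nd p').1.1.1 ->
  (node_run nd p).1.1.2 = (node_run nd p').1.1.2 -> p = p'.
Proof.
move=> h1 h2; apply: (node_run_inj_size (nd := nd)) => //.
by have := node_run_size nd p; rewrite h1 h2 node_run_size => /addnI.
Qed.

Definition level (nd : node) : nat := weight (large_word nd).

Definition balanced (nd : node) : Prop :=
  weight (small_word nd) = (level nd + nd.2.1.1)%N.

Lemma level_step nd s : balanced nd ->
  balanced (node_step nd s) /\ level (node_step nd s) = (level nd + lvl s nd.2)%N.
Proof.
case: nd => [[[u v] sd] g]; rewrite /balanced /level /node_step.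
have := lvl_child s g; case: (child s g) => sw h.
by case: sw; case: sd => /= -[hl hw] hb; rewrite ?weight_rcons; lia.
Qed.

Fixpoint paths_upto (n : nat) : seq (seq bool) :=
  if n is m.+1 then
    [::] :: [seq false :: p | p <- paths_upto m] ++ [seq true :: p | p <- paths_upto m]
  else [:: [::]].

Lemma mem_paths_upto n p : (size p <= n)%N -> p \in paths_upto n.
Proof.
elim: n p => [|n IH] [|s p] //= sp; rewrite inE mem_cat /=; apply/orP.
by case: s; [right|left]; apply: map_f; exact: IH.
Qed.

(* If the cylinders of [A] have total mass less than the mass of the whole
   tree, one can walk down the tree avoiding [A]. *)
Lemma avoiding_path (R : realDomainType) (mass : seq bool -> R) (A : seq (seq bool)) :
  (forall p, 0 <= mass p) ->
  (forall p, mass p <= mass (rcons p false) + mass (rcons p true)) ->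
  \sum_(c <- A) mass c < mass [::] ->
  forall N, exists2 p, size p = N & forall k, (k <= N)%N -> take k p \notin A /\ 0 < mass (take k p).
Proof.
move=> m0 msub sumA.
(* The walk keeps the part of [A] below q lighter than q itself; one of the two children inherits
   this. *)
pose S q := \sum_(c <- A | prefix q c) mass c.
have S0 q : 0 <= S q by apply: sumr_ge0.
have Sin q : q \in A -> mass q <= S q.
  move=> qA; rewrite /S (big_rem q)//= prefix_refl lerDl.
  by apply: sumr_ge0.
have Ssub q : S (rcons q false) + S (rcons q true) <= S q.
  rewrite /S [X in X + _]big_mkcond [X in _ + X]big_mkcond [leRHS]big_mkcond -big_split/=.
  apply: ler_sum => c _.
  have pre s : prefix (rcons q s) c -> prefix q c.
    by move=> /(prefix_trans _); apply; exact: prefix_rcons.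
  have excl : prefix (rcons q false) c -> prefix (rcons q true) c -> False.
    move=> /prefixP[x ->]; rewrite prefixE size_rcons -(size_rcons q false) take_size_cat//.
    by move=> /eqP/rcons_inj[].
  case: ifP => h1; case: ifP => h2; rewrite ?addr0 ?add0r.
  - by case: (excl h1 h2).
  - by rewrite (pre _ h1).
  - by rewrite (pre _ h2).
  - by case: ifP.
move=> N; suff [p sp hp] : exists2 p, size p = N &
    forall k, (k <= N)%N -> S (take k p) < mass (take k p).
  exists p => // k /hp hk; split; last exact: le_lt_trans (S0 _) hk.
  by apply/negP => /Sin; rewrite leNgt hk.
elim: N => [|N [p sp hp]].
  exists [::] => // k; rewrite leqn0 => /eqP ->; rewrite take0.
  apply: le_lt_trans sumA; rewrite /S.
  by rewrite le_eqVlt; apply/orP; left; apply/eqP; apply: eq_bigl => c; rewrite prefix0s.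
have [s hs] : exists s, S (rcons p s) < mass (rcons p s).
  apply: contrapT => H; have H' s : mass (rcons p s) <= S (rcons p s).
    by rewrite leNgt; apply/negP => h; apply: H; exists s.
  have := hp N (leqnn _); rewrite -sp take_size => /(le_lt_trans (Ssub p)).
  rewrite ltNge => /negP; apply.
  by apply: (le_trans (msub p)); apply: lerD.
exists (rcons p s) => [|k]; first by rewrite size_rcons sp.
rewrite leq_eqVlt => /orP[/eqP ->|kN]; first by rewrite -sp -(size_rcons p s) take_size.
by rewrite -cats1 takel_cat ?sp//; exact: hp.
Qed.

Definition root_node : node := ([::], [::], false, g_start).


Lemma eigen_mass (R : fieldType) (m v v1 v2 : R) (n d1 d2 : nat) : m != 0 ->
  (d1 <= 5)%N -> (d2 <= 5)%N -> m ^+ 5 * v = m ^+ (5 - d1) * v1 + m ^+ (5 - d2) * v2 ->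
  v / m ^+ n = v1 / m ^+ (n + d1) + v2 / m ^+ (n + d2).
Proof.
move=> m0 h1 h2 E; have mk k : m ^+ k != 0 by rewrite expf_neq0.
have term d x : (d <= 5)%N -> x / m ^+ (n + d) = m ^+ (5 - d) * x / (m ^+ 5 * m ^+ n).
  move=> h; have -> : m ^+ 5 = m ^+ (5 - d) * m ^+ d by rewrite -exprD subnK.
  rewrite exprD; move: (mk d) (mk n) (mk (5 - d)%N).
  by move: (m ^+ d) (m ^+ n) (m ^+ (5 - d)) => a b c a0 b0 c0; field; rewrite a0 b0 c0.
rewrite !term// -mulrDl -E; move: (mk 5) (mk n); move: (m ^+ 5) (m ^+ n) => a b a0 b0.
by field; rewrite a0 b0.
Qed.

Section Mass.
Variables (R : realType) (beta mu : R) (b : R[i]) (F : set R[i]).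
Hypothesis pp : plastic_pair beta b.
Hypothesis tF : is_tile b F.
Hypothesis muP : mu_spec mu.

Let b3 := b3 pp.
Let r := normc b.
Let r0 : 0 < r. Proof. exact: r_gt0 pp. Qed.
Let r1 : r < 1. Proof. exact: r_lt1 pp. Qed.
Let mu1 : 1 < mu. Proof. exact: mu_gt1 muP. Qed.
Let mu0 : 0 < mu. Proof. exact: lt_trans mu1. Qed.

Let V := weightv mu.

Lemma weightv_lookup g : 0 < V g -> isSome (lookup g).
Proof.
by move=> h; apply: contraT => /(lookupN mu)[e _]; move: h; rewrite /V e ltxx.
Qed.

Lemma weightv_child g : 0 < V g -> exists s, 0 < V (child s g).2.
Proof.
move=> Vg; have E := weightv_eq muP (weightv_lookup Vg).
apply: contrapT => H; have H' s : V (child s g).2 = 0.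
  apply/eqP; rewrite eq_le (weightv_ge0 muP) andbT leNgt; apply/negP => h.
  by apply: H; exists s.
move: E; rewrite -/(V g) -/(V (child false g).2) -/(V (child true g).2) !H' !mulr0 addr0.
by move/eqP; rewrite mulf_eq0 expf_eq0 /= !gt_eqF.
Qed.

(** A positive entry has a child with positive entry. Following such children yields points of [F]
    and of [gF] at distance O(|b|^n) for every n, while disjoint compact sets would be a positive
    distance apart. *)
Lemma meet_nonempty g : 0 < V g -> exists z, meet b F g z.
Proof.
move=> Vg; have [F0 cF _] := tF; have [p0 Fp0] := F0.
pose D : R := 6 + \sum_(x <- survivors) normc (zev b x.1.1.2).
have DP h : isSome (lookup h) -> normc (zev b h.2) + 6 <= D.
  move=> /lookupE/lookup_mem hm; rewrite addrC /D lerD2l.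
  rewrite (big_rem _ hm) lerDl; apply: sumr_ge0 => x _; exact: normc_ge0.
have D0 : 0 < D by rewrite ltr_pwDl// sumr_ge0// => x _; exact: normc_ge0.
have approx m : forall h n, 0 < V h -> (2 * n + 5 - h.1.1 <= m)%N ->
    exists p q, [/\ F p, F q & normc (p - act b h q) <= D * r ^+ (n - 5)].
  have small h k : 0 < V h -> (k <= 5)%N ->
      exists p q, [/\ F p, F q & normc (p - act b h q) <= D * r ^+ (k - 5)].
    move=> Vh k5; exists p0, p0; split=> //; rewrite (eqP k5) expr0 mulr1.
    apply: le_trans (DP _ (weightv_lookup Vh)).
    move: {Vh} h => [[j e] t]; rewrite /act /=.
    have -> : p0 - ((-1) ^+ e * b ^+ j * p0 + zev b t) = p0 + - ((-1) ^+ e * b ^+ j * p0) + - zev b t.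
      by ring.
    apply: (le_trans (normcD _ _)); rewrite normcN addrC lerD2l.
    apply: (le_trans (normcD _ _)); rewrite normcN !normcM -signr_odd !normcX normcN normc1 expr1n mul1r.
    have h1 : normc b ^+ j * normc p0 <= normc p0.
      by rewrite ler_piMl ?normc_ge0// exprn_ile1// ltW.
    have := normc_tile pp tF Fp0; lra.
  elim: m => [|m IH] h n Vh mn.
    by apply: small => //; have := survivor_le5 (weightv_lookup Vh); move: mn; clear; lia.
  have [n5|n5] := leqP n 5; first exact: small.
  have [s Vs] := weightv_child Vh.
  have [|p [q [Fp Fq pq]]] := IH _ (n - lvl s h)%N Vs.
    exact: child_measure (survivor_le5 (weightv_lookup Vh)) n5 mn.
  have hr : r ^+ lvl s h * (D * r ^+ (n - lvl s h - 5)) <= D * r ^+ (n - 5).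
    rewrite mulrCA ler_wpM2l ?(ltW D0)// -exprD ler_wiXn2l ?(ltW r1) ?(ltW r0)//.
    exact: subn5_le.
  have := @pair_lift_dist _ b s h p (act b (child s h).2 q).
  have := ler_wpM2l (exprn_ge0 (lvl s h) (ltW r0)) pq; rewrite -/r => h1 h2.
  have := childP b3 s h; move: h2; rewrite /pair_lift; case: ifP => _ h2 H.
    exists (branch b s q), p; split=> //; first exact: tile_branch.
    by rewrite -H normcB h2; exact: le_trans hr.
  exists (branch b s p), q; split=> //; first exact: tile_branch.
  by rewrite -H h2; exact: le_trans hr.
apply: contrapT => H.
have [|e e0 He] := compact_disjoint_dist cF (act_image_compact pp tF (g := g)).
  by move=> z Fz [y Fy yz]; apply: H; exists z; split=> //; exists y.
have [|N HN] := @pow_small _ r (e / D) (introT andP (conj (ltW r0) r1)); first exact: divr_gt0.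
have [p [q [Fp Fq pq]]] := approx _ g (N + 5)%N Vg (leqnn _).
have := He p (act b g q) Fp (ex_intro2 _ _ q Fq erefl); rewrite normcB leNgt => /negP; apply.
apply: (le_lt_trans pq); rewrite addnK mulrC -ltr_pdivlMr//; exact: HN.
Qed.

Let side (sd : bool) (z : R[i]) : R[i] := if sd then act b g_start z else z.

Let large (nd : node) z := side nd.1.2 (fword b (large_word nd) z).
Let small (nd : node) z := side (~~ nd.1.2) (fword b (small_word nd) z).

Lemma node_coherent p z : let nd := node_run root_node p in
  small nd z = large nd (act b nd.2 z).
Proof.
elim/last_ind: p z => [|p s IH] z /=; first by rewrite /small /large /=.
rewrite node_run_rcons; move: IH; move: (node_run root_node p) => [[[u v] sd] g] IH.
rewrite /node_step; have := childP b3 s g; case: (child s g) => sw h /=.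
move: IH; rewrite /small /large /=.
case: sw; case: sd => /= IH H; rewrite ?fword_rcons -?H -?IH ?H ?IH //.
Qed.

Lemma node_point p w : let nd := node_run root_node p in meet b F nd.2 w ->
  [/\ meet b F g_start (large nd w), exists2 y, F y & fword b nd.1.1.1 y = large nd w &
      exists2 y, F y & act b g_start (fword b nd.1.1.2 y) = large nd w].
Proof.
move=> nd [Fw [y Fy wE]]; have : small nd y = large nd w by rewrite wE; exact: node_coherent.
have hu z : F z -> F (fword b nd.1.1.1 z) by exact: tile_fword.
have hv z : F z -> F (fword b nd.1.1.2 z) by exact: tile_fword.
move: hu hv; case: nd wE => [[[u v] sd] g] /= _ hu hv.
rewrite /large /small /side /=; case: sd => /= H.
  split; [split; [by rewrite -H; exact: hu|by exists (fword b v w) => //; exact: hv]|by exists y|by exists w].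
by split; [split; [exact: hu|exists (fword b v y); [exact: hv|exact: esym H]]|by exists w|by exists y].
Qed.

Lemma node_balanced p : balanced (node_run root_node p).
Proof.
elim/last_ind: p => [//|p s IH]; rewrite node_run_rcons.
by have [] := level_step s IH.
Qed.

Let lev p := level (node_run root_node p).
Let st p := (node_run root_node p).2.

Lemma lev_rcons p s : lev (rcons p s) = (lev p + lvl s (st p))%N.
Proof. by rewrite /lev node_run_rcons; have [] := level_step s (node_balanced p). Qed.

Lemma st_rcons p s : st (rcons p s) = (child s (st p)).2.
Proof.
rewrite /st node_run_rcons; case: (node_run root_node p) => [[[u v] sd] g].
by rewrite /node_step /=; case: (child s g) => sw h; case: sd.
Qed.

Let mass p := V (st p) / mu ^+ lev p.

Lemma mass_ge0 p : 0 <= mass p.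
Proof. by rewrite /mass divr_ge0 ?exprn_ge0 ?(ltW mu0)// (weightv_ge0 muP). Qed.

(** On the table this is the eigenvector equation, with equality; off the table the left side is
    0. *)
Lemma mass_le_children p : mass p <= mass (rcons p false) + mass (rcons p true).
Proof.
have [sg|/(lookupN mu)[e _]] := boolP (isSome (lookup (st p))); last first.
  by rewrite {1}/mass /V e mul0r addr_ge0// mass_ge0.
have E := weightv_eq muP sg; move: E {sg}.
rewrite /mass !st_rcons !lev_rcons.
rewrite -!/(V _); move: (V (st p)) (V (child false (st p)).2) (V (child true (st p)).2).
move: (lvl_le5 false (st p)) (lvl_le5 true (st p)).
move: (lvl false (st p)) (lvl true (st p)) (lev p) => d1 d2 n h1 h2 v v1 v2 E.
rewrite le_eqVlt; apply/orP; left; apply/eqP.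
by apply: eigen_mass => //; rewrite gt_eqF.
Qed.

Lemma weightv_pos_start : 0 < V g_start.
Proof.
have h := g_start_corr; have [[_]|] := weightv_cases muP g_start_lookup.
  by rewrite -(zr1 R) zr_le; move: h; lia.
exact: lt_trans.
Qed.

(** Each letter of the path lengthens one of the two words, whose weights are [lev p] and [lev p] +
    j with j <= 5. *)
Lemma lev_size p : isSome (lookup (st p)) -> (size p <= 2 * lev p + 5)%N.
Proof.
move=> /survivor_le5 h5; have := node_run_size root_node p; have := node_balanced p.
rewrite /balanced -/(lev p) -/(st p) /lev /level.
have := size_weight (large_word (node_run root_node p)).
have := size_weight (small_word (node_run root_node p)).
move: h5; rewrite /st; case: (node_run root_node p) => [[[u v] sd] g] /=.
by case: sd; lia.
Qed.

(* The mass distribution principle: the natural measure on the paths of the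
   boundary graph gives mass O(mu^-n) to any disc of radius about r^n. *)
Lemma cover_mass : exists2 c : R, 0 < c & forall B : seq (R[i] * nat),
  (forall z, meet b F g_start z -> exists2 a, a \in B & normc (z - a.1) * r <= r ^+ a.2) ->
  c <= \sum_(a <- B) mu ^- a.2.
Proof.
have [M HM] := tiles_near_bounded pp tF.
pose Vm : R := 1 + \sum_(x <- survivors) V x.1.1.
have Vm0 : 0 < Vm by rewrite ltr_pwDl// sumr_ge0// => x _; exact: weightv_ge0.
have VmP g : V g <= Vm.
  have [sg|/(lookupN mu)[e _]] := boolP (isSome (lookup g)); last by rewrite /V e ltW.
  have /lookupE/lookup_mem gm := sg; rewrite /Vm (big_rem _ gm) /=; clear sg gm.
  rewrite addrCA lerDl; apply: addr_ge0; first exact: ler01.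
  by apply: sumr_ge0 => x _; exact: weightv_ge0.
pose Q : R := (M * M)%:R * Vm + 1.
have Q0 : 0 < Q by rewrite ltr_wpDl// mulr_ge0// ltW.
exists (V g_start / Q) => [|B cov]; first by rewrite divr_gt0// weightv_pos_start.
rewrite ler_pdivrMr// leNgt; apply/negP => Hlt.
(* The cylinders attached to a disc: both tiles of the pair come near it, and the level has just
   reached that of the disc. The slack 4 allows for a last step of up to 5. *)
pose ok (a : R[i] * nat) p := `[< [/\ (a.2 <= lev p <= a.2 + 4)%N, 0 < V (st p),
  exists2 y, F y & normc (fword b (node_run root_node p).1.1.1 y - a.1) * r <= r ^+ a.2 &
  exists2 y, F y & normc (act b g_start (fword b (node_run root_node p).1.1.2 y) - a.1) * r <= r ^+ a.2] >].
pose Aof a := [seq p <- undup (paths_upto (2 * (a.2 + 4) + 5)) | ok a p].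
have words_weight p a : isSome (lookup (st p)) -> (a <= lev p <= a + 4)%N ->
    (a <= weight (node_run root_node p).1.1.1 <= a + 9)%N /\
    (a <= weight (node_run root_node p).1.1.2 <= a + 9)%N.
  move=> /survivor_le5 h5; have := node_balanced p.
  rewrite /balanced -/(lev p) -/(st p) /lev /level.
  move: h5; rewrite /st; case: (node_run root_node p) => [[[u v] sd] g] /=.
  by case: sd; lia.
have szA a : (size (Aof a) <= M * M)%N.
  pose U := undup [seq (node_run root_node p).1.1.1 | p <- Aof a].
  pose W := undup [seq (node_run root_node p).1.1.2 | p <- Aof a].
  have okA p : p \in Aof a -> ok a p by rewrite mem_filter => /andP[].
  have szU : (size U <= M)%N.
    apply: (HM a.2 a.1); first exact: undup_uniq.
    move=> u; rewrite mem_undup => /mapP[p /okA/asboolP[hl /weightv_lookup sg hu _] ->].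
    by have [] := words_weight _ _ sg hl.
  have szW : (size W <= M)%N.
    (* [g_start] is an isometry; its inverse carries the tiles of the second word, and the centre,
       back to subtiles of [F]. *)
    apply: (HM a.2 (act b (unflip g_start) a.1)); first exact: undup_uniq.
    move=> v; rewrite mem_undup => /mapP[p /okA/asboolP[hl /weightv_lookup sg _ [y Fy hy]] ->].
    have [_ hv] := words_weight _ _ sg hl; split=> //; exists y => //.
    rewrite -[X in X * _]mul1r -[X in X * _ * _](expr0 (normc b)) -(act_dist b g_start).
    by rewrite act_unflip.
  apply: (@leq_trans (size [seq (u, v) | u <- U, v <- W])); last first.
    by rewrite size_allpairs leq_mul.
  pose word p := ((node_run root_node p).1.1.1, (node_run root_node p).1.1.2).
  rewrite -(size_map word); apply: uniq_leq_size.
    rewrite map_inj_uniq ?filter_uniq ?undup_uniq//.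
    by move=> p p' [h1 h2]; exact: node_run_inj h1 h2.
  move=> _ /mapP[p pA ->]; apply: allpairs_f; rewrite mem_undup; exact: map_f.
pose A := flatten [seq Aof a | a <- B].
have sumA : \sum_(c <- A) mass c < mass [::].
  have -> : mass [::] = V g_start by rewrite /mass /lev /level /= expr0 divr1.
  apply: le_lt_trans Hlt; rewrite /A big_flatten big_map mulr_suml.
  apply: ler_sum => a _.
  apply: (@le_trans _ _ (\sum_(c <- Aof a) Vm / mu ^+ a.2)).
    rewrite big_seq [leRHS]big_seq; apply: ler_sum => p.
    rewrite mem_filter => /andP[/asboolP[/andP[hl _] _ _ _] _].
    apply: ler_pM; [exact: weightv_ge0|by rewrite invr_ge0 exprn_ge0// ltW|exact: VmP|].
    by rewrite lef_pV2 ?posrE ?exprn_gt0// ler_weXn2l// ltW.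
  rewrite big_const_seq count_predT iter_addr_0 -mulr_natl mulrA [leLHS]mulrC.
  apply: ler_wpM2l; first by rewrite invr_ge0 exprn_ge0// ltW.
  have : (size (Aof a))%:R <= (M * M)%:R :> R by rewrite ler_nat.
  rewrite /Q; move: ((size _)%:R) ((M * M)%:R) => x y xy.
  by have := ler_wpM2r (ltW Vm0) xy; lra.
pose N0 := \max_(a <- B) a.2.
(* By [lev_size] a path of this length has level above [N0], so it passes the level of every
   disc. *)
have [p sp hp] := avoiding_path mass_ge0 mass_le_children sumA (2 * N0 + 6).
have massV q : 0 < mass q -> 0 < V (st q).
  by rewrite /mass pmulr_lgt0// invr_gt0 exprn_gt0.
have Vp : 0 < V (st p) by apply: massV; have [_] := hp _ (leqnn _); rewrite -{1}sp take_size.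
have [w mw] := meet_nonempty Vp.
have [mz [y1 Fy1 y1E] [y2 Fy2 y2E]] := node_point mw.
set z := large _ w in mz y1E y2E.
have [a aB za] := cov _ mz.
have aN : (a.2 <= N0)%N by apply: leq_bigmax_seq.
have levp : (a.2 <= lev p)%N.
  by have := lev_size (weightv_lookup Vp); rewrite sp; move: aN; clear; lia.
have ex : exists k, (a.2 <= lev (take k p))%N by exists (size p); rewrite take_size.
(* The first prefix that reaches the level of the disc around z belongs to [A], which the path
   avoids. *)
have [k hk kmin] := ex_minnP ex.
have kN : (k <= 2 * N0 + 6)%N by rewrite -sp; apply: kmin; rewrite take_size.
have [notA mk] := hp _ kN; case/negP: notA.
have Vk := massV _ mk.
have hk4 : (lev (take k p) <= a.2 + 4)%N.
  case: k hk kmin kN {mk Vk} => [|k] hk kmin kN; first by rewrite take0.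
  rewrite (take_nth false) ?sp// lev_rcons; have := lvl_le5 (nth false p k) (st (take k p)).
  have : (lev (take k p) < a.2)%N by rewrite ltnNge; apply/negP => /kmin; rewrite ltnn.
  move: (lev (take k p)) (lvl _ _) a.2; clear; lia.
have [x [y [ux vy]]] := node_run_word (node_run root_node (take k p)) (drop k p).
have pE : node_run (node_run root_node (take k p)) (drop k p) = node_run root_node p.
  by rewrite /node_run -foldl_cat cat_take_drop.
rewrite pE in ux vy.
apply/flattenP; exists (Aof a); first exact: map_f.
rewrite mem_filter mem_undup mem_paths_upto ?andbT; last first.
  by apply: leq_trans (lev_size (weightv_lookup Vk)) _; move: (lev (take k p)) a.2 hk4; clear; lia.
apply/asboolP; split=> //; first by rewrite hk.
- exists (fword b x y1); first exact: tile_fword.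
  by rewrite -fword_cat -ux y1E.
- exists (fword b y y2); first exact: tile_fword.
  by rewrite -fword_cat -vy y2E.
Qed.

End Mass.

(** * The root mu *)

Definition push_digit (a : Z) (d : nat) : Z := Z.add (Z.mul 10 a) (Z.of_nat d).
Arguments push_digit : simpl never.

Lemma decimal_expansionE (R : realType) n (ds : seq nat) :
  decimal_expansion R n ds * 10 ^+ size ds
    = zr R (foldl push_digit (Z.of_nat n) ds).
Proof.
elim: ds n => [|d ds IH] n; first by rewrite /decimal_expansion /= addr0 expr0 mulr1 zr_nat.
rewrite [foldl _ _ _]/= (_ : push_digit _ _ = Z.of_nat (10 * n + d)); last by rewrite /push_digit; lia.
rewrite -IH /decimal_expansion [foldr _ _ (d :: ds)]/= [size (d :: ds)]/= exprS.
by rewrite natrD natrM; field.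
Qed.

Lemma rounds_to_zr (R : realType) (x : R) n (ds : seq nat) :
  let N := foldl push_digit (Z.of_nat n) ds in
  zr R (2 * N - 1)%coq_Z <= x * zr R (2 * Z.pow 10 (Z.of_nat (size ds)))%coq_Z <= zr R (2 * N + 1)%coq_Z ->
  rounds_to x n ds.
Proof.
move=> N; rewrite /rounds_to zrB zrD zrM zrM zr1 zrX (zr_nat _ 2) (zr_nat _ 10).
have := decimal_expansionE R n ds; rewrite -/N => DE /andP[h1 h2].
have k0 : 0 < (10 : R) ^+ size ds by rewrite exprn_gt0.
rewrite ler_pdivlMr// -[X in _ * X](gtr0_norm k0) -normrM mulrBl DE ler_norml.
by apply/andP; split; lra.
Qed.

Definition pmul (k l : seq Z) : seq Z :=
  foldr (fun c m => padd (pscale c l) (0%coq_Z :: m)) [::] k.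

Lemma pev_mul (K : comNzRingType) (x : K) k l : pev x (pmul k l) = pev x k * pev x l.
Proof.
elim: k => [|c k IH]; first by rewrite /= mul0r.
by rewrite [pmul _ _]/= pev_add pev_scale [pev x (_ :: _)]/= IH [pev x (c :: k)]/= zr0; ring.
Qed.

(* [pabs l] and [pdabs l] dominate a polynomial and its derivative. *)
Definition pabs (l : seq Z) : seq Z := map Z.abs l.
Fixpoint pdabs (l : seq Z) : seq Z :=
  if l is _ :: l' then padd (pabs l') (0%coq_Z :: pdabs l') else [::].

Lemma normc_zr (R : realType) n : normc (zr R[i] n) = zr R (Z.abs n).
Proof.
rewrite zr_complex normc_real; case: (Z.abs_spec n) => -[h ->].
  by rewrite ger0_norm// -(zr0 R) zr_le; lia.
by rewrite zrN ltr0_norm// -(zr0 R) zr_lt; lia.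
Qed.

Lemma pev_abs_le (R : realType) (x : R[i]) (x0 : R) l : normc x <= x0 ->
  normc (pev x l) <= pev x0 (pabs l).
Proof.
move=> h; elim: l => [|c l IH]; first by rewrite /= expr0n/= addr0 sqrtr0.
apply: (le_trans (normcD _ _)); rewrite normc_zr [pev x0 _]/= lerD2l normcM.
by apply: ler_pM => //; exact: normc_ge0.
Qed.

Lemma pev_lipschitz (R : realType) (x y : R[i]) (x0 : R) l : normc x <= x0 -> normc y <= x0 ->
  normc (pev x l - pev y l) <= normc (x - y) * pev x0 (pdabs l).
Proof.
move=> hx hy; elim: l => [|c l IH]; first by rewrite /= subr0 expr0n/= addr0 sqrtr0 mulr0.
have -> : pev x (c :: l) - pev y (c :: l) = x * (pev x l - pev y l) + (x - y) * pev y l.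
  by rewrite /=; ring.
apply: (le_trans (normcD _ _)); rewrite !normcM [pdabs _]/= pev_add [pev x0 (_ :: _)]/= zr0 add0r.
rewrite addrC mulrDr; apply: lerD.
  by rewrite ler_wpM2l ?normc_ge0//; exact: pev_abs_le.
rewrite mulrCA; apply: ler_pM; rewrite ?normc_ge0//.
Qed.

(* A polynomial [g0 + g1 x + ...] whose linear term dominates the derivative
   of the rest on a disc is injective there. *)
Lemma pev_disc_inj (R : realType) (x y : R[i]) (x0 : R) g0 g1 l : normc x <= x0 -> normc y <= x0 ->
  pev x0 (pdabs (0%coq_Z :: 0%coq_Z :: l)) < zr R (Z.abs g1) ->
  pev x (g0 :: g1 :: l) = pev y (g0 :: g1 :: l) -> x = y.
Proof.
move=> hx hy hd E; apply/eqP; rewrite -subr_eq0 -normc_eq0; apply: contraT => xy.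
have xy0 : 0 < normc (x - y) by rewrite lt_def xy normc_ge0.
have := pev_lipschitz (0%coq_Z :: 0%coq_Z :: l) hx hy.
have -> : pev x (0%coq_Z :: 0%coq_Z :: l) - pev y (0%coq_Z :: 0%coq_Z :: l) = - (zr R[i] g1 * (x - y)).
  move/eqP: E; rewrite -subr_eq0 => /eqP; rewrite /= zr0 => E.
  by rewrite -[LHS]subr0 -{3}E; ring.
by rewrite normcN normcM normc_zr mulrC ler_pM2l// leNgt hd.
Qed.

Definition mu_full : seq Z := mu_coefs ++ [:: 1%coq_Z].

Lemma mu_polyE (K : comNzRingType) (x : K) : (mu_poly K).[x] = pev x mu_full.
Proof.
have zneg p : zr K (Zneg p) = - zr K (Zpos p) by rewrite -zrN.
rewrite /mu_poly !hornerE /pev /mu_full /mu_coefs /= !zneg zr0 zr1 (zr_nat _ 2) (zr_nat _ 3).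
ring.
Qed.

(* An approximation of the power series of [(1 - mu x) / x^21 P(1/x)], where
   [P] is [mu_poly]; it makes all the roots of the reciprocal polynomial but
   the smallest one disappear. *)
Definition cofactor : seq Z :=
  [:: 100; -31; -131; 0; 0; 100; 69; -62; -162; -31; 269; -124; -224; 107; 145; 452; 235;
      -682; -982; 311; 1232; 81; -315; -443; -694; 931; 512; -2549; -1637; 3831; 4611;
      -384; -3581; -6364; -2597]%coq_Z.

Definition recip_prod : seq Z := pmul (rev mu_full) cofactor.

(** Since 1/mu < 0.763321, this is the hypothesis of [pev_disc_inj] on the disc |x| <= 1/mu. *)
Lemma recip_prod_check :
  Z.ltb 0 (plow 0 763321000 1000000000
    (padd [:: Z.abs (nth 0%coq_Z recip_prod 1)]
       (pscale (-1)%coq_Z (pdabs (0%coq_Z :: 0%coq_Z :: drop 2 recip_prod))))).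
Proof. by vm_compute. Qed.

Lemma pev_rev (K : fieldType) (x : K) l : x != 0 ->
  x ^+ (size l).-1 * pev x^-1 l = pev x (rev l).
Proof.
elim: l => [|c l IH] x0; first by rewrite mulr0.
rewrite rev_cons -cats1 pev_cat size_rev -IH//= mulr0 addr0.
case: l {IH} => [|d l]; first by rewrite /= !(mulr0, mul0r, addr0, mul1r, add0r).
rewrite [size _]/= [_.-1]/= mulrDr addrC; congr (_ + _).
by rewrite exprSr -mulrA mulVKf.
Qed.

Section Mu.
Variable R : realType.

Lemma mu_exists : exists2 mu : R, mu_spec mu & root (mu_poly R) mu.
Proof.
set D := zr R 1000000000%coq_Z.
have D0 : 0 < D by rewrite -(zr0 R) zr_lt.
pose lo := zr R 1310065735%coq_Z / D; pose hi := zr R 1310065736%coq_Z / D.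
have loD : lo * D = zr R 1310065735%coq_Z by rewrite divfK// gt_eqF.
have hiD : hi * D = zr R 1310065736%coq_Z by rewrite divfK// gt_eqF.
have lohi : lo <= hi by rewrite -(ler_pM2r D0) loD hiD zr_le.
have pos (x : R) l n : zr R n <= x * D <= zr R n -> Z.leb 0 n ->
    Z.leb 0 (plow n n 1000000000 l) -> 0 <= pev x l.
  move=> xn n0 h; have := @plowP _ x n n _ l D0 n0 xn.
  have Dl : 0 < D ^+ size l by rewrite exprn_gt0.
  move=> h2; rewrite -(pmulr_lge0 _ Dl); apply: le_trans h2.
  by rewrite -(zr0 R) zr_le.
have f_lo : (mu_poly R).[lo] <= 0.
  rewrite mu_polyE -oppr_ge0 -mulN1r.
  have <- : zr R (-1)%coq_Z = -1 by rewrite (zrN _ 1%coq_Z) zr1.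
  rewrite -pev_scale; apply: (pos _ _ 1310065735%coq_Z) => //; first by rewrite loD lexx.
have f_hi : 0 <= (mu_poly R).[hi].
  by rewrite mu_polyE; apply: (pos _ _ 1310065736%coq_Z) => //; rewrite hiD lexx.
have [|mu /andP[mulo muhi] rt] := poly_ivt lohi (p := mu_poly R); first by rewrite f_lo.
exists mu => //; split; last by rewrite -loD -hiD !ler_pM2r// mulo.
by move: rt; rewrite rootE mu_polyE /mu_full pev_cat [pev mu [:: _]]/= zr1 mulr0 addr0 mulr1 => /eqP.
Qed.

(** For a root w with |w| >= mu, both 1/w and 1/mu are zeros of [recip_prod] in the disc |x| <=
    1/mu. The product is injective there, so w = mu. *)
Lemma mu_dominant (mu : R) : mu_spec mu -> root (mu_poly R) mu ->
  dominant_root (mu_poly R[i]) mu%:C.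
Proof.
move=> muP rt; have mu1 := mu_gt1 muP; have mu0 := lt_trans ltr01 mu1.
have rtC : root (mu_poly R[i]) mu%:C.
  move: rt; rewrite !rootE !mu_polyE => /eqP h.
  have -> : pev mu%:C mu_full = (pev mu mu_full)%:C.
    elim: mu_full => [//|c l IH]; rewrite [LHS]/= [pev mu _]/= IH zr_complex.
    by rewrite rmorphD rmorphM.
  by rewrite h.
split=> // w rw wmu; rewrite ltNge normc_real ger0_norm ?(ltW mu0)//; apply/negP => muw.
have w0 : w != 0 by rewrite -normc_gt0; exact: lt_le_trans muw.
have mc0 : mu%:C != 0 :> R[i] by rewrite -normc_gt0 normc_real normr_gt0 gt_eqF.
have key (z : R[i]) : z != 0 -> root (mu_poly R[i]) z -> pev z^-1 recip_prod = 0.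
  move=> z0; rewrite rootE mu_polyE => /eqP h; rewrite /recip_prod pev_mul -pev_rev ?invr_neq0//.
  by rewrite invrK h mulr0 mul0r.
case/eqP: wmu; apply: invr_inj.
have E : recip_prod = nth 0%coq_Z recip_prod 0 :: nth 0%coq_Z recip_prod 1 :: drop 2 recip_prod.
  by vm_compute.
apply: (@pev_disc_inj _ _ _ mu^-1 (nth 0%coq_Z recip_prod 0) (nth 0%coq_Z recip_prod 1) (drop 2 recip_prod)).
- by rewrite normcV lef_pV2 ?posrE// normc_gt0.
- by rewrite normcV normc_real gtr0_norm.
- have D0 : 0 < zr R 1000000000%coq_Z by rewrite -(zr0 R) zr_lt.
  have mb : zr R 0%coq_Z <= mu^-1 * zr R 1000000000%coq_Z <= zr R 763321000%coq_Z.
    rewrite zr0 mulr_ge0 ?invr_ge0 ?(ltW mu0) ?(ltW D0)//= mulrC ler_pdivrMr//.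
    have [_ /andP[h _]] := muP; rewrite -(ler_pM2r D0) -mulrA.
    apply: le_trans (ler_wpM2l _ h); last by rewrite -(zr0 R) zr_le.
    by rewrite -!zrM zr_le.
  have := recip_prod_check; rewrite -(zr_lt R) zr0 => /lt_le_trans /(_ (@plowP R mu^-1 0%coq_Z 763321000%coq_Z _ _ D0 isT mb)).
  rewrite pmulr_lgt0 ?exprn_gt0// pev_add pev_scale (zrN _ 1%coq_Z) zr1 mulN1r subr_gt0.
  by rewrite [pev _ [:: _]]/= mulr0 addr0.
- by rewrite -E !key.
Qed.

Lemma ln_ratio_ge (x y : R) p q : 1 < x -> 1 < y -> (0 < q)%N -> y ^+ p <= x ^+ (2 * q) ->
  p%:R / q%:R <= 2 * ln x / ln y.
Proof.
move=> x1 y1 q0 h; have x0 := lt_trans ltr01 x1; have y0 := lt_trans ltr01 y1.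
have ly := ln_gt0 y1; have q0' : 0 < q%:R :> R by rewrite ltr0n.
rewrite ler_pdivrMr// [leRHS]mulrAC ler_pdivlMr//.
move: h; rewrite -ler_ln ?posrE ?exprn_gt0// !lnXn// -[ln y *+ _]mulr_natl -[ln x *+ _]mulr_natl natrM => h.
by rewrite mulrAC.
Qed.

Lemma ln_ratio_le (x y : R) p q : 1 < x -> 1 < y -> (0 < q)%N -> x ^+ (2 * q) <= y ^+ p ->
  2 * ln x / ln y <= p%:R / q%:R.
Proof.
move=> x1 y1 q0 h; have x0 := lt_trans ltr01 x1; have y0 := lt_trans ltr01 y1.
have ly := ln_gt0 y1; have q0' : 0 < q%:R :> R by rewrite ltr0n.
rewrite ler_pdivlMr// mulrAC ler_pdivrMr//.
move: h; rewrite -ler_ln ?posrE ?exprn_gt0// !lnXn// -[ln y *+ _]mulr_natl -[ln x *+ _]mulr_natl natrM => h.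
by rewrite mulrAC.
Qed.

End Mu.

(* Upper and lower bounds for powers, in fixed point arithmetic with
   denominator [d]. *)
Fixpoint powup (d x : Z) (n : positive) : Z :=
  match n with
  | xH => x
  | xO m => let y := powup d x m in Z.div (y * y) d + 1
  | xI m => let y := powup d x m in Z.div ((Z.div (y * y) d + 1) * x) d + 1
  end%coq_Z.

Fixpoint powlow (d x : Z) (n : positive) : Z :=
  match n with
  | xH => x
  | xO m => let y := powlow d x m in Z.div (y * y) d
  | xI m => let y := powlow d x m in Z.div (Z.div (y * y) d * x) d
  end%coq_Z.

Section Powers.
Variables (R : realType) (d : Z).
Hypothesis d0 : Z.lt 0 d.

Let D0 : 0 < zr R d. Proof. by rewrite -(zr0 R) zr_lt; lia. Qed.

Lemma powupP (x : Z) (y : R) n : 0 <= y -> y * zr R d <= zr R x ->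
  y ^+ Pos.to_nat n * zr R d <= zr R (powup d x n).
Proof.
move=> y0 yx.
have step (a c : R) m k : 0 <= a -> 0 <= c -> a * zr R d <= zr R m -> c * zr R d <= zr R k ->
    a * c * zr R d <= zr R (Z.div (m * k) d + 1).
  move=> a0 c0 am ck; rewrite -(ler_pM2r D0).
  have -> : a * c * zr R d * zr R d = (a * zr R d) * (c * zr R d) by ring.
  apply: (@le_trans _ _ (zr R m * zr R k)).
    by apply: ler_pM => //; rewrite mulr_ge0// ltW.
  by rewrite -!zrM zr_le; have := Z.mul_succ_div_gt (m * k) d d0; lia.
have yn k : 0 <= y ^+ k by rewrite exprn_ge0.
elim: n => [n IH|n IH|]; last by rewrite expr1.
  have -> : Pos.to_nat n~1 = (Pos.to_nat n + Pos.to_nat n + 1)%N by lia.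
  by rewrite !exprD expr1 /=; apply: (step _ _ _ _ (mulr_ge0 _ _)) => //; exact: step.
have -> : Pos.to_nat n~0 = (Pos.to_nat n + Pos.to_nat n)%N by lia.
by rewrite exprD /=; exact: step.
Qed.

Lemma powlowP (x : Z) (y : R) n : Z.le 0 x -> zr R x <= y * zr R d ->
  Z.le 0 (powlow d x n) /\ zr R (powlow d x n) <= y ^+ Pos.to_nat n * zr R d.
Proof.
move=> x0 xy.
have step (a c : R) m k : Z.le 0 m -> Z.le 0 k -> zr R m <= a * zr R d -> zr R k <= c * zr R d ->
    Z.le 0 (Z.div (m * k) d) /\ zr R (Z.div (m * k) d) <= a * c * zr R d.
  move=> m0 k0 am ck; split; first by apply: Z.div_pos; lia.
  rewrite -(ler_pM2r D0).
  have -> : a * c * zr R d * zr R d = (a * zr R d) * (c * zr R d) by ring.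
  apply: (@le_trans _ _ (zr R m * zr R k)).
    by rewrite -!zrM zr_le; have := Z.mul_div_le (m * k) d d0; lia.
  by apply: ler_pM => //; rewrite -(zr0 R) zr_le; lia.
elim: n => [n [p0 IH]|n [p0 IH]|]; last by rewrite expr1.
  have -> : Pos.to_nat n~1 = (Pos.to_nat n + Pos.to_nat n + 1)%N by lia.
  have [q0 hq] := step _ _ _ _ p0 p0 IH IH.
  by rewrite !exprD expr1 /=; exact: step.
have -> : Pos.to_nat n~0 = (Pos.to_nat n + Pos.to_nat n)%N by lia.
by rewrite exprD /=; exact: step.
Qed.

End Powers.

(** * The conjugate of alpha *)

(** At points of [K] outside [L] the radius is so small that the ball misses [L]; these balls are
    discarded afterwards. *)
Lemma ball_cover_setI (R : realType) (K L : set R[i]) :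
  ball_cover_compact K -> ball_cover_compact L -> ball_cover_compact (K `&` L).
Proof.
move=> cK cL e epos.
have dP p : exists d : R, K p -> 0 < d /\ ((L p /\ d = e p) \/ (forall w, L w -> d <= normc (w - p))).
  have [[Kp|nKp] [Lp|nLp]] := (pselect (K p), pselect (L p)); try by exists 0.
    by exists (e p) => _; split; [exact: epos|left].
  by have [d d0 Hd] := ball_cover_closed cL nLp; exists d => _; split=> //; right.
have [d dE] := boolp.choice dP.
have [s sK Ks] := cK d (fun p Kp => (dE p Kp).1).
exists [seq p <- s | `[< L p >]] => [p|q [Kq Lq]].
  by rewrite mem_filter => /andP[/asboolP Lp /sK].
have [p ps qp] := Ks _ Kq; have [_ [[Lp dp]|H]] := dE p (sK _ ps).
  by exists p; rewrite -?dp// mem_filter ps andbT; exact/asboolP.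
by have := H _ Lq; rewrite leNgt qp.
Qed.

(** The values of the scaled cubic at y and at its root x differ by (y - x)(y^2 + xy + x^2 - D^2),
    whose second factor is nonnegative once 3 y^2 >= 4 D^2. So the sign at an integer y locates the
    root. *)
Lemma plastic_bounds (R : realType) (beta : R) : beta ^+ 3 = beta + 1 ->
  zr R 1324717957%coq_Z <= beta * zr R 1000000000%coq_Z <= zr R 1324717958%coq_Z.
Proof.
move=> b3; set D := zr R 1000000000%coq_Z.
have D0 : 0 < D by rewrite -(zr0 R) zr_lt.
set x := beta * D; have x3 : x ^+ 3 = x * D ^+ 2 + D ^+ 3.
  have -> : x ^+ 3 = beta ^+ 3 * D ^+ 3 by rewrite /x; ring.
  by rewrite b3 /x; ring.
move: x x3 => x x3.
have quad y : 4 * D ^+ 2 <= 3 * y ^+ 2 -> 0 <= y ^+ 2 + x * y + x ^+ 2 - D ^+ 2.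
  move=> h; have : 0 <= (2 * x + y) ^+ 2 by exact: sqr_ge0.
  have -> : (2 * x + y) ^+ 2 = 4 * x ^+ 2 + 4 * (x * y) + y ^+ 2 by ring.
  by lra.
apply/andP; split; rewrite leNgt; apply/negP.
  set y := zr R 1324717957%coq_Z => xy.
  have hy : y ^+ 3 < y * D ^+ 2 + D ^+ 3 by rewrite !exprS !expr0 !mulr1 -!zrM -zrD zr_lt.
  have hq : 4 * D ^+ 2 <= 3 * y ^+ 2.
    by rewrite !exprS !expr0 !mulr1 -(zr_nat _ 4) -(zr_nat _ 3) -!zrM zr_le.
  have := mulr_ge0 (ltW (_ : 0 < y - x)) (quad _ hq); rewrite subr_gt0 => /(_ xy).
  have -> : (y - x) * (y ^+ 2 + x * y + x ^+ 2 - D ^+ 2)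
    = y ^+ 3 - x ^+ 3 - y * D ^+ 2 + x * D ^+ 2 by ring.
  by rewrite x3 leNgt => /negP; apply; lra.
set y := zr R 1324717958%coq_Z => xy.
have hy : y * D ^+ 2 + D ^+ 3 < y ^+ 3 by rewrite !exprS !expr0 !mulr1 -!zrM -zrD zr_lt.
have hq : 4 * D ^+ 2 <= 3 * y ^+ 2.
  by rewrite !exprS !expr0 !mulr1 -(zr_nat _ 4) -(zr_nat _ 3) -!zrM zr_le.
have := mulr_ge0 (ltW (_ : 0 < x - y)) (quad _ hq); rewrite subr_gt0 => /(_ xy).
have -> : (x - y) * (y ^+ 2 + x * y + x ^+ 2 - D ^+ 2)
  = x ^+ 3 - y ^+ 3 + y * D ^+ 2 - x * D ^+ 2 by ring.
by rewrite x3 leNgt => /negP; apply; lra.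
Qed.

Section Alpha.
Variables (R : realType) (alpha : R).
Hypothesis alpha_root : root (alpha_poly R) alpha.
Let beta := tent_beta alpha.

Let alpha3 : alpha ^+ 3 = 5 * alpha ^+ 2 - 4 * alpha + 1.
Proof.
move: alpha_root; rewrite rootE /alpha_poly !hornerE => /eqP h.
by apply/eqP; rewrite -subr_eq0 -[X in _ == X]h; apply/eqP; ring.
Qed.

Let alpha1 : alpha - 1 != 0.
Proof.
apply/eqP => h; have a1 : alpha = 1 by lra.
by move: alpha3; rewrite a1 => e; lra.
Qed.

Lemma tent_beta3 : beta ^+ 3 = beta + 1.
Proof.
rewrite /beta /tent_beta; apply: (mulIf (expf_neq0 3 alpha1)).
have -> : (alpha / (alpha - 1)) ^+ 3 * (alpha - 1) ^+ 3 = alpha ^+ 3 by field.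
have -> : (alpha / (alpha - 1) + 1) * (alpha - 1) ^+ 3
  = 2 * alpha ^+ 3 - 5 * alpha ^+ 2 + 4 * alpha - 1 by field.
by rewrite {2}alpha3 alpha3; ring.
Qed.

Lemma tent_betaE : beta * (alpha - 1) = alpha.
Proof. by rewrite /beta /tent_beta divfK. Qed.

Lemma alpha_rounds : rounds_to alpha 4 [:: 0; 7; 9; 6]%N.
Proof.
apply: rounds_to_zr; rewrite [foldl _ _ _]/= /push_digit.
rewrite (_ : Z.sub _ 1 = 81591%coq_Z)// (_ : Z.add _ 1 = 81593%coq_Z)//.
rewrite (_ : Z.mul 2 _ = 20000%coq_Z)//.
have /andP[h1 h2] := plastic_bounds tent_beta3.
set D := zr R 1000000000%coq_Z in h1 h2; set B := _ * D in h1 h2.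
have BD : alpha * (B - D) = B.
  apply/eqP; rewrite -subr_eq0.
  have -> : alpha * (B - D) - B = (beta * (alpha - 1) - alpha) * D by rewrite /B -/beta; ring.
  by rewrite tent_betaE subrr mul0r.
have BD0 : 0 < B - D by rewrite subr_gt0 (lt_le_trans _ h1)// zr_lt.
(* As alpha = beta / (beta - 1), the bound alpha >= 81591/20000 reads 61591 beta <= 81591; the upper
   bound is similar with 61593 and 81593. *)
have lo : zr R 61591%coq_Z * B <= zr R 61591%coq_Z * zr R 1324717958%coq_Z.
  by rewrite ler_wpM2l// -(zr0 R) zr_le.
have hi : zr R 61593%coq_Z * zr R 1324717957%coq_Z <= zr R 61593%coq_Z * B.
  by rewrite ler_wpM2l// -(zr0 R) zr_le.
have lo' : zr R 61591%coq_Z * B <= zr R 81591%coq_Z * D.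
  by apply: le_trans lo _; rewrite -!zrM zr_le.
have hi' : zr R 81593%coq_Z * D <= zr R 61593%coq_Z * B.
  by apply: le_trans hi; rewrite -!zrM zr_le.
have e1 : zr R 81591%coq_Z = zr R 61591%coq_Z + zr R 20000%coq_Z by rewrite -zrD.
have e3 : zr R 81593%coq_Z = zr R 61593%coq_Z + zr R 20000%coq_Z by rewrite -zrD.
rewrite -(ler_pM2r BD0) -[X in _ && X](ler_pM2r BD0) mulrAC BD.
rewrite -subr_ge0 -[X in _ && X]subr_ge0.
have -> : B * zr R 20000%coq_Z - zr R 81591%coq_Z * (B - D)
  = zr R 81591%coq_Z * D - zr R 61591%coq_Z * B by rewrite e1; ring.
have -> : zr R 81593%coq_Z * (B - D) - B * zr R 20000%coq_Z
  = zr R 61593%coq_Z * B - zr R 81593%coq_Z * D by rewrite e3; ring.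
by rewrite !subr_ge0 lo' hi'.
Qed.

Section Conjugate.
Variables (psi : R -> R[i]).
Hypothesis psi_emb : field_embedding (Qadjoin alpha) psi.
Hypothesis psi_nonreal : complex.Im (psi alpha) != 0.
Let b := psi beta.

Lemma Qadjoin_alpha : Qadjoin alpha alpha.
Proof. by move=> S [_ h]; exact: h. Qed.

Lemma Qadjoin_closed : [/\ Qadjoin alpha 1,
  (forall x y, Qadjoin alpha x -> Qadjoin alpha y -> Qadjoin alpha (x - y)) &
  (forall x y, Qadjoin alpha x -> Qadjoin alpha y -> Qadjoin alpha (x / y))].
Proof.
split.
- by move=> S [[h1 _ _] _]; move: h1; rewrite inE.
- move=> x y hx hy S hS; have [[_ h2 _] _] := hS.
  by have := h2 x y; rewrite !inE; apply; [exact: hx|exact: hy].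
- move=> x y hx hy S hS; have [[_ _ h3] _] := hS.
  by have := h3 x y; rewrite !inE; apply; [exact: hx|exact: hy].
Qed.

Lemma psi_beta3 : b ^+ 3 = b + 1 /\ b * (psi alpha - 1) = psi alpha.
Proof.
have [Q1 QB QV] := Qadjoin_closed; have Qa := Qadjoin_alpha.
have [psi1 psiD psiM] := psi_emb.
have Qa1 := QB _ _ Qa Q1; have Qb : Qadjoin alpha beta by exact: QV.
have QVb : Qadjoin alpha beta^-1 by rewrite -div1r; exact: QV.
have Qbb : Qadjoin alpha (beta * beta) by rewrite -{2}[beta]invrK; exact: QV.
have psia1 : psi (alpha - 1) = psi alpha - 1.
  by have := psiD _ _ Qa1 Q1; rewrite subrK psi1 => ->; rewrite addrK.
split; last by rewrite -psia1 -psiM// tent_betaE.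
rewrite -psi1 -(psiD _ _ Qb Q1) -tent_beta3 !exprS !expr0 !mulr1.
rewrite (psiM _ _ Qb Qbb) (psiM _ _ Qb Qb); reflexivity.
Qed.

(** The image of alpha is b / (b - 1), and b - 1 = b^-4. *)
Lemma psi_alphaE : psi alpha = b ^+ 5.
Proof.
have [p3 pa] := psi_beta3.
have e4 : b ^+ 4 * (b - 1) = 1.
  have -> : b ^+ 4 * (b - 1) = b ^+ 3 * (b ^+ 2 - b) by ring.
  rewrite p3; have -> : (b + 1) * (b ^+ 2 - b) = b ^+ 3 - b by ring.
  by rewrite p3; ring.
have e : psi alpha * (b - 1) = b.
  move: (psi alpha) (b) pa => A c pa; apply/eqP; rewrite -subr_eq0.
  have -> : A * (c - 1) - c = c * (A - 1) - A by ring.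
  by rewrite pa subrr.
have -> : psi alpha = psi alpha * (b ^+ 4 * (b - 1)) by rewrite e4 mulr1.
by rewrite mulrCA e; ring.
Qed.

(** For b = x + iy with y nonzero, the imaginary part of the cubic gives y^2 = 3 x^2 - 1, and then t
    = -2x satisfies t^3 = t + 1. The factor t^2 + t beta + beta^2 - 1 cannot vanish because t^2 >
    4/3, so t = beta. *)
Lemma psi_plastic : plastic_pair beta b.
Proof.
have b3 := tent_beta3; have [p3 _] := psi_beta3.
have /andP[h1 h2] := plastic_bounds b3.
have mb : zr R 1324717%coq_Z <= beta * mega R <= zr R 1324718%coq_Z.
  have k0 : 0 < zr R 1000%coq_Z by rewrite -(zr0 R) zr_lt.
  have mE : mega R * zr R 1000%coq_Z = zr R 1000000000%coq_Z by rewrite /mega -zrM.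
  rewrite -(ler_pM2r k0) -[X in _ && X](ler_pM2r k0) -mulrA mE -!zrM.
  by rewrite (le_trans _ h1) ?(le_trans h2)// zr_le.
have yn0 : complex.Im b != 0.
  apply: contra psi_nonreal => /eqP y0; rewrite psi_alphaE.
  have -> : b = (complex.Re b)%:C by move: y0; case: (b) => u v /= ->.
  by rewrite -rmorphXn.
move: p3 yn0; rewrite /plastic_pair; case: (b) => x y p3 /= y0.
have : (x +i* y) * ((x +i* y) * (x +i* y)) == (x +i* y) + 1.
  by rewrite -p3 !exprS expr0 mulr1.
rewrite eq_complex /= => /andP[/eqP e1 /eqP e2].
have y2 : y ^+ 2 = 3 * x ^+ 2 - 1.
  apply: (mulfI y0); apply/eqP; rewrite -subr_eq0 -oppr_eq0; apply/eqP.
  by move/eqP: e2; rewrite -subr_eq0 => /eqP <-; ring.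
have t3 : (- 2 * x) ^+ 3 = - 2 * x + 1.
  have : x ^+ 3 - 3 * x * y ^+ 2 = x + 1.
    by move/eqP: e1; rewrite -subr_eq0 => /eqP e1; apply/eqP; rewrite -subr_eq0 -[X in _ == X]e1; apply/eqP; ring.
  by rewrite y2 => h; lra.
have tE : - 2 * x = beta.
  set t := - 2 * x in t3 *; apply/eqP; rewrite -subr_eq0.
  have : (t - beta) * (t ^+ 2 + t * beta + beta ^+ 2 - 1) = 0.
    have -> : (t - beta) * (t ^+ 2 + t * beta + beta ^+ 2 - 1)
      = t ^+ 3 - t - (beta ^+ 3 - beta) by ring.
    by rewrite t3 b3; ring.
  move/eqP; rewrite mulf_eq0 => /orP[//|/eqP h].
  have y2' : 0 < y ^+ 2 by rewrite exprn_even_gt0.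
  have x2 : t ^+ 2 = 4 * x ^+ 2 by rewrite /t; ring.
  have s0 : 0 <= (t + 2 * beta) ^+ 2 by exact: sqr_ge0.
  by move: h s0 y2' x2; rewrite y2; move: (x ^+ 2) => X; lra.
have xE : x = - beta / 2 by lra.
split=> //; move/eqP: y2; rewrite -subr_eq0 xE => /eqP y2; apply/eqP; rewrite -subr_eq0 -[X in _ == X]y2.
by apply/eqP; field.
Qed.

End Conjugate.

Lemma tent_tile (psi : R -> R[i]) (F : set R[i]^o) :
  field_embedding (Qadjoin alpha) psi -> complex.Im (psi alpha) != 0 ->
  is_tent_tile psi alpha F -> is_tile (psi beta) F.
Proof.
move=> psi_emb nr [F0 cF FE]; split=> [//||z]; first exact: compact_normc.
have [psi1 _ _] := psi_emb; have aE := psi_alphaE psi_emb.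
split=> [|[s [y [Fy ->]]]].
  rewrite {1}FE => -[[y Fy <-]|[y Fy <-]]; [exists false, y|exists true, y]; split=> //=.
    by rewrite /tent_L aE.
  by rewrite /tent_R psi1.
rewrite FE; case: s => /=; [right|left]; exists y => //.
  by rewrite /tent_R psi1.
by rewrite /tent_L aE.
Qed.

End Alpha.

(** * The dimension of the boundary *)

Section Dimension.
Variables (R : realType) (beta : R) (b : R[i]) (mu : R) (F : set R[i]^o).
Hypothesis pp : plastic_pair beta b.
Hypothesis tF : is_tile b F.
Hypothesis muP : mu_spec mu.
Let r := normc b.
Let s0 : R := 2 * ln mu / ln beta.

Lemma tile_boundaryP z : boundary F z <->
  F z /\ forall e : R, 0 < e -> exists2 w, ~ F w & normc (w - z) < e.
Proof.
have [_ cF _] := tF; split=> [[/closure_normc clF nF]|[Fz H]].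
  split=> [|e e0].
    apply: contrapT => Fz; have [e e0 He] := ball_cover_closed cF Fz.
    by have [w Fw] := clF _ e0; rewrite ltNge He.
  apply: contrapT => H; apply: nF; apply/interior_normc; exists e => // w wz.
  by apply: contrapT => Fw; apply: H; exists w.
split; first by apply/closure_normc => e e0; exists z => //; rewrite subrr normc0.
by move=> /interior_normc[e e0 He]; have [w Fw /He] := H _ e0.
Qed.

Let r0 : 0 < r. Proof. exact: (r_gt0 pp). Qed.
Let r1 : r < 1. Proof. exact: (r_lt1 pp). Qed.
Let mu1 : 1 < mu. Proof. exact: (mu_gt1 muP). Qed.
Let mu0 : 0 < mu. Proof. exact: lt_trans mu1. Qed.
Let beta1 : 1 < beta. Proof. exact: lt_trans mu1 (mu_lt_beta pp muP). Qed.

Lemma similarity_dim_gt0 : 0 < s0.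
Proof. by rewrite divr_gt0 ?mulr_gt0 ?ln_gt0. Qed.

(** From beta |b|^2 = 1. In dimension [s0] a disc of radius |b|^n thus has weight mu^-n. *)
Lemma radius_similarity_dim : r `^ s0 = mu^-1.
Proof.
have lr : ln beta + 2 * ln r = 0.
  by rewrite mulr_natl -lnXn// -lnM ?posrE ?exprn_gt0 ?(beta_gt0 pp)// (beta_r2 pp) ln1.
have lb : ln beta != 0 by rewrite gt_eqF ?ln_gt0.
rewrite /powR gt_eqF// (_ : s0 * ln r = - ln mu) ?expRN ?lnK ?posrE//.
rewrite /s0 (_ : ln r = - ln beta / 2); last by lra.
by field.
Qed.

Let powRX (t : R) n : (r ^+ n) `^ t = (r `^ t) ^+ n.
Proof. by rewrite -(powR_mulrn n (ltW r0)) -(powR_mulrn n (powR_ge0 r t)) powRAC. Qed.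

Lemma boundary_measure0 t : s0 < t -> hausdorff_measure (@complex_dist R) t (boundary F) = 0%E.
Proof.
move=> ts; have t0 := lt_trans similarity_dim_gt0 ts.
have [C C0 HC] := boundary_cover pp tF muP.
apply: hausdorff_measure0_cover => // delta eps d0 e0.
(* About mu^k discs of radius |b|^k contribute O(q^k), and q < 1 exactly because t exceeds [s0]. *)
pose q := mu * r `^ t.
have q0 : 0 <= q by rewrite mulr_ge0 ?powR_ge0 ?ltW.
have q1 : q < 1.
  rewrite -(divff (lt0r_neq0 mu0)) /q ltr_pM2l// -radius_similarity_dim.
  by rewrite /powR gt_eqF// ltr_expR ltr_nM2r// ln_lt0// r0.
pose c := C * mu ^+ 5 * 3 `^ t; have c0 : 0 <= c.
  exact: mulr_ge0 (mulr_ge0 C0 (exprn_ge0 5 (ltW mu0))) (powR_ge0 _ _).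
have [N1 H1] : exists N, forall n, (N <= n)%N -> r ^+ n < delta / 3.
  by apply: pow_small; rewrite ?(ltW r0) ?r1// divr_gt0.
have [N2 H2] : exists N, forall n, (N <= n)%N -> q ^+ n < eps / (c + 1).
  by apply: pow_small; rewrite ?q0 ?q1// divr_gt0// ltr_pwDr.
pose k := maxn N1 N2; have [l lC Hl] := HC (k + 5)%N; rewrite addnK in Hl.
exists (size l), (3 * r ^+ k), (fun i => [set z | normc (z - nth 0 l i) <= 3 / 2 * r ^+ k]); split.
- have rk : 0 <= r ^+ k by exact: exprn_ge0 (ltW r0).
  have := H1 k (leq_maxl _ _); rewrite ltr_pdivlMr// => h1.
  by rewrite mulr_ge0//= mulrC ltW.
- move=> i x y _ /= hx hy; apply: le_trans (normc_dist x (nth 0 l i) y) _.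
  by rewrite -(normcN (_ - y)) opprB; lra.
- move=> z /tile_boundaryP /Hl[a al za]; exists (index a l); first by rewrite index_mem.
  by rewrite /= nth_index.
have := H2 k (leq_maxr _ _); rewrite ltr_pdivlMr ?ltr_pwDr// => h2.
have rk : 0 <= r ^+ k by exact: exprn_ge0 (ltW r0).
have rt : 0 <= (r `^ t) ^+ k by exact: exprn_ge0 (powR_ge0 _ _).
rewrite powRM// powRX mulrA.
apply: (@le_trans _ _ (C * mu ^+ (k + 5) * 3 `^ t * (r `^ t) ^+ k)).
  by rewrite !ler_wpM2r// powR_ge0.
have -> : C * mu ^+ (k + 5) * 3 `^ t * (r `^ t) ^+ k = c * q ^+ k.
  by rewrite /c /q exprD exprMn; ring.
by apply: le_trans (ltW h2); rewrite mulrC ler_wpM2l ?exprn_ge0// lerDl.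
Qed.

Lemma radius_index (x : R) : 0 < x <= 1 -> exists2 n, r ^+ n <= x & x * r <= r ^+ n.
Proof.
move=> /andP[x0 x1].
have ex : exists n, r ^+ n <= x.
  have [|N HN] := @pow_small _ r x _ x0; first by rewrite r1 ltW.
  by exists N; exact/ltW/HN.
exists (ex_minn ex); case: ex_minnP => [[|n]] // h hmin.
  by rewrite mulr_ile1// ltW.
rewrite exprSr ler_pM2r//; rewrite leNgt; apply/negP => /ltW /hmin.
by rewrite ltnn.
Qed.

(** A cover by balls of total at most c/2 contradicts [cover_mass]: each radius x <= 1 is rounded
    down to a power |b|^n, and mu^-n = |b|^(n s0) <= x^s0 <= x^t. The loss in rounding is the factor
    [r] in [cover_mass]. *)
Lemma boundary_measure_neq0 t : 0 <= t < s0 ->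
  hausdorff_measure (@complex_dist R) t (boundary F) <> 0%E.
Proof.
move=> /andP[t0 ts] H0; have [c c0 Hc] := cover_mass pp tF muP.
have [_ cF _] := tF; have start := g_start_lookup.
have KF : meet b F g_start `<=` boundary F.
  by move=> z Kz; apply/tile_boundaryP; split; [case: Kz|exact: (meet_boundary pp tF muP start Kz)].
clear start.
have cK : ball_cover_compact (meet b F g_start).
  have := ball_cover_setI cF (act_image_compact pp tF (g := g_start)).
  congr ball_cover_compact.
  by apply/seteqP; split=> z [Fz [y Fy e]]; split=> //; exists y.
have [B [B01 KB SB]] := hausdorff_measure0_balls t0 H0 KF cK (divr_gt0 c0 (ltr0Sn _ 1)).
have nP (a : R[i] * R) : exists n, 0 < a.2 <= 1 -> r ^+ n <= a.2 /\ a.2 * r <= r ^+ n.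
  have [/radius_index[n h1 h2]|//] := boolP (0 < a.2 <= 1); last by exists 0%N.
  by exists n.
have [nn nnP] := boolp.choice nP.
have : c <= \sum_(a <- [seq (a.1, nn a) | a <- B]) mu ^- a.2.
  apply: Hc => z /KB[a aB za]; exists (a.1, nn a); first by apply/mapP; exists a.
  have [_ h] := nnP a (B01 _ aB); apply: le_trans h.
  by rewrite ler_wpM2r ?(ltW r0)// ltW.
apply/negP; rewrite -ltNge big_map; apply: le_lt_trans (_ : c / 2 < c); last by lra.
apply: le_trans SB; rewrite big_seq [leRHS]big_seq; apply: ler_sum => a aB /=.
have a01 := B01 _ aB; have [h _] := nnP _ a01; have /andP[a0 a1] := a01.
rewrite -exprVn -radius_similarity_dim -powRX.
apply: (@le_trans _ _ (a.2 `^ s0)).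
  apply: (ge0_ler_powR (ltW similarity_dim_gt0) _ _ h); rewrite nnegrE ?(ltW a0)//.
  exact: exprn_ge0 (ltW r0).
by apply: ger_powR; rewrite ?a0// ltW.
Qed.

Theorem hausdorff_dim_boundary : hausdorff_dim (@complex_dist R) (boundary F) = s0%:E.
Proof.
apply: hausdorff_dimE; [exact/ltW/similarity_dim_gt0|exact: boundary_measure0|exact: boundary_measure_neq0].
Qed.

End Dimension.

Lemma mu_rounds (R : realType) (mu : R) : mu_spec mu -> rounds_to mu 1 [:: 3; 1; 0; 0; 7]%N.
Proof.
move=> [_ /andP[h1 h2]]; apply: rounds_to_zr; rewrite [foldl _ _ _]/= /push_digit.
rewrite (_ : Z.sub _ 1 = 262013%coq_Z)// (_ : Z.add _ 1 = 262015%coq_Z)//.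
rewrite (_ : Z.mul 2 _ = 200000%coq_Z)//.
have k0 : 0 < zr R 5000%coq_Z by rewrite -(zr0 R) zr_lt.
rewrite -(ler_pM2r k0) -[X in _ && X](ler_pM2r k0) -mulrA -!zrM.
rewrite (_ : Z.mul 200000 _ = 1000000000%coq_Z)//.
by rewrite (le_trans _ h1) ?(le_trans h2)// zr_le.
Qed.

(* The rationals 607/316 and 2234/1163 lie on either side of the dimension, within
   half a unit of its fifth decimal. *)
Lemma power_check :
  Z.leb (powup 1000000000 1324717958 607) (powlow 1000000000 1310065735 632) /\
  Z.leb (powup 1000000000 1310065736 2326) (powlow 1000000000 1324717957 2234).
Proof. by split; vm_compute. Qed.

Lemma dimension_rounds (R : realType) (beta mu : R) :
  beta ^+ 3 = beta + 1 -> mu_spec mu ->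
  rounds_to (2 * ln mu / ln beta) 1 [:: 9; 2; 0; 8; 9]%N.
Proof.
move=> b3 muP; have /andP[b1 b2] := plastic_bounds b3; have [_ /andP[m1 m2]] := muP.
have d0 : Z.lt 0 1000000000 by [].
have D0 : 0 < zr R 1000000000%coq_Z by rewrite -(zr0 R) zr_lt.
have mu1 := mu_gt1 muP.
have beta1 : 1 < beta.
  by rewrite -(ltr_pM2r D0) mul1r; apply: lt_le_trans b1; rewrite zr_lt.
have [c1 c2] := power_check.
have B0 := ltW (lt_trans ltr01 beta1); have M0 := ltW (lt_trans ltr01 mu1).
have := powupP d0 607 B0 b2; have [_] := @powlowP R _ d0 1310065735%coq_Z mu 632 (Pos2Z.pos_is_nonneg _) m1.
have := powupP d0 2326 M0 m2; have [_] := @powlowP R _ d0 1324717957%coq_Z beta 2234 (Pos2Z.pos_is_nonneg _) b1.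
move: c1 c2; rewrite -!(zr_le R).
move: (powup _ _ _) (powlow _ _ _) (powup _ _ _) (powlow _ _ _) => u1 l1 u2 l2 c1 c2 hl2 hu2 hl1 hu1.
have lo : beta ^+ 607 <= mu ^+ 632.
  by rewrite -(ler_pM2r D0); exact: le_trans hu1 (le_trans c1 hl1).
have hi : mu ^+ 2326 <= beta ^+ 2234.
  by rewrite -(ler_pM2r D0); exact: le_trans hu2 (le_trans c2 hl2).
have := ln_ratio_ge mu1 beta1 (isT : (0 < 316)%N) lo.
have := ln_ratio_le mu1 beta1 (isT : (0 < 1163)%N) hi.
move: (2 * ln mu / ln beta) => x; clear -x.
rewrite ler_pdivlMr ?ltr0n// ler_pdivrMr ?ltr0n// -!zr_nat => xhi xlo.
apply: rounds_to_zr; rewrite [foldl _ _ _]/= /push_digit.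
rewrite (_ : Z.sub _ 1 = 384177%coq_Z)// (_ : Z.add _ 1 = 384179%coq_Z)//.
rewrite (_ : Z.mul 2 _ = 200000%coq_Z)//.
have k0 : 0 <= zr R 200000%coq_Z by rewrite -(zr0 R) zr_le.
have p0 n : (0 < n)%N -> 0 < zr R (Z.of_nat n) by rewrite zr_nat ltr0n.
apply/andP; split.
  rewrite -(ler_pM2r (p0 316%N isT)) mulrAC -zrM.
  by apply: le_trans (ler_wpM2r k0 xlo); rewrite -zrM zr_le.
rewrite -(ler_pM2r (p0 1163%N isT)) mulrAC -zrM.
by apply: le_trans (ler_wpM2r k0 xhi) _; rewrite -zrM zr_le.
Qed.

Theorem theorem5p8 (R : realType) (alpha : R) (alpha' : R[i])
    (psi : R -> R[i]) (F : set R[i]^o)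
    (alpha_root : root (alpha_poly R) alpha)
    (alpha'_conj : galois_conjugate alpha alpha')
    (alpha'_nonreal : complex.Im alpha' != 0)
    (psi_emb : field_embedding (Qadjoin alpha) psi)
    (psi_alpha : psi alpha = alpha')
    (F_tile : is_tent_tile psi alpha F) :
  rounds_to alpha 4 [:: 0; 7; 9; 6]%N /\
  exists mu : R,
    [/\ dominant_root (mu_poly R[i]) mu%:C,
        rounds_to mu 1 [:: 3; 1; 0; 0; 7]%N,
        hausdorff_dim (@complex_dist R) (boundary F)
          = (2 * ln mu / ln (tent_beta alpha))%:E
      & rounds_to (2 * ln mu / ln (tent_beta alpha)) 1 [:: 9; 2; 0; 8; 9]%N].
Proof.
split; first exact: alpha_rounds.
have [mu muP mu_root] := mu_exists R; exists mu.
have nonreal : complex.Im (psi alpha) != 0 by rewrite psi_alpha.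
split.
- exact: mu_dominant.
- exact: mu_rounds.
- exact: (hausdorff_dim_boundary (psi_plastic alpha_root psi_emb nonreal)
            (tent_tile alpha_root psi_emb nonreal F_tile) muP).
- exact: dimension_rounds (tent_beta3 alpha_root) muP.
Qed.
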